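(* For each $n\in\{2,3,4\}$ and each integer $k\geq 1$, there exists a polynomial $Q_{n,k}(t)\in\mathbb{Z}[t]$ with non-negative integer coefficients such that $c_{n,k}(q)=Q_{n,k}(q)$ for every prime power $q$.
   Context: For a prime power $q$, $\mathbb{F}_q$ is the field with $q$ elements. $M_n(\mathbb{F}_q)^{(k)}$ is the set of $k$-tuples of pairwise commuting $n\times n$ matrices over $\mathbb{F}_q$. $GL_n(\mathbb{F}_q)$ acts on it by simultaneous conjugation, $g\cdot(A_1,\ldots,A_k) = (gA_1g^{-1},\ldots,gA_kg^{-1})$, and $c_{n,k}(q)$ is the number of orbits. *)

(* Defs.v *)
From mathcomp Require Import all_boot all_order all_algebra all_fingroup.

Set Implicit Arguments.
Unset Strict Implicit.
Unset Printing Implicit Defensive.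

Import GRing.Theory.
Local Open Scope ring_scope.

(* MathComp's {'GL_n[F]} is the group of units of 'M[F]_n.-1.+1, so the         *)
(* matrices below have size n.-1.+1, which is n as soon as n > 0.               *)

Section CommutingTuples.

Variables (F : finFieldType) (n k : nat).

Definition commuting_tuples : {set k.-tuple 'M[F]_n.-1.+1} :=
  [set A : k.-tuple 'M[F]_n.-1.+1 | all2rel (@comm_mxb F n.-1.+1) A].

Definition sim_conj (g : {'GL_n[F]}) (A : k.-tuple 'M[F]_n.-1.+1) :
    k.-tuple 'M[F]_n.-1.+1 :=
  [tuple of [seq GLval g *m X *m invmx (GLval g) | X <- A]].

(* MathComp actions are right actions: the left action sim_conj is turned into  *)
(* one by letting g act as g^-1, which does not change the orbits.              *)
Definition sim_conj_right (A : k.-tuple 'M[F]_n.-1.+1) (g : {'GL_n[F]}) :=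
  sim_conj g^-1%g A.

Lemma sim_conj_right1 : sim_conj_right^~ 1%g =1 id.
Proof.
move=> A; apply: eq_from_tnth => i; rewrite tnth_map.
by rewrite invg1 GL_1E invmx1 mul1mx mulmx1.
Qed.

Lemma sim_conj_rightM : forall A, act_morph sim_conj_right A.
Proof.
move=> A g h; apply: eq_from_tnth => i; rewrite !tnth_map.
have invE (u : {'GL_n[F]}) : invmx (GLval u) = GLval u^-1 by [].
by rewrite !invE !invgK invMg !GL_MxE !mulmxA.
Qed.

Canonical sim_conj_action := TotalAction sim_conj_right1 sim_conj_rightM.

Definition commuting_orbits : {set {set k.-tuple 'M[F]_n.-1.+1}} :=
  orbit sim_conj_action 'GL_n[F]%g @: commuting_tuples.

Definition num_commuting_orbits : nat := #|commuting_orbits|.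

End CommutingTuples.

(* Main.v *)
(* By Burnside's lemma, the number of orbits times |GL_n(q)| is the number of   *)
(* pairs (g, A) with g a unit commuting with a commuting k-tuple A.  Fixing the *)
(* first matrix a of the tuple leaves the same count inside the centralizer of  *)
(* a, so, grouping the a by similarity class, the orbit number kap k 0 is the   *)
(* sum over the classes of a of the normalized counts kap (k - 1) a.  A cyclic  *)
(* a has an abelian centralizer of order q^n and the cyclic classes together    *)
(* contribute q^n q^(n (k-1)); the other classes for n <= 4 are scalars,        *)
(* l + N with N of rank 1, doubled 2 x 2 companion matrices, and                *)
(* l + (0 (+) N) with N a companion matrix with a zero row.  Splitting off      *)
(* blocks reduces their centralizers to smaller matrix algebras, to M_2 over    *)
(* the field with q^2 elements and to M_2(F[e]/e^2), and to a few nilpotent     *)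
(* structures counted by the same recursion.  With x = q^k, this gives the      *)
(* closed forms orb2, orb3, orb4, whose terms are Gaussian binomials.           *)

Require Import Defs.
From mathcomp Require Import all_boot all_order all_algebra all_fingroup all_field.
From mathcomp Require Import ring.

Set Implicit Arguments.
Unset Strict Implicit.
Unset Printing Implicit Defensive.

Import Order.TTheory GRing.Theory Num.Theory.

(** * Counting commuting tuples *)

Local Open Scope nat_scope.

(** By Burnside's lemma ([num_commuting_orbits_wcomm]), c_{n,k}(q) |GL_n(q)| counts the pairs of a
    unit g and a commuting k-tuple inside the centralizer of g. All members of such a configuration
    commute with each other, so the first matrix a of the tuple may be fixed before the others, and
    the rest is the same count inside the centralizer of a ([wcommS], [wmx0S]). The ratio [kap m a]
    is then the number of orbits of the unit group of the centralizer of a on its commuting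
    m-tuples. Since the similarity class of a has |GL_n| / [wmx 0 a] elements, [kap m.+1 0] is the
    sum of [kap m a] over the similarity classes ([kapS2], [kapS3], [kapS4]).

    The cyclic classes are handled all at once: their centralizers are commutative of order q^n, and
    counting pairs of a matrix and a cyclic vector shows that together they contribute q^n q^(n m)
    ([sum_wmx0_cyclic], [sum_wmx_cyclic]). For n <= 4 few other types remain ([class3], [class4]),
    and their centralizers are explicit. Blocks without intertwiners split off ([kap_block]). A
    doubled companion matrix leads to two copies of M_2(F), to M_2 over the field with q^2 elements
    ([kap_irr]) or to M_2 over the dual numbers ([kap_eps]), according to the roots of its
    quadratic. The nilpotent types (2,1), (3,1), (2,1,1) are treated by removing a central factor
    ([wmx_center]) and counting tuples for the explicit relations [rel30] and [rel8]. In these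
    smaller structures most elements have a commutative centralizer, so each count again obeys a
    one-step recursion, solved in terms of x = q^m.

    Substituting all this, the orbit numbers are the rational expressions [orb2], [orb3], [orb4] in
    q and x = q^k ([kap2E], [kap3E], [kap4E]). They are arranged as sums of products of powers of q
    and Gaussian binomials, which the q-Pascal rule exhibits as polynomials with non-negative
    coefficients. The one genuine division by 2 disappears because ([k]^2 + [k]_{q^2}) / 2 is the
    Gaussian binomial of k + 1 over 2 ([evq_h2p]). *)

Section CommutationCount.
Variables (T : finType) (r : rel T).

Definition cent (S : {set T}) (a : T) : {set T} := [set b in S | r a b].

(** The first entry is chosen in S and the others inside its centralizer. For a reflexive symmetric
    relation this counts pairwise commuting m-tuples ([card_commuting_tuples]). *)
Fixpoint ncomm m (S : {set T}) : nat :=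
  if m is m'.+1 then \sum_(a in S) ncomm m' (cent S a) else 1.

(** The marked element v plays the role of the group element in Burnside's count; in the
    applications u is invertibility. *)
Definition wcomm (u : pred T) m (S : {set T}) : nat :=
  \sum_(v in S | u v) ncomm m (cent S v).

Lemma cent_cent S a b : cent (cent S a) b = cent (cent S b) a.
Proof. by apply/setP => c; rewrite !inE -!andbA [r a c && _]andbC. Qed.

(** The marked element and the first entry of the tuple can be chosen in either order, because
    iterated centralizers do not depend on the order. *)
Lemma wcommS (u : pred T) m S : symmetric r ->
  wcomm u m.+1 S = \sum_(a in S) wcomm u m (cent S a).
Proof.
move=> r_sym; rewrite /wcomm /=.
rewrite (exchange_big_dep (mem S)) /=; last first.
  by move=> i j _; rewrite inE => /andP[].
apply: eq_bigr => a Sa; apply: eq_big => [v|v _]; last by rewrite cent_cent.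
by rewrite !inE Sa r_sym /= -!andbA; congr (_ && _); rewrite andbC.
Qed.

Lemma wcomm0 (u : pred T) S : wcomm u 0 S = #|[set v in S | u v]|.
Proof. by rewrite /wcomm /= sum1dep_card. Qed.

Lemma ncomm_abelian m (S : {set T}) : {in S &, forall a b, r a b} -> ncomm m S = #|S| ^ m.
Proof.
elim: m => //= m IHm abS; rewrite expnS -sum_nat_const.
apply: eq_bigr => a Sa; suff -> : cent S a = S by apply: IHm.
apply/setP => b; rewrite inE; case: (boolP (b \in S)) => // Sb.
by rewrite abS.
Qed.

Lemma wcomm_abelian (u : pred T) m (S : {set T}) : {in S &, forall a b, r a b} ->
  wcomm u m S = #|S| ^ m * wcomm u 0 S.
Proof.
move=> abS; rewrite wcomm0 -sum1dep_card big_distrr /=.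
apply: eq_bigr => a /andP[Sa _]; rewrite muln1.
suff -> : cent S a = S by apply: ncomm_abelian.
apply/setP => b; rewrite inE; case: (boolP (b \in S)) => // Sb.
by rewrite abS.
Qed.

End CommutationCount.

Section Transport.
Variables (T T' : finType) (r : rel T) (r' : rel T') (f : T -> T').

Lemma cent_imset (S : {set T}) a : a \in S ->
    {in S &, forall a b, r' (f a) (f b) = r a b} ->
  cent r' (f @: S) (f a) = f @: cent r S a.
Proof.
move=> Sa rf; apply/setP => y; rewrite inE; apply/andP/imsetP.
  by case=> /imsetP[b Sb ->]; rewrite rf // => rab; exists b; rewrite // inE Sb.
by case=> b; rewrite inE => /andP[Sb rab] ->; rewrite rf // imset_f.
Qed.

Lemma ncomm_imset m (S : {set T}) : {in S &, injective f} ->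
    {in S &, forall a b, r' (f a) (f b) = r a b} ->
  ncomm r' m (f @: S) = ncomm r m S.
Proof.
elim: m S => //= m IHm S f_inj rf; rewrite big_imset //=.
apply: eq_bigr => a Sa; rewrite cent_imset // IHm // => b c.
  by rewrite !inE => /andP[Sb _] /andP[Sc _]; apply: f_inj.
by rewrite !inE => /andP[Sb _] /andP[Sc _]; apply: rf.
Qed.

Lemma wcomm_imset (u : pred T) (u' : pred T') m (S : {set T}) :
    {in S &, injective f} ->
    {in S &, forall a b, r' (f a) (f b) = r a b} ->
    {in S, forall a, u' (f a) = u a} ->
  wcomm r' u' m (f @: S) = wcomm r u m S.
Proof.
move=> f_inj rf uf; rewrite /wcomm big_mkcondr big_imset //= [RHS]big_mkcondr.
apply: eq_bigr => a Sa; rewrite uf // cent_imset // ncomm_imset // => b c.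
  by rewrite !inE => /andP[Sb _] /andP[Sc _]; apply: f_inj.
by rewrite !inE => /andP[Sb _] /andP[Sc _]; apply: rf.
Qed.

End Transport.

Section Product.
Variables (T1 T2 : finType) (r1 : rel T1) (r2 : rel T2).

Definition prod_rel : rel (T1 * T2) := [rel a b | r1 a.1 b.1 && r2 a.2 b.2].

Lemma cent_prod S1 S2 a : cent prod_rel (setX S1 S2) a =
  setX (cent r1 S1 a.1) (cent r2 S2 a.2).
Proof.
by apply/setP => b; rewrite !inE /= -!andbA; do 2!bool_congr; rewrite andbC.
Qed.

Lemma ncomm_prod m S1 S2 :
  ncomm prod_rel m (setX S1 S2) = ncomm r1 m S1 * ncomm r2 m S2.
Proof.
elim: m S1 S2 => //= m IHm S1 S2; rewrite big_distrlr /= pair_big /=.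
by apply: eq_big => [a|a _]; rewrite ?inE // cent_prod IHm.
Qed.

Lemma wcomm_prod (u1 : pred T1) (u2 : pred T2) m S1 S2 :
  wcomm prod_rel [pred a | u1 a.1 && u2 a.2] m (setX S1 S2) =
  wcomm r1 u1 m S1 * wcomm r2 u2 m S2.
Proof.
rewrite /wcomm big_distrlr /= pair_big /=.
apply: eq_big => [a|a _]; rewrite ?inE /= ?cent_prod ?ncomm_prod //.
by rewrite -!andbA; do 2!bool_congr.
Qed.

End Product.

Lemma card_commuting_tuples (T : finType) (r : rel T) k (S : {set T}) :
    reflexive r -> symmetric r ->
  #|[set A : k.-tuple T | all (mem S) A && all2rel r A]| = ncomm r k S.
Proof.
move=> rxx r_sym; elim: k S => [|k IHk] S /=.
  transitivity #|{: 0.-tuple T}|; last by rewrite card_tuple.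
  by apply: eq_card => A; rewrite !inE tuple0.
rewrite -sum1_card (partition_big (fun A => thead A) (mem S)) /=; last first.
  by move=> A; rewrite inE; case/tupleP: A => a A /= /andP[/andP[Sa _] _].
apply: eq_bigr => a Sa; rewrite -IHk -sum1_card.
rewrite (reindex_onto (fun A : k.-tuple T => [tuple of a :: A])
    (fun A : k.+1.-tuple T => [tuple of behead A])) /=.
  apply: eq_bigl => A; rewrite !inE theadE eqxx andbT /= all2rel_cons // rxx /= Sa /=.
  rewrite (_ : _ == A) ?andbT; last by apply/eqP/val_inj.
  rewrite andbA; congr (_ && _).
  rewrite -all_predI; apply: eq_all => b /=; by rewrite !inE.
by move=> A /andP[_ /eqP <-]; rewrite -tuple_eta.
Qed.

Lemma comm_mxb_refl (R : pzSemiRingType) n : reflexive (@comm_mxb R n).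
Proof. by move=> a; apply/eqP. Qed.
Lemma comm_mxb_sym' (R : pzSemiRingType) n : symmetric (@comm_mxb R n).
Proof. by move=> a b; rewrite /comm_mxb eq_sym. Qed.

(** Cauchy-Frobenius: a tuple is fixed by g exactly when each of its entries commutes with g. *)
Lemma num_commuting_orbits_wcomm (F : finFieldType) n k :
  num_commuting_orbits F n k * #|'GL_n[F]%g| =
  wcomm (@comm_mxb F n.-1.+1) (mem unitmx) k [set: 'M[F]_n.-1.+1].
Proof.
have rxx := @comm_mxb_refl F n.-1.+1; have r_sym := @comm_mxb_sym' F n.-1.+1.
have acts : [acts 'GL_n[F], on commuting_tuples F n k | sim_conj_action F n k]%g.
  apply/subsetP => g _; rewrite !inE /=; apply/subsetP => A.
  rewrite !inE => /allrelP cA; apply/allrelP => _ _ /mapP[X AX ->] /mapP[Y AY ->].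
  have /eqP cXY := cA _ _ AX AY; apply/eqP.
  have gK : (invmx (GLval g^-1%g) *m GLval g^-1%g = 1%:M)%R by apply/mulVmx/GL_unitmx.
  rewrite !mulmxA -!(mulmxA _ (invmx _) (GLval _)) gK !mulmx1 -!mulmxA.
  by rewrite (mulmxA X) cXY -(mulmxA Y).
rewrite /num_commuting_orbits /commuting_orbits -(Frobenius_Cauchy acts).
rewrite /wcomm (eq_bigl (fun A => A \in unitmx)) => [|A]; last by rewrite !inE.
have GLin (A : 'M[F]_n.-1.+1) : A \in unitmx -> GLval (insubd (1%g : {'GL_n[F]}) A) = A.
  by move=> uA; rewrite insubdK.
rewrite [RHS](reindex_onto (fun g : {'GL_n[F]} => GLval g) (fun A => insubd (1%g : {'GL_n[F]}) A)) //=.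
apply: eq_big => [g|g _].
  rewrite inE; have ug : (GLval g : matrix _ _ _) \in unitmx := GL_unitmx g.
  by rewrite ug; apply/esym/eqP/val_inj; rewrite /= GLin.
rewrite -card_commuting_tuples //; apply: eq_card => A.
rewrite !inE /= andbC; congr (_ && _).
have actE X : X \in A -> (GLval g^-1%g *m X *m invmx (GLval g^-1%g) == X)%R =
    comm_mxb (GLval g) X.
  move=> _; rewrite (_ : invmx _ = GLval g); last by rewrite -[in RHS](invgK g).
  have gK : (GLval g *m GLval g^-1%g = 1%:M)%R by apply/mulmxV/GL_unitmx.
  have Kg : (GLval g^-1%g *m GLval g = 1%:M)%R by apply/mulVmx/GL_unitmx.
  apply/eqP/eqP => [{1}<-|cgX]; first by rewrite !mulmxA gK mul1mx.
  by rewrite -mulmxA -cgX mulmxA Kg mul1mx.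
rewrite sub1set inE; apply/eqP/allP => [fixA X AX | fixA]; last first.
  apply/eq_from_tnth => i; rewrite tnth_map; apply/eqP.
  by rewrite actE ?mem_tnth //; have := fixA _ (mem_tnth i A); rewrite !inE.
rewrite !inE /= -actE //; have /tnthP[i ->] := AX.
by rewrite -[in X in _ == X]fixA tnth_map.
Qed.

(** * Centralizers and the normalized counts *)

Local Open Scope ring_scope.

Section CentralizerCounts.
Variables (F : finFieldType) (n : nat).
Implicit Types (a b g : 'M[F]_n) (m : nat).

Definition cmx a : {set 'M[F]_n} := cent comm_mxb setT a.
Definition wmx m a : nat := wcomm comm_mxb (mem unitmx) m (cmx a).
(** [wmx 0 a] is the order of the unit group of [cmx a], so by Burnside this ratio is the number of
    orbits of that group on the commuting m-tuples of [cmx a]. *)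
Definition kap m a : rat := (wmx m a)%:R / (wmx 0 a)%:R.
Definition ugl : nat := #|[set g : 'M[F]_n | g \in unitmx]|.
Definition sim a b := [exists g : 'M[F]_n, (g \in unitmx) && (g *m a == b *m g)].

Lemma mem_cmx a b : (b \in cmx a) = (a *m b == b *m a).
Proof. by rewrite !inE. Qed.

Lemma simP a b :
  reflect (exists2 g : 'M[F]_n, g \in unitmx & g *m a = b *m g) (sim a b).
Proof.
apply: (iffP existsP) => [[g /andP[ug /eqP ga]]|[g ug ga]]; first by exists g.
by exists g; rewrite ug ga eqxx.
Qed.

Lemma sim_refl a : sim a a.
Proof. by apply/simP; exists 1%:M; rewrite ?unitmx1 // mul1mx mulmx1. Qed.

Lemma sim_sym a b : sim a b = sim b a.
Proof.
have h c d : sim c d -> sim d c.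
  case/simP=> g ug gc; apply/simP; exists (invmx g); rewrite ?unitmx_inv //.
  apply: (can_inj (mulKmx ug)); rewrite mulmxA mulmxV // mul1mx.
  by rewrite !mulmxA gc -mulmxA mulmxV // mulmx1.
by apply/idP/idP; apply: h.
Qed.

Lemma sim_trans a b c : sim a b -> sim b c -> sim a c.
Proof.
case/simP=> g ug ga /simP[h uh hb]; apply/simP; exists (h *m g).
  by rewrite unitmx_mul uh.
by rewrite -mulmxA ga mulmxA hb mulmxA.
Qed.

Lemma wmx_sim m a b : sim a b -> wmx m a = wmx m b.
Proof.
case/simP=> g ug ga; pose f (x : 'M[F]_n) := g *m x *m invmx g.
have fM x y : f x *m f y = f (x *m y).
  by rewrite /f !mulmxA mulmxKV.
have f_inj : injective f.
  move=> x y fxy; apply: (can_inj (mulKmx ug)).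
  have ui : invmx g \in unitmx by rewrite unitmx_inv.
  by apply: (can_inj (mulmxK ui)); apply: fxy.
have fa : f a = b by rewrite /f ga mulmxK.
rewrite /wmx (_ : cmx b = f @: cmx a); last first.
  apply/setP => y; rewrite mem_cmx; apply/eqP/imsetP => [byC | [x]].
    have fy : f (invmx g *m y *m g) = y.
      by rewrite /f !mulmxA mulmxV // mul1mx mulmxK.
    exists (invmx g *m y *m g); last by rewrite fy.
    by rewrite mem_cmx; apply/eqP/f_inj; rewrite -(fM a) -(fM _ a) fa fy.
  by rewrite mem_cmx => /eqP cax ->; rewrite -fa !fM cax.
rewrite (wcomm_imset (r := comm_mxb) (u := mem unitmx)) //.
- by move=> x y _ _; apply: f_inj.
- move=> x y _ _; rewrite /comm_mxb !fM; exact: (inj_eq f_inj).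
by move=> x _; rewrite /= /f !unitmx_mul unitmx_inv ug andbT.
Qed.

Lemma kap_sim m a b : sim a b -> kap m a = kap m b.
Proof. by move=> ab; rewrite /kap !(wmx_sim _ ab). Qed.

Lemma wmx0E a : wmx 0 a = #|[set g in cmx a | g \in unitmx]|.
Proof. by rewrite /wmx wcomm0. Qed.

Lemma wmx0_gt0 a : (0 < wmx 0 a)%N.
Proof.
rewrite wmx0E; apply/card_gt0P; exists 1%:M.
by rewrite inE mem_cmx mul1mx mulmx1 eqxx unitmx1.
Qed.

Lemma kap0 a : kap 0 a = 1.
Proof. by rewrite /kap divff // pnatr_eq0 -lt0n wmx0_gt0. Qed.

(** The matrices carrying a to b form a coset of the unit group of the centralizer of b. *)
Lemma card_conjugators a b : sim a b ->
  #|[set g : 'M[F]_n | (g \in unitmx) && (g *m a == b *m g)]| = wmx 0 b.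
Proof.
case/simP=> g ug ga; rewrite wmx0E.
rewrite -[RHS](card_imset _ (can_inj (mulmxK ug))); apply: eq_card => h.
rewrite inE; apply/andP/imsetP => [[uh /eqP ha] | [c]].
  exists (h *m invmx g); last by rewrite mulmxKV.
  rewrite inE mem_cmx unitmx_mul uh unitmx_inv ug andbT mulmxA -ha.
  have -> : a = invmx g *m b *m g by rewrite -mulmxA -ga mulKmx.
  by rewrite !mulmxA mulmxK ?eqxx.
rewrite inE mem_cmx => /andP[/eqP cb uc] ->.
by rewrite unitmx_mul uc ug -mulmxA ga !mulmxA cb.
Qed.

(** Orbit-stabilizer: the units are sorted by the conjugate of b that they produce. *)
Lemma card_sim b : (#|[set a | sim a b]| * wmx 0 b = ugl)%N.
Proof.
rewrite /ugl -!sum1_card.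
rewrite [RHS](partition_big (fun g => invmx g *m b *m g) (mem [set a | sim a b])) /=.
  rewrite sum1_card -sum_nat_const; apply: eq_bigr => a; rewrite inE => ab.
  rewrite -(card_conjugators ab) -sum1_card; apply: eq_bigl => g; rewrite !inE.
  case: (boolP (g \in unitmx)) => //= ug; apply/eqP/eqP => [ga|<-].
    by rewrite -mulmxA -ga mulKmx.
  by rewrite !mulmxA mulmxV // mul1mx.
move=> g; rewrite !inE => ug; apply/simP; exists g => //.
by rewrite !mulmxA mulmxV // mul1mx.
Qed.

Lemma sum_sim (J : finType) (rep : J -> 'M[F]_n) (f : 'M[F]_n -> rat) :
    (forall a b, sim a b -> f a = f b) ->
    (forall i j, sim (rep i) (rep j) -> i = j) ->
  \sum_(a | [exists j, sim a (rep j)]) f a =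
  \sum_j ugl%:R / (wmx 0 (rep j))%:R * f (rep j).
Proof.
move=> f_sim rep_inj.
transitivity (\sum_a \sum_(j | sim a (rep j)) f a).
  rewrite big_mkcond; apply: eq_bigr => a _; case: existsP => [[j aj]|no].
    rewrite (big_pred1 j) // => i; apply/idP/eqP => [ai|-> //].
    by apply: rep_inj; apply: sim_trans aj; rewrite sim_sym.
  by rewrite big_pred0 // => i; apply/negbTE/negP => ai; case: no; exists i.
rewrite (exchange_big_dep xpredT) //=; apply: eq_bigr => j _.
rewrite (eq_bigr (fun=> f (rep j))) => [|a]; last exact: f_sim.
rewrite sumr_const -(card_sim (rep j)) natrM mulfK; last first.
  by rewrite pnatr_eq0 -lt0n wmx0_gt0.
by rewrite cardsE mulr_natl.
Qed.

Lemma cmx_scalar x : cmx x%:M = setT.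
Proof. by apply/setP => b; rewrite mem_cmx inE scalar_mxC eqxx. Qed.

Lemma cmx0 : cmx 0 = setT.
Proof. by apply/setP => b; rewrite mem_cmx inE mulmx0 mul0mx eqxx. Qed.

Lemma ugl_wmx : ugl = wmx 0 0.
Proof. by rewrite wmx0E cmx0; apply: eq_card => g; rewrite !inE. Qed.

Lemma cmx_addl x a : cmx (x%:M + a) = cmx a.
Proof.
apply/setP => b; rewrite !mem_cmx mulmxDl mulmxDr scalar_mxC.
by rewrite (inj_eq (addrI _)).
Qed.

Lemma kap_addl m x a : kap m (x%:M + a) = kap m a.
Proof. by rewrite /kap /wmx cmx_addl. Qed.

(** This is the engine of all recursions: after a is fixed, the remaining configuration lives in
    [cmx a]. *)
Lemma wmx0S m : wmx m.+1 0 = (\sum_a wmx m a)%N.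
Proof.
rewrite /wmx wcommS; last exact: comm_mxb_sym'.
by rewrite cmx0; apply: eq_bigl => a; rewrite inE.
Qed.

End CentralizerCounts.

(** * Cyclic matrices and their total contribution *)

Section CyclicVector.
Variables (F : finFieldType) (n : nat).

(* Evaluation at a common cyclic vector v identifies S with the row space. *)
Lemma common_cyclic_vector (S : {set 'M[F]_n}) (e : 'I_n -> 'M[F]_n) (v : 'rV[F]_n) :
    (forall i, {in S, forall c, e i *m c = c *m e i}) ->
    (forall w : 'rV[F]_n, \sum_i w 0 i *: e i \in S) ->
    (\matrix_i (v *m e i)) \in unitmx ->
  [/\ {in S &, forall c d, c *m d = d *m c},
      {in S &, injective (fun c => v *m c)},
      (fun c => v *m c) @: S = setT & #|S| = (#|F| ^ n)%N].
Proof.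
move=> eC eS ug; set g := \matrix_i _ in ug.
have gE (w : 'rV[F]_n) : v *m (\sum_i w 0 i *: e i) = w *m g.
  rewrite mulmx_sumr [RHS]mulmx_sum_row; apply: eq_bigr => i _.
  by rewrite rowK scalemxAr.
have vinj : {in S &, injective (fun c => v *m c)}.
  move=> c d Sc Sd /= vcd; apply: (can_inj (mulKmx ug)).
  by apply/row_matrixP => i; rewrite !row_mul !rowK -!mulmxA !eC // !mulmxA vcd.
have vimg : (fun c => v *m c) @: S = setT.
  apply/setP => w; rewrite inE; apply/imsetP.
  by exists (\sum_i (w *m invmx g) 0 i *: e i) => //; rewrite gE mulmxKV.
split=> //; last by rewrite -(card_in_imset vinj) vimg cardsT card_mx mul1n.
move=> c d Sc Sd; have -> : c = \sum_i (v *m c *m invmx g) 0 i *: e i.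
  by apply: vinj => //=; rewrite gE mulmxKV.
rewrite mulmx_suml mulmx_sumr; apply: eq_bigr => i _.
by rewrite -scalemxAl -scalemxAr eC.
Qed.

End CyclicVector.

Section Cyclic.
Variables (F : finFieldType) (n' : nat).
Local Notation n := n'.+1.
Implicit Types (a g : 'M[F]_n) (v r : 'rV[F]_n).

(** This matrix is invertible exactly when v is a cyclic vector of a. *)
Definition krylov v a : 'M[F]_n := \matrix_(i < n) (v *m a ^+ i).
Definition cyclic a := [exists v, krylov v a \in unitmx].

Lemma krylov_comm v a c : a *m c = c *m a -> krylov (v *m c) a = krylov v a *m c.
Proof.
move=> ac; apply/row_matrixP => i; rewrite row_mul !rowK -!mulmxA; congr (v *m _).
exact: (commrX i (esym ac : GRing.comm c a)).
Qed.

(** A matrix commuting with a is determined by its value on a cyclic vector v, and every value is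
    attained by a polynomial in a. Units of the centralizer correspond to the values that are again
    cyclic vectors. *)
Lemma cmx_cyclic a : cyclic a ->
  [/\ {in cmx a &, forall c d, c *m d = d *m c}, #|cmx a| = (#|F| ^ n)%N
    & wmx 0 a = #|[set v | krylov v a \in unitmx]|].
Proof.
case/existsP=> v uv; have [|||aC vinj vimg cardC] :=
    @common_cyclic_vector F n (cmx a) (fun i => a ^+ i) v.
- move=> i c; rewrite mem_cmx => /eqP ac; apply: esym.
  exact: (commrX i (esym ac : GRing.comm c a)).
- move=> w; rewrite mem_cmx mulmx_sumr mulmx_suml; apply/eqP/eq_bigr => i _.
  by rewrite -scalemxAl -scalemxAr; congr (_ *: _); rewrite !mulmxE -exprS exprSr.
- by [].
split=> //; rewrite wmx0E.
have sub : {subset [set g in cmx a | g \in unitmx] <= cmx a}.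
  by move=> g; rewrite inE => /andP[].
rewrite -(card_in_imset (sub_in2 sub vinj)); apply: eq_card => w.
apply/imsetP/idP => [[c]|].
  rewrite inE mem_cmx => /andP[/eqP ac uc] ->.
  by rewrite inE krylov_comm // unitmx_mul uv.
rewrite inE => uw; have : w \in [set v *m c | c in cmx a] by rewrite vimg inE.
case/imsetP=> c Cc wE; exists c => //; have := Cc; rewrite mem_cmx => /eqP ac.
by rewrite inE Cc; move: uw; rewrite wE krylov_comm // unitmx_mul uv.
Qed.

(** The companion matrix for row vectors, with arbitrary last row r. *)
Definition comp r : 'M[F]_n :=
  \matrix_(i < n) (if (i < n')%N then delta_mx 0 (inord i.+1) else r).

Lemma krylov_row0 r g : g \in unitmx ->
  krylov (row 0 g) (invmx g *m comp r *m g) = g.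
Proof.
move=> ug; apply/row_matrixP => -[i lti]; rewrite rowK /=.
elim: i lti => [|i IHi] lti.
  by rewrite expr0 mulmx1; congr row; apply: val_inj.
rewrite exprSr -mulmxE mulmxA IHi 1?ltnW // => lti'.
rewrite !mulmxA rowE -!mulmxA mulKVmx // mulmxA -rowE rowK /= -ltnS lti -rowE.
by congr row; apply: val_inj; rewrite /= inordK.
Qed.

(** Both sides count pairs (a, v) with v cyclic for a. For fixed a there are [wmx 0 a] of them by
    [cmx_cyclic]; conversely (a, v) amounts to a free choice of the Krylov basis g and of the last
    row r of a in that basis. *)
Lemma sum_wmx0_cyclic :
  (\sum_(a | cyclic a) wmx 0 a = #|F| ^ n * ugl F n)%N.
Proof.
pose phi (p : 'rV[F]_n * 'M[F]_n) := (invmx p.2 *m comp p.1 *m p.2, row 0 p.2).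
pose U := [set g : 'M[F]_n | g \in unitmx].
transitivity #|[set p : 'M[F]_n * 'rV[F]_n | krylov p.2 p.1 \in unitmx]|.
  rewrite -sum1dep_card -(pair_big_dep xpredT (fun a v => krylov v a \in unitmx)
    (fun _ _ => 1%N)) /= [LHS]big_mkcond; apply: eq_bigr => a _.
  rewrite sum1dep_card; case: ifPn => [/cmx_cyclic[] //|].
  by rewrite negb_exists => /forallP no; apply/esym/eqP; rewrite cards_eq0;
     apply/eqP/setP => v; rewrite !inE (negbTE (no v)).
(* The basis g is recovered as the Krylov matrix of the image, and then r as the last row of the
   companion matrix. *)
have phi_inj : {in setX setT U &, injective phi}.
  move=> [r g] [s h]; rewrite !inE /= => ug uh [e1 e2].
  have gh : g = h by rewrite -(krylov_row0 r ug) -(krylov_row0 s uh) e1 e2.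
  move: e1; rewrite -gh => /(can_inj (mulmxK ug)) e1.
  have : invmx g \in unitmx by rewrite unitmx_inv.
  move=> /mulKmx/can_inj /(_ _ _ e1) /(congr1 (row ord_max)).
  by rewrite !rowK /= ltnn => ->.
have cardU : #|setX [set: 'rV[F]_n] U| = (#|F| ^ n * ugl F n)%N.
  by rewrite cardsX cardsT card_mx mul1n.
rewrite -cardU -(card_in_imset phi_inj); apply: eq_card => -[a v].
rewrite inE /=; apply/idP/imsetP => [uk|[[r g]]]; last first.
  by rewrite !inE /= => ug [-> ->]; rewrite krylov_row0.
set g := krylov v a in uk; exists (row ord_max (g *m a *m invmx g), g).
  by rewrite !inE.
rewrite /phi /=; congr pair; last first.
  by rewrite rowK expr0 mulmx1.
(* In the Krylov basis a shifts every row but the last to the next one, so it is a companion matrix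
   there. *)
have -> : comp (row ord_max (g *m a *m invmx g)) = g *m a *m invmx g.
  apply/row_matrixP => i; rewrite rowK; case: ltnP => [lti|lei].
    rewrite !row_mul rowK -(mulmxA v) (_ : a ^+ i *m a = a ^+ i.+1);
      last by rewrite exprSr.
    have -> : v *m a ^+ i.+1 = row (inord i.+1) g by rewrite rowK inordK.
    by rewrite rowE -mulmxA mulmxV // mulmx1.
  by congr row; apply: val_inj => /=; apply/eqP; rewrite eqn_leq lei -ltnS ltn_ord.
by rewrite !mulmxA mulVmx // mul1mx mulmxKV.
Qed.

Lemma sum_wmx_cyclic m :
  (\sum_(a | cyclic a) wmx m a = #|F| ^ (n * m) * (#|F| ^ n * ugl F n))%N.
Proof.
rewrite -sum_wmx0_cyclic big_distrr /=; apply: eq_bigr => a /cmx_cyclic[aC cardC _].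
rewrite /wmx wcomm_abelian ?cardC ?expnM // => c d Cc Cd.
by rewrite /comm_mxb aC.
Qed.

End Cyclic.

(** * Matrices up to similarity in sizes 3 and 4 *)

Section FreeRows.
Variables (F : fieldType) (n : nat).
Implicit Types (u v w : 'rV[F]_n) (X : seq 'rV[F]_n).

Definition rowsmx m X : 'M[F]_(m, n) := \matrix_(i < m) X`_i.

Lemma rowsmx_unit X : free X -> size X = n -> rowsmx n X \in unitmx.
Proof.
move=> fX sX; rewrite -row_free_unit; apply: inj_row_free => w.
rewrite mulmx_sum_row => wX; apply/rowP => i; rewrite mxE.
have X_n : size X == n by apply/eqP.
apply: (freeP (fX : free (Tuple X_n)) (fun i => w 0 i)).
by rewrite -[RHS]wX; apply: eq_bigr => j _; rewrite rowK.
Qed.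

Lemma exists_notin_span X : (size X < n)%N -> exists w, w \notin <<X>>%VS.
Proof.
move=> ltX; have: ~~ (fullv <= <<X>>)%VS.
  apply/negP => /dimvS; rewrite dimvf /dim /= mul1n leqNgt.
  by rewrite (leq_ltn_trans (dim_span X)).
by case/subvPn => w _ wX; exists w.
Qed.

Lemma span1P v w : reflect (exists x, w = x *: v) (w \in <<[:: v]>>%VS).
Proof. by rewrite span_seq1; apply: vlineP. Qed.

Lemma span2P v1 v2 w :
  reflect (exists x y, w = x *: v1 + y *: v2) (w \in <<[:: v1; v2]>>%VS).
Proof.
rewrite span_cons; apply: (iffP memv_addP) => [[_ /vlineP[x ->]]|[x [y ->]]].
  by case=> _ /span1P[y ->] ->; exists x, y.
exists (x *: v1); first by apply/vlineP; exists x.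
by exists (y *: v2) => //; apply/span1P; exists y.
Qed.

Lemma span3P v1 v2 v3 w :
  reflect (exists x y z, w = x *: v1 + y *: v2 + z *: v3)
    (w \in <<[:: v1; v2; v3]>>%VS).
Proof.
rewrite span_cons; apply: (iffP memv_addP) => [[_ /vlineP[x ->]]|[x [y [z ->]]]].
  by case=> _ /span2P[y [z ->]] ->; exists x, y, z; rewrite addrA.
exists (x *: v1); first by apply/vlineP; exists x.
exists (y *: v2 + z *: v3); first by apply/span2P; exists y, z.
by rewrite addrA.
Qed.

Lemma free2P v1 v2 : reflect
  (forall x y, x *: v1 + y *: v2 = 0 -> x = 0 /\ y = 0) (free [:: v1; v2]).
Proof.
apply: (iffP (@freeP _ _ _ [tuple v1; v2])) => [fX x y|fX k].
  move=> xy; have := fX (fun i => [:: x; y]`_i).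
  rewrite !big_ord_recl big_ord0 /= addr0 => /(_ xy) h.
  by split; [have := h 0 | have := h 1].
rewrite !big_ord_recl big_ord0 /= addr0 => /fX[k0 k1] [[|[|//]] lti].
  by rewrite -[RHS]k0; congr k; apply: val_inj.
by rewrite -[RHS]k1; congr k; apply: val_inj.
Qed.

Lemma free3P v1 v2 v3 : reflect
  (forall x y z, x *: v1 + y *: v2 + z *: v3 = 0 -> [/\ x = 0, y = 0 & z = 0])
  (free [:: v1; v2; v3]).
Proof.
apply: (iffP (@freeP _ _ _ [tuple v1; v2; v3])) => [fX x y z|fX k].
  move=> xyz; have := fX (fun i => [:: x; y; z]`_i).
  rewrite !big_ord_recl big_ord0 /= addr0 addrA => /(_ xyz) h.
  by split; [have := h 0 | have := h 1 | have := h 2].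
rewrite !big_ord_recl big_ord0 /= addr0 addrA => /fX[k0 k1 k2] [[|[|[|//]]] lti].
- by rewrite -[RHS]k0; congr k; apply: val_inj.
- by rewrite -[RHS]k1; congr k; apply: val_inj.
- by rewrite -[RHS]k2; congr k; apply: val_inj.
Qed.

Lemma free4P v1 v2 v3 v4 : reflect
  (forall x y z t, x *: v1 + y *: v2 + z *: v3 + t *: v4 = 0 ->
    [/\ x = 0, y = 0, z = 0 & t = 0])
  (free [:: v1; v2; v3; v4]).
Proof.
apply: (iffP (@freeP _ _ _ [tuple v1; v2; v3; v4])) => [fX x y z t|fX k].
  move=> xyz; have := fX (fun i => [:: x; y; z; t]`_i).
  rewrite !big_ord_recl big_ord0 /= addr0 !addrA => /(_ xyz) h.
  by split; [have := h 0 | have := h 1 | have := h 2 | have := h 3].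
rewrite !big_ord_recl big_ord0 /= addr0 !addrA.
move=> /fX[k0 k1 k2 k3] [[|[|[|[|//]]]] lti].
- by rewrite -[RHS]k0; congr k; apply: val_inj.
- by rewrite -[RHS]k1; congr k; apply: val_inj.
- by rewrite -[RHS]k2; congr k; apply: val_inj.
- by rewrite -[RHS]k3; congr k; apply: val_inj.
Qed.

Lemma span4P v1 v2 v3 v4 w :
  reflect (exists x y z t, w = x *: v1 + y *: v2 + z *: v3 + t *: v4)
    (w \in <<[:: v1; v2; v3; v4]>>%VS).
Proof.
rewrite span_cons; apply: (iffP memv_addP) => [[_ /vlineP[x ->]]|[x [y [z [t ->]]]]].
  by case=> _ /span3P[y [z [t ->]]] ->; exists x, y, z, t; rewrite !addrA.
exists (x *: v1); first by apply/vlineP; exists x.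
exists (y *: v2 + z *: v3 + t *: v4); first by apply/span3P; exists y, z, t.
by rewrite !addrA.
Qed.

Lemma free_rev X : free (rev X) = free X.
Proof. by apply: perm_free; rewrite perm_rev. Qed.

Lemma free_spanN v X : free X -> ~~ free (v :: X) -> v \in <<X>>%VS.
Proof. by move=> fX; rewrite free_cons fX andbT negbK. Qed.

End FreeRows.

(** * Matrices under which each vector generates a space of dimension at most 2 *)

Section Quadratic.
Variables (F : finFieldType) (n' : nat).
Local Notation n := n'.+1.
Implicit Types (a N : 'M[F]_n) (v w : 'rV[F]_n).

(** By Cayley-Hamilton the span of u, u a, ..., u a^(n-1) is stable under a, hence everything, so
    these n vectors are free. *)
Lemma cyclic_gen a u :
    (forall W : {vspace 'rV[F]_n}, (forall w, w \in W -> w *m a \in W) ->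
       u \in W -> W = fullv) ->
  cyclic a.
Proof.
move=> genu; pose X := [seq u *m a ^+ i | i <- iota 0 n].
have XE i : (i < n)%N -> X`_i = u *m a ^+ i.
  by move=> lti; rewrite (nth_map 0%N) ?size_iota // nth_iota.
have Xin i : (i < n)%N -> u *m a ^+ i \in <<X>>%VS.
  by move=> lti; rewrite -XE // memv_span // mem_nth // size_map size_iota.
have hornerZX i (c : F) : horner_mx a (c *: 'X^i) = c *: a ^+ i.
  by rewrite -mul_polyC rmorphM /= horner_mx_C rmorphXn /= horner_mx_X
             -mulmxE mul_scalar_mx.
have CH : a ^+ n = - \sum_(i < n) (char_poly a)`_i *: a ^+ i.
  apply/eqP; rewrite -addr_eq0 addrC; apply/eqP.
  rewrite -[RHS](Cayley_Hamilton a) -[X in horner_mx a X]coefK poly_def.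
  rewrite size_char_poly rmorph_sum [in RHS]big_ord_recr /= hornerZX.
  have := char_poly_monic a; rewrite monicE lead_coefE size_char_poly /= => /eqP ->.
  by rewrite scale1r; congr (_ + _); apply: eq_bigr => i _; rewrite hornerZX.
have stX w : w \in <<X>>%VS -> w *m a \in <<X>>%VS.
  pose f : 'Hom('rV[F]_n, 'rV[F]_n) := linfun (mulmxr a).
  suff /subvP sub : (<<X>> <= f @^-1: <<X>>)%VS.
    by move=> /sub; rewrite -memv_preim lfunE.
  apply/span_subvP => x /mapP[i]; rewrite mem_iota /= add0n => lti ->.
  rewrite -memv_preim lfunE /= -mulmxA mulmxE -exprSr.
  move: lti; rewrite ltnS leq_eqVlt => /predU1P[->|lti]; last by rewrite Xin.
  rewrite CH mulmxN rpredN mulmx_sumr rpred_sum // => i0 _.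
  by rewrite -scalemxAr rpredZ // Xin.
have Xfull : <<X>>%VS = fullv.
  by apply: genu => //; have := Xin 0%N isT; rewrite expr0 mulmx1.
have fX : free X.
  by rewrite /free Xfull dimvf /dim /= mul1n size_map size_iota.
apply/existsP; exists u.
have -> : krylov u a = rowsmx n X by apply/row_matrixP => i; rewrite !rowK XE.
by apply: rowsmx_unit; rewrite // size_map size_iota.
Qed.

Definition quadr a := forall v, ~~ free [:: v; v *m a; v *m a *m a].

Lemma free3_shift x N v : free [:: v; v *m N; v *m N *m N] ->
  free [:: v; v *m (x%:M + N); v *m (x%:M + N) *m (x%:M + N)].
Proof.
move=> /free3P fN; apply/free3P => c d e.
have -> : v *m (x%:M + N) = x *: v + v *m N by rewrite mulmxDr mul_mx_scalar.
have -> : (x *: v + v *m N) *m (x%:M + N) =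
    (x * x) *: v + (x + x) *: (v *m N) + v *m N *m N.
  rewrite mulmxDr mul_mx_scalar mulmxDl -scalemxAl !scalerDr scalerA scalerDl.
  by rewrite !addrA.
rewrite !scalerDr !scalerA.
have -> : c *: v + ((d * x) *: v + d *: (v *m N)) +
   ((e * (x * x)) *: v + (e * (x + x)) *: (v *m N) + e *: (v *m N *m N)) =
   (c + d * x + e * (x * x)) *: v + (d + e * (x + x)) *: (v *m N) + e *: (v *m N *m N).
  by move: (v *m N *m N) (v *m N) => vNN vN; apply/rowP => i; rewrite !mxE; ring.
case/fN => h1 h2 h3; move: h1 h2; rewrite h3 !mul0r !addr0 => h1 h2.
by move: h1; rewrite h2 mul0r addr0.
Qed.

Lemma quadr_shift x N : quadr (x%:M + N) -> quadr N.
Proof. by move=> qa v; apply: contra (qa v); apply: free3_shift. Qed.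

(** Subtracting a multiple of v from w leaves w' with w' N = c v. If c were nonzero, w' would
    violate [quadr]. If v N N had a nonzero component along v, then v + w' would. *)
Lemma quadr_tail N v w :
    quadr N -> free [:: v; v *m N] ->
    w \notin <<[:: v; v *m N]>>%VS -> w *m N \in <<[:: v; v *m N]>>%VS ->
  exists w' b, [/\ free [:: w'; v; v *m N], w' *m N = 0, v *m N *m N = b *: (v *m N)
     & exists d, w' = w - d *: v].
Proof.
move=> qN fv wN /span2P[c [d wE]]; pose w' := w - d *: v.
have fw : free [:: w'; v; v *m N].
  rewrite free_cons fv andbT; apply: contra wN => /span2P[x [y]].
  rewrite /w' => /(canRL (subrK _)) ->; apply/span2P; exists (x + d), y.
  by rewrite scalerDl addrAC.
have wE' : w' *m N = c *: v by rewrite mulmxBl -scalemxAl wE addrK.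
have c0 : c = 0.
  apply/eqP/negPn/negP => c0; have /negP[] := qN w'; rewrite wE' -scalemxAl.
  apply/free3P => x y z; rewrite !scalerA => /(free3P _ _ _ fw)[-> /eqP + /eqP].
  by rewrite !mulf_eq0 (negPf c0) !orbF => /eqP -> /eqP ->.
rewrite c0 scale0r in wE'.
have /free_spanN : free (rev [:: v; v *m N]) by rewrite free_rev.
move=> /(_ (v *m N *m N)); rewrite -free_rev /= => /(_ (qN v)).
rewrite [rev _]/= => /span2P[b [a vE]].
have a0 : a = 0.
  apply/eqP/negPn/negP => a0; have /negP[] := qN (v + w').
  rewrite mulmxDl wE' addr0 vE; apply/free3P => x y z.
  have -> : x *: (v + w') + y *: (v *m N) + z *: (b *: (v *m N) + a *: v) =
    x *: w' + (x + z * a) *: v + (y + z * b) *: (v *m N).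
    by clearbody w'; move: (v *m N) => vN; apply/rowP => i; rewrite !mxE; ring.
  case/(free3P _ _ _ fw) => ->; rewrite add0r => /eqP.
  by rewrite mulf_eq0 (negPf a0) orbF => /eqP ->; rewrite mul0r addr0 => ->.
exists w', b; split=> //; last by exists d.
by rewrite vE a0 scale0r addr0.
Qed.

(** If every vector is an eigenvector, the matrix is diagonal, and sums of two basis vectors show
    that all diagonal entries agree. *)
Lemma nonscalar_free a : ~~ is_scalar_mx a -> exists v, free [:: v; v *m a].
Proof.
move=> nsa; case: (boolP [exists v : 'rV[F]_n, free [:: v; v *m a]]).
  by case/existsP=> v; exists v.
rewrite negb_exists => /forallP nf; case/negP: nsa.
have eig v : v != 0 -> exists x, v *m a = x *: v.
  move=> v0; apply/span1P/free_spanN; first by rewrite -seq1_free in v0 *.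
  by rewrite -free_rev; apply: nf.
have eq0 (i : 'I_n) : delta_mx 0 i != 0 :> 'rV[F]_n.
  by apply/eqP => /rowP/(_ i) /eqP; rewrite !mxE !eqxx oner_eq0.
have offd i j : i != j -> a i j = 0.
  move=> ij; have [x] := eig _ (eq0 i).
  by rewrite -rowE => /rowP/(_ j); rewrite !mxE eqxx eq_sym (negPf ij) mulr0.
have diag i : a i i = a 0 0.
  case: (eqVneq i 0) => [-> //|i0].
  have [] := eig (delta_mx 0 i + delta_mx 0 0).
    apply/eqP => /rowP/(_ i) /eqP; rewrite !mxE !eqxx (negPf i0) addr0.
    by rewrite oner_eq0.
  move=> x; rewrite mulmxDl -!rowE => /rowP e; have := e i; have := e 0.
  have a0i : a 0 i = 0 by rewrite offd // eq_sym.
  rewrite !mxE !eqxx (offd _ _ i0) a0i ?(eq_sym 0) (negPf i0) /=.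
  by rewrite !(addr0, add0r, mulr1) => -> ->.
apply/is_scalar_mxP; exists (a 0 0); apply/matrixP => i j; rewrite !mxE.
by case: (eqVneq i j) => [<-|/offd //]; rewrite diag.
Qed.

End Quadratic.

(** * Explicit representatives of the noncyclic classes *)

Section Representatives.
Variable F : finFieldType.

(* Missing rows and entries are 0. *)
Definition mxs n (s : seq (seq F)) : 'M[F]_n := \matrix_(i, j) (nth [::] s i)`_j.

(** Tabulating entries reduces identities between explicit matrices to identities between lists,
    which [ring] or [field] settle entry by entry ([mx_entries]). *)
Definition lmx m n (f : nat -> nat -> F) : seq (seq F) :=
  mkseq (fun i => mkseq (fun j => f i j) n) m.

Lemma mxs_lmx n f i j : (mxs n (lmx n n f) : 'M[F]_n) i j = f i j.
Proof. by rewrite mxE !nth_mkseq. Qed.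

Lemma mxs_pad n s : mxs n s = mxs n (lmx n n (fun i j => (nth [::] s i)`_j)).
Proof. by apply/matrixP => i j; rewrite mxs_lmx mxE. Qed.

Lemma mxs_mul n s t : mxs n s *m mxs n t = mxs n (lmx n n (fun i j =>
  foldr (fun k x => (nth [::] s i)`_k * (nth [::] t k)`_j + x) 0 (iota 0 n))).
Proof.
apply/matrixP => i j; rewrite mxs_lmx mxE.
rewrite (eq_bigr (fun k : 'I_n => (nth [::] s i)`_k * (nth [::] t k)`_j)) => [|k _];
  last by rewrite !mxE.
rewrite -(big_mkord xpredT (fun k => (nth [::] s i)`_k * (nth [::] t k)`_j)).
rewrite /index_iota subn0; elim: (iota 0 n) => [|k r IHr]; first by rewrite big_nil.
by rewrite big_cons IHr.
Qed.

Lemma mxs_scalar n x : x%:M = mxs n (lmx n n (fun i j => if i == j then x else 0)).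
Proof. by apply/matrixP => i j; rewrite mxs_lmx mxE -val_eqE /=; case: eqP. Qed.

Lemma mxs_0 n : 0 = mxs n [::].
Proof. by apply/matrixP => i j; rewrite !mxE !nth_nil. Qed.

Lemma mxs_add n s t : mxs n s + mxs n t =
  mxs n (lmx n n (fun i j => (nth [::] s i)`_j + (nth [::] t i)`_j)).
Proof. by apply/matrixP => i j; rewrite mxs_lmx !mxE. Qed.

Lemma mxs_scale n x s : x *: mxs n s =
  mxs n (lmx n n (fun i j => x * (nth [::] s i)`_j)).
Proof. by apply/matrixP => i j; rewrite mxs_lmx !mxE. Qed.

Lemma mxs_block_diag m n s1 s4 :
  block_mx (mxs m s1) 0 0 (mxs n s4) =
  mxs (m + n) (lmx (m + n) (m + n) (fun i j =>
    if (i < m)%N then (if (j < m)%N then (nth [::] s1 i)`_j else 0)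
    else if (j < m)%N then 0 else (nth [::] s4 (i - m))`_(j - m))).
Proof.
apply/matrixP => i j; rewrite mxs_lmx.
case: (split_ordP i) => i' ->; case: (split_ordP j) => j' ->;
  rewrite ?block_mxEul ?block_mxEur ?block_mxEdl ?block_mxEdr !mxE /= ?ltn_ord //;
  by rewrite ?ltnNge ?leq_addr //= ?addKn.
Qed.

Lemma mxs_block_dr m n s :
  block_mx (0 : 'M_m) 0 0 (mxs n s) =
  mxs (m + n) (lmx (m + n) (m + n) (fun i j =>
    if (i < m)%N || (j < m)%N then 0 else (nth [::] s (i - m))`_(j - m))).
Proof.
rewrite (mxs_0 m) mxs_block_diag; apply/matrixP => i j; rewrite !mxs_lmx.
by do 2!case: ifP => //; rewrite nth_nil nth_nil.
Qed.

Lemma mxs_block_ur n s :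
  block_mx 0 (mxs n s) 0 (0 : 'M_n) =
  mxs (n + n) (lmx (n + n) (n + n) (fun i j =>
    if (i < n)%N && (n <= j)%N then (nth [::] s i)`_(j - n) else 0)).
Proof.
apply/matrixP => i j; rewrite mxs_lmx.
case: (split_ordP i) => i' ->; case: (split_ordP j) => j' ->;
  rewrite ?block_mxEul ?block_mxEur ?block_mxEdl ?block_mxEdr !mxE /= ?ltn_ord //.
  by rewrite leqNgt ltn_ord.
by rewrite leq_addr addKn.
Qed.

(** On row vectors, e0 goes to e1, e1 to b e1 and the other basis vectors to 0, so N N = b N. *)
Definition rank1 n b : 'M[F]_n := mxs n [:: [:: 0; 1]; [:: 0; b]].

(** Two copies of the companion matrix of t^2 - b t - c. *)
Definition double_comp c b : 'M[F]_4 :=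
  mxs 4 [:: [:: 0; 1; 0; 0]; [:: c; b; 0; 0]; [:: 0; 0; 0; 1]; [:: 0; 0; c; b]].

(** On row vectors, e0 goes to e1, e1 to e2, e2 to c e1 + b e2 and e3 to 0: the companion matrix of
    t^3 - b t^2 - c t beside a zero block of size 1. *)
Definition singular_comp c b : 'M[F]_4 :=
  mxs 4 [:: [:: 0; 1]; [:: 0; 0; 1]; [:: 0; c; b]].

Lemma sim_rows n (X : seq 'rV[F]_n) (a b : 'M[F]_n) : free X -> size X = n ->
  (forall i : 'I_n, X`_i *m a = \sum_j b i j *: X`_j) -> sim a b.
Proof.
move=> fX sX Xa; apply/simP; exists (rowsmx n X); first exact: rowsmx_unit.
apply/row_matrixP => i; rewrite !row_mul rowK Xa mulmx_sum_row.
by apply: eq_bigr => j _; rewrite rowK mxE.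
Qed.

Lemma sim_shift n x (a b : 'M[F]_n) : sim a b -> sim (x%:M + a) (x%:M + b).
Proof.
case/simP=> g ug ga; apply/simP; exists g => //.
by rewrite mulmxDl mulmxDr scalar_mxC ga.
Qed.

Lemma span_full n (X : seq 'rV[F]_n) : free X -> size X = n -> <<X>>%VS = fullv.
Proof.
move=> /eqP dX sX; apply/eqP; rewrite eqEdim subvf dX sX.
by rewrite dimvf /dim /= mul1n.
Qed.

Lemma addKscalar n x (a : 'M[F]_n) : x%:M + (a - x%:M) = a.
Proof. by rewrite addrC subrK. Qed.

Lemma shift_span n x (N : 'M[F]_n) (v : 'rV[F]_n) :
  <<[:: v; v *m (x%:M + N)]>>%VS = <<[:: v; v *m N]>>%VS.
Proof.
have E (y : F) (M : 'M[F]_n) (w : 'rV[F]_n) :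
    (<<[:: w; w *m (y%:M + M)]>> <= <<[:: w; w *m M]>>)%VS.
  apply/span_subvP => u; rewrite !inE => /predU1P[->|/eqP->].
    by rewrite memv_span // inE eqxx.
  by apply/span2P; exists y, 1; rewrite mulmxDr mul_mx_scalar scale1r.
apply/eqP; rewrite eqEsubv E /=.
by have := E (- x) (x%:M + N) v; rewrite raddfN addKr.
Qed.

Lemma shift_free n x (N : 'M[F]_n) (v : 'rV[F]_n) :
  free [:: v; v *m (x%:M + N)] = free [:: v; v *m N].
Proof. by rewrite !/(free _) shift_span. Qed.

Lemma free_cyclic n' (a : 'M[F]_n'.+1) (v : 'rV[F]_n'.+1) :
  free [seq v *m a ^+ i | i <- iota 0 n'.+1] -> cyclic a.
Proof.
move=> fX; apply/existsP; exists v.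
have -> : krylov v a = rowsmx n'.+1 [seq v *m a ^+ i | i <- iota 0 n'.+1].
  apply/row_matrixP => i; rewrite !rowK (nth_map 0%N) ?size_iota //.
  by rewrite nth_iota.
by rewrite rowsmx_unit // size_map size_iota.
Qed.

(** Here a is quadratic in the sense of [quadr]. A vector w completing v, v a to a basis satisfies w
    a = x w modulo their span, which supplies x; [quadr_tail] then corrects w into the kernel of a -
    x. *)
Lemma class3 (a : 'M[F]_3) : ~~ cyclic a -> ~~ is_scalar_mx a ->
  exists x b, sim a (x%:M + rank1 3 b).
Proof.
move=> nca /nonscalar_free[v fv].
have qa : quadr a.
  move=> u; apply: contra nca => fu; apply: (@free_cyclic _ _ u).
  by rewrite /= expr0 expr1 expr2 mulmx1 mulmxA.
have [w wN] : exists w, w \notin <<[:: v; v *m a]>>%VS by apply: exists_notin_span.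
have fw : free [:: w; v; v *m a] by rewrite free_cons wN.
have : w *m a \in <<[:: w; v; v *m a]>>%VS by rewrite span_full ?memvf.
case/span3P=> x [y [z]]; rewrite -addrA addrC => wE; pose N := a - x%:M.
have aE : a = x%:M + N by rewrite addKscalar.
have fvN : free [:: v; v *m N] by rewrite -(shift_free x) -aE.
have wNN : w \notin <<[:: v; v *m N]>>%VS by rewrite -(shift_span x) -aE.
have wM : w *m N \in <<[:: v; v *m N]>>%VS.
  rewrite -(shift_span x) -aE; apply/span2P; exists y, z.
  by rewrite mulmxBr mul_mx_scalar wE addrK.
have qN : quadr N by apply: (@quadr_shift _ _ x); rewrite -aE.
have [w' [b [fw' w'N vNN _]]] := quadr_tail qN fvN wNN wM.
exists x, b; rewrite aE; apply: sim_shift.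
apply: (@sim_rows _ [:: v; v *m N; w']) => //.
  by rewrite -(@perm_free _ _ [:: w'; v; v *m N]) // (perm_catC [:: w'] [:: _; _]).
case=> [[|[|[|//]]] lti] /=; rewrite !big_ord_recl big_ord0 !mxE /=.
- by rewrite scale0r scale1r add0r !scale0r !addr0.
- by rewrite vNN !scale0r add0r !addr0.
- by rewrite w'N !scale0r !addr0.
Qed.

Lemma shift_span3 n x (N : 'M[F]_n) (v : 'rV[F]_n) :
  (<<[:: v; v *m (x%:M + N); v *m (x%:M + N) *m (x%:M + N)]>> <=
   <<[:: v; v *m N; v *m N *m N]>>)%VS.
Proof.
apply/span_subvP => u; rewrite !inE => /predU1P[->|/predU1P[->|/eqP->]].
- by rewrite memv_span // inE eqxx.
- apply/span3P; exists x, 1, 0.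
  by rewrite mulmxDr mul_mx_scalar scale1r scale0r addr0.
apply/span3P; exists (x * x), (x + x), 1.
rewrite !mulmxDr !mulmxDl !mul_mx_scalar -!scalemxAl.
move: (v *m N *m N) (v *m N) => vNN vN.
by apply/rowP => i; rewrite !mxE; ring.
Qed.

Lemma cyclic_shift x (a : 'M[F]_4) (u : 'rV[F]_4) :
    (forall W : {vspace 'rV[F]_4},
       (forall w, w \in W -> w *m ((- x)%:M + a) \in W) -> u \in W -> W = fullv) ->
  cyclic a.
Proof.
move=> genu; apply: (@cyclic_gen _ _ _ u) => W stW; apply: genu => w Ww.
by rewrite mulmxDr mul_mx_scalar rpredD ?rpredZ ?stW.
Qed.

(** Complete v, v a, v a a by w, let x be the eigenvalue of a on the quotient line and N = a - x.
    After correction w' N = c v, and v N N N has coefficients r on w' and g on v. A nonzero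
    coefficient would make a cyclic: with cyclic vector w' for c, v for r, and w' + v for g. So all
    three vanish. *)
Lemma class4_cubic (a : 'M[F]_4) (v : 'rV[F]_4) : ~~ cyclic a ->
    free [:: v; v *m a; v *m a *m a] ->
  exists x c b, sim a (x%:M + singular_comp c b).
Proof.
move=> nca fv.
have [w wN] : exists w, w \notin <<[:: v; v *m a; v *m a *m a]>>%VS.
  exact: exists_notin_span.
have : w *m a \in <<[:: w; v; v *m a; v *m a *m a]>>%VS.
  by rewrite span_full ?memvf // free_cons wN.
rewrite span_cons => /memv_addP[_ /vlineP[x ->] [z zin wE]].
pose N := (- x)%:M + a; have aE : a = x%:M + N by rewrite /N raddfN addrA subrr add0r.
have fN : free [:: v; v *m N; v *m N *m N] by apply: free3_shift.
have eqsp : <<[:: v; v *m N; v *m N *m N]>>%VS = <<[:: v; v *m a; v *m a *m a]>>%VS.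
  apply/eqP; rewrite eqEdim shift_span3 (eqP (fN : _ == _)) (eqP (fv : _ == _)).
  by rewrite leqnn.
have : w *m N \in <<[:: v; v *m N; v *m N *m N]>>%VS.
  rewrite eqsp; suff -> : w *m N = z by [].
  by rewrite mulmxDr mul_mx_scalar wE scaleNr addKr.
case/span3P=> c [d [e]]; rewrite -addrA => wNE.
pose w' := w - (d *: v + e *: (v *m N)).
have w'E : w' *m N = c *: v.
  by rewrite mulmxBl mulmxDl -!scalemxAl wNE addrK.
have fX : free [:: w'; v; v *m N; v *m N *m N].
  rewrite free_cons fN andbT -eqsp in wN *; apply: contra wN.
  rewrite /w' => w'in; rewrite -(subrK (d *: v + e *: (v *m N)) w) rpredD //.
  by apply/span3P; exists d, e, 0; rewrite scale0r addr0.
have full (W : {vspace 'rV[F]_4}) : (forall u, u \in W -> u *m N \in W) ->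
    w' \in W -> v \in W -> W = fullv.
  move=> stW Ww Wv; apply/eqP; rewrite eqEsubv subvf -(span_full fX) //.
  apply/span_subvP => u; rewrite !inE => /or4P[] /eqP-> //; first exact: stW.
  by apply/stW/stW.
have divW (W : {vspace 'rV[F]_4}) y (u : 'rV[F]_4) : y != 0 -> y *: u \in W -> u \in W.
  by move=> y0 /(rpredZ y^-1); rewrite scalerA mulVf // scale1r.
have c0 : c = 0.
  apply/eqP/negPn/negP => c0; case/negP: nca.
  apply: (@cyclic_shift x _ w') => W stW Ww; apply: full => //.
  by apply: (divW _ c) => //; rewrite -w'E stW.
rewrite c0 scale0r in w'E.
have : v *m N *m N *m N \in <<[:: w'; v; v *m N; v *m N *m N]>>%VS.
  by rewrite span_full ?memvf.
case/span4P=> r [g [al [be]]]; rewrite -addrA => vE.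
have stN (W : {vspace 'rV[F]_4}) : (forall u, u \in W -> u *m N \in W) ->
    v *m N \in W -> r *: w' + g *: v \in W.
  move=> stW Wv.
  have -> : r *: w' + g *: v =
      v *m N *m N *m N - (al *: (v *m N) + be *: (v *m N *m N)).
    by rewrite vE addrK.
  apply: rpredB; first by do 2!apply: (stW).
  by apply: rpredD; apply: rpredZ => //; apply: stW.
have r0 : r = 0.
  apply/eqP/negPn/negP => r0; case/negP: nca.
  apply: (@cyclic_shift x _ v) => W stW Wv; apply: full => //.
  apply: (divW _ r) => //; rewrite -(addrK (g *: v) (r *: w')).
  by apply: rpredB; [apply: stN => //; apply: stW | apply: rpredZ].
have g0 : g = 0.
  apply/eqP/negPn/negP => g0; case/negP: nca.
  apply: (@cyclic_shift x _ (w' + v)) => W stW Wv.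
  have vN : v *m N \in W by have := stW _ Wv; rewrite mulmxDl w'E add0r.
  have Wv' : v \in W.
    by apply: (divW _ g) => //; have := stN _ stW vN; rewrite r0 scale0r add0r.
  by apply: full => //; rewrite -(addrK v w') rpredB.
exists x, al, be; rewrite aE; apply: sim_shift.
apply: (@sim_rows _ [:: v; v *m N; v *m N *m N; w']) => //.
  by rewrite (@perm_free _ _ _ [:: w'; v; v *m N; v *m N *m N]) //
       (perm_catC [:: _; _; _] [:: w']).
case=> [[|[|[|[|//]]]] lti] /=; rewrite !big_ord_recl big_ord0 !mxE /=.
- by rewrite scale1r !scale0r add0r !addr0.
- by rewrite scale1r !scale0r !add0r addr0.
- by rewrite vE r0 g0 !scale0r !add0r !addr0.
- by rewrite w'E !scale0r !addr0.
Qed.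

(** Each of v, w and v + w satisfies a quadratic relation; independence of v, v a, w, w a forces the
    three relations to have the same coefficients. *)
Lemma double_comp_sim (a : 'M[F]_4) (v w : 'rV[F]_4) : quadr a ->
    free [:: v; v *m a; w; w *m a] -> exists c b, sim a (double_comp c b).
Proof.
move=> qa f4; have /free4P f4P := f4.
have fv : free [:: v; v *m a].
  apply/free2P => x y xy; have [] := f4P x y 0 0; rewrite ?scale0r ?addr0 //.
have fw : free [:: w; w *m a].
  by move: f4; rewrite 2!free_cons => /and3P[].
have quad (u : 'rV[F]_4) : free [:: u; u *m a] ->
    exists c b, u *m a *m a = c *: u + b *: (u *m a).
  rewrite -free_rev => fu; have := @free_spanN _ _ (u *m a *m a) _ fu.
  rewrite -free_rev /= => /(_ (qa u)); rewrite [rev _]/= => /span2P[b [c ->]].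
  by exists c, b; rewrite addrC.
have [c [b vE]] := quad _ fv; have [c' [b' wE]] := quad _ fw.
have fu : free [:: v + w; (v + w) *m a].
  apply/free2P => x y; rewrite mulmxDl !scalerDr => xy.
  have [] := f4P x y x y; last by move=> -> ->.
  by rewrite -[RHS]xy -!addrA; congr (_ + _); rewrite addrCA.
have [s [t]] := quad _ fu; rewrite !mulmxDl vE wE => /eqP; rewrite -subr_eq0 => /eqP E.
have [] := f4P (c - s) (b - t) (c' - s) (b' - t).
  rewrite -[RHS]E; move: (v *m a) (w *m a) => va wa.
  by apply/rowP => i; rewrite !mxE; ring.
move=> /subr0_eq cs /subr0_eq bt /subr0_eq c's /subr0_eq b't; subst.
exists s, t; apply: (@sim_rows _ [:: v; v *m a; w; w *m a]) => //.
case=> [[|[|[|[|//]]]] lti] /=; rewrite !big_ord_recl big_ord0 !mxE /=.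
- by rewrite scale1r !scale0r add0r !addr0.
- by rewrite vE !scale0r !addr0.
- by rewrite scale1r !scale0r !add0r addr0.
- by rewrite wE !scale0r !add0r !addr0.
Qed.

(** If no w makes v, v a, w, w a a basis, then a acts as a scalar x on the quotient by the span of v
    and v a. [quadr_tail] then corrects two complementary vectors into the kernel of a - x. *)
Lemma class4_quadr (a : 'M[F]_4) : quadr a -> ~~ is_scalar_mx a ->
    (exists x b, sim a (x%:M + rank1 4 b)) \/
    (exists c b, sim a (double_comp c b)).
Proof.
move=> qa /nonscalar_free[v fv].
case: (boolP [exists w : 'rV[F]_4, free [:: v; v *m a; w; w *m a]]).
  by case/existsP => w /(double_comp_sim qa); right.
rewrite negb_exists => /forallP nf; left.
have [w1 w1N] : exists w, w \notin <<[:: v; v *m a]>>%VS by apply: exists_notin_span.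
have [w2 w2N] : exists w, w \notin <<[:: w1; v; v *m a]>>%VS.
  exact: exists_notin_span.
have f4 : free [:: w2; w1; v; v *m a] by rewrite free_cons w2N free_cons w1N fv.
have /free4P f4P := f4.
have split_a u : exists p r z, [/\ z \in <<[:: v; v *m a]>>%VS &
    u *m a = p *: w2 + r *: w1 + z].
  have : u *m a \in <<[:: w2; w1; v; v *m a]>>%VS by rewrite span_full ?memvf.
  case/span4P=> p [r [y [z ->]]]; exists p, r, (y *: v + z *: (v *m a)).
  by split; [apply/span2P; exists y, z | rewrite !addrA].
(* Any u whose image is not proportional to u modulo <v, va> would complete a basis. *)
have eig s t p r z : z \in <<[:: v; v *m a]>>%VS ->
    (s *: w2 + t *: w1) *m a = p *: w2 + r *: w1 + z -> s * r = t * p.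
  move=> /span2P[y1 [y2 ->]] uE; apply/eqP; rewrite -subr_eq0; apply/negPn/negP => det0.
  have /negP[] := nf (s *: w2 + t *: w1).
  rewrite uE; apply/free4P => x1 x2 x3 x4 E.
  have [] := f4P (x3 * s + x4 * p) (x3 * t + x4 * r) (x1 + x4 * y1) (x2 + x4 * y2).
    rewrite -[RHS]E; move: (v *m a) => va.
    by apply/rowP => i; rewrite !mxE; ring.
  move=> e1 e2.
  (* Cramer's rule for the system [e1], [e2] in x3 and x4, whose determinant s r - t p is
     nonzero. *)
  have x40 : x4 = 0.
    apply: (mulIf det0); rewrite mul0r.
    have -> : x4 * (s * r - t * p) = s * (x3 * t + x4 * r) - t * (x3 * s + x4 * p) by ring.
    by rewrite e1 e2 !mulr0 subrr.
  have x30 : x3 = 0.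
    apply: (mulIf det0); rewrite mul0r.
    have -> : x3 * (s * r - t * p) =
      r * (x3 * s + x4 * p) - p * (x3 * t + x4 * r) by ring.
    by rewrite e1 e2 !mulr0 subrr.
  by rewrite x40 !mul0r !addr0 => -> ->.
have [p1 [r1 [z1 [z1in w1E]]]] := split_a w1.
have [p2 [r2 [z2 [z2in w2E]]]] := split_a w2.
have p10 : p1 = 0.
  have := eig 0 1 p1 r1 z1 z1in; rewrite scale0r add0r scale1r => /(_ w1E).
  by rewrite mul0r mul1r.
have r20 : r2 = 0.
  have := eig 1 0 p2 r2 z2 z2in; rewrite scale0r addr0 scale1r => /(_ w2E).
  by rewrite mul0r mul1r.
rewrite {}p10 {}r20 !scale0r ?addr0 ?add0r in w1E w2E.
have r1p2 : r1 = p2.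
  have := eig 1 1 p2 r1 (z1 + z2); rewrite rpredD // !scale1r !mul1r; apply=> //.
  by rewrite mulmxDl w1E w2E addrACA [z2 + z1]addrC.
pose x := p2; pose N := (- x)%:M + a.
have aE : a = x%:M + N by rewrite /N raddfN addrA subrr add0r.
have qN : quadr N by apply: (@quadr_shift _ _ x); rewrite -aE.
have spN : <<[:: v; v *m N]>>%VS = <<[:: v; v *m a]>>%VS.
  by rewrite -(shift_span x) -aE.
have fvN : free [:: v; v *m N] by rewrite -(shift_free x) -aE.
have inN w z : w *m a = x *: w + z -> z \in <<[:: v; v *m a]>>%VS ->
    w *m N \in <<[:: v; v *m N]>>%VS.
  by move=> wE zin; rewrite spN mulmxDr mul_mx_scalar wE scaleNr addKr.
have w1NN : w1 *m N \in <<[:: v; v *m N]>>%VS.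
  by apply: (inN _ z1); rewrite // w1E r1p2.
have w2NN : w2 *m N \in <<[:: v; v *m N]>>%VS by apply: (inN _ z2).
rewrite -spN in w1N.
have w2N' : w2 \notin <<[:: v; v *m N]>>%VS.
  apply: contra w2N; rewrite spN => w2in.
  by rewrite span_cons -[w2]add0r memv_add // mem0v.
have [w1' [b [fw1 w1'N vNN [d1 w1'E]]]] := quadr_tail qN fvN w1N w1NN.
have [w2' [b' [fw2 w2'N _ [d2 w2'E]]]] := quadr_tail qN fvN w2N' w2NN.
exists x, b; rewrite aE; apply: sim_shift.
have f4' : free [:: w2'; w1'; v; v *m N].
  rewrite free_cons fw1 andbT; apply: contra w2N.
  rewrite w2'E w1'E => /span3P[c [d [e /(canRL (subrK _)) ->]]].
  rewrite span_cons -spN; have -> : c *: (w1 - d1 *: v) + d *: v + e *: (v *m N) + d2 *: v =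
    c *: w1 + ((d + d2 - c * d1) *: v + e *: (v *m N)).
    by move: (v *m N) => vN; apply/rowP => i; rewrite !mxE; ring.
  apply: memv_add; first by apply/vlineP; exists c.
  by apply/span2P; exists (d + d2 - c * d1), e.
apply: (@sim_rows _ [:: v; v *m N; w2'; w1']) => //.
  rewrite (@perm_free _ _ _ [:: w2'; w1'; v; v *m N]) //.
  by rewrite (perm_catC [:: _; _] [:: w2'; w1']).
case=> [[|[|[|[|//]]]] lti] /=; rewrite !big_ord_recl big_ord0 !mxE /=.
- by rewrite scale1r !scale0r add0r !addr0.
- by rewrite vNN !scale0r add0r !addr0.
- by rewrite w2'N !scale0r !addr0.
- by rewrite w1'N !scale0r !addr0.
Qed.

Lemma class4 (a : 'M[F]_4) : ~~ cyclic a ->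
  [\/ is_scalar_mx a, exists x b, sim a (x%:M + rank1 4 b),
      exists c b, sim a (double_comp c b)
    | exists x c b, sim a (x%:M + singular_comp c b)].
Proof.
move=> nca; case: (boolP (is_scalar_mx a)) => [sa|nsa]; first by constructor 1.
case: (boolP [forall v : 'rV[F]_4, ~~ free [:: v; v *m a; v *m a *m a]]).
  move=> /forallP qa; case: (class4_quadr qa nsa) => ?; first by constructor 2.
  by constructor 3.
rewrite negb_forall => /existsP[v]; rewrite negbK => fv.
by constructor 4; apply: class4_cubic fv.
Qed.

End Representatives.

Lemma eq_cons (T : Type) (x y : T) s t : x = y -> s = t -> x :: s = y :: t.
Proof. by move=> -> ->. Qed.

Ltac mx_entries :=
  rewrite /rank1 /double_comp /singular_comp
    ?(mxs_scalar, mxs_mul, mxs_add, mxs_scale, mxs_block_diag, mxs_block_dr,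
      mxs_block_ur);
  rewrite [LHS]mxs_pad [RHS]mxs_pad /lmx /=; congr (mxs _ _);
  repeat (apply: eq_cons => //); rewrite //=.

(** * Recursions on the number of matrices *)

Section Invariants.
Variables (F : finFieldType).

Lemma cyclic_free n' (a : 'M[F]_n'.+1) : cyclic a ->
  exists v : 'rV[F]_n'.+1, forall c : 'I_n'.+1 -> F,
    \sum_i c i *: (v *m a ^+ i) = 0 -> forall i, c i = 0.
Proof.
case/existsP=> v uk; exists v => c c0 i.
have /rowP/(_ i) : \row_i c i = 0; last by rewrite !mxE.
apply: (can_inj (mulmxK uk)); rewrite mul0mx mulmx_sum_row -[RHS]c0.
by apply: eq_bigr => j _; rewrite rowK mxE.
Qed.

Lemma cyclic_quadrF n (a : 'M[F]_n.+3) : cyclic a -> quadr a -> False.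
Proof.
case/cyclic_free => v fv /(_ v) /negP[]; apply/free3P => x y z E.
have := fv (fun i => [:: x; y; z]`_i); rewrite !big_ord_recl /=.
rewrite big1 => [|i _]; last by rewrite nth_nil scale0r.
rewrite expr0 expr1 expr2 mulmx1 -mulmxE mulmxA addr0 addrA => /(_ E) h.
split; first exact: (h 0).
  exact: (h 1).
by have := h (lift ord0 (lift ord0 ord0)).
Qed.

Lemma quadr_sim n (a b : 'M[F]_n.+1) : sim a b -> quadr a -> quadr b.
Proof.
case/simP=> g ug ga qa v; apply: contra (qa (v *m g)) => /free3P fb.
apply/free3P => x y z; rewrite -[v *m g *m a]mulmxA ga [v *m (b *m g)]mulmxA.
rewrite -[_ *m g *m a]mulmxA ga !mulmxA !scalemxAl -!mulmxDl => E.
rewrite -!scalemxAl in E.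
by apply: fb; apply: (can_inj (mulmxK ug)); rewrite mul0mx.
Qed.

Lemma quadr_rel n (a : 'M[F]_n.+1) c b : a *m a = c%:M + b *: a -> quadr a.
Proof.
move=> aE v; apply/negP => /free3P/(_ c b (- 1)); rewrite -mulmxA aE mulmxDr.
rewrite mul_mx_scalar -scalemxAr scaleN1r subrr => /(_ erefl)[_ _ /eqP].
by rewrite oppr_eq0 oner_eq0.
Qed.

Lemma quadr_scalar n (a : 'M[F]_n.+1) : is_scalar_mx a -> quadr a.
Proof.
case/is_scalar_mxP=> x ->; apply: (@quadr_rel _ _ (x * x) 0).
by rewrite scale0r addr0 -scalar_mxM.
Qed.

Lemma sim_scalar n (a b : 'M[F]_n) : sim a b -> is_scalar_mx a = is_scalar_mx b.
Proof.
have h (c d : 'M[F]_n) : sim c d -> is_scalar_mx c -> is_scalar_mx d.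
  case/simP=> g ug gc /is_scalar_mxP[x cE]; apply/is_scalar_mxP; exists x.
  by apply: (can_inj (mulmxK ug)); rewrite -gc cE scalar_mxC.
by move=> ab; apply/idP/idP; apply: h; rewrite // sim_sym.
Qed.

Lemma sim_rank n x (a b : 'M[F]_n) : sim a b ->
  \rank (a - x%:M) = \rank (b - x%:M).
Proof.
case/simP=> g ug gab; have rg : row_free g by rewrite row_free_unit.
rewrite -(mxrankMfree (b - _) rg) mulmxBl -gab -scalar_mxC -mulmxBr.
by rewrite eqmxMfull // row_full_unit.
Qed.

Lemma sim_trace n (a b : 'M[F]_n) : sim a b -> \tr a = \tr b.
Proof.
case/simP=> g ug ga.
by rewrite -[b](mulmxK ug) -ga mxtrace_mulC mulmxA mulVmx // mul1mx.
Qed.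

Lemma rank_rank1 n b : (\rank (rank1 n b : 'M[F]_n) <= 1)%N.
Proof.
have -> : rank1 n b = (\col_i [:: 1; b]`_i) *m (\row_j [:: 0; 1]`_j).
  apply/matrixP => i j; rewrite !mxE big_ord1 !mxE.
  case: i j => [[|[|i]] /= _] [[|[|j]] /= _];
    by rewrite ?nth_nil ?mul1r ?mulr0 ?mulr1 ?mul0r.
exact: leq_trans (mxrankM_maxr _ _) (rank_leq_row _).
Qed.

Lemma rank1_nonscalar n b : ~~ is_scalar_mx (rank1 n.+2 b : 'M[F]_n.+2).
Proof.
apply/negP => /is_scalar_mxP[x /matrixP/(_ 0 1)] /eqP.
by rewrite !mxE /= mulr0n oner_eq0.
Qed.

(** If x and x' differed, the scalar matrix x' - x, of rank at least 3, would be a difference of two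
    matrices of rank at most 1. The trace then recovers b. *)
Lemma sim_rank1_inj n x b x' b' :
    sim (x%:M + rank1 n.+3 b : 'M[F]_n.+3) (x'%:M + rank1 n.+3 b') ->
  x = x' /\ b = b'.
Proof.
move=> s; have xx' : x = x'.
  apply/eqP/negPn/negP => xx'; have := sim_rank x s.
  rewrite addrC addKr => E.
  have := rank_rank1 n.+3 b'; have := rank_rank1 n.+3 b; rewrite E => r1 r2.
  have := leq_trans (mxrank_add (x'%:M + rank1 n.+3 b' - x%:M) (- rank1 n.+3 b'))
     (leq_add r1 _).
  rewrite mxrank_opp => /(_ _ r2).
  rewrite addrAC addrK -raddfB /= -scalemx1 eqmx_scale ?mxrank1 //.
  by rewrite subr_eq0 eq_sym.
split=> //; have := sim_trace s; rewrite xx' !mxtraceD => /addrI.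
have tr c : \tr (rank1 n.+3 c) = c.
  rewrite /mxtrace !big_ord_recl !mxE /= add0r big1 ?addr0 // => i _.
  by rewrite !mxE /= ?nth_nil.
by rewrite !tr.
Qed.

Lemma double_comp_sqr c b :
  double_comp c b *m double_comp c b = c%:M + b *: double_comp c b :> 'M[F]_4.
Proof.
by mx_entries; ring.
Qed.

Lemma rank_double_comp (c b x : F) : (1 < \rank (double_comp c b - x%:M)%R)%N.
Proof.
(* Rows 0, 2 and columns 1, 3 avoid the diagonal and cut out an identity matrix whatever x is. *)
pose P : 'M[F]_(2, 4) := \matrix_(i, j) (j == i.*2 :> nat)%:R.
pose Q : 'M[F]_(4, 2) := \matrix_(i, j) (i == j.*2.+1 :> nat)%:R.
suff PQ : P *m (double_comp c b - x%:M) *m Q = 1%:M.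
  apply: leq_trans (leq_trans (mxrankM_maxl _ Q) (mxrankM_maxr P _)).
  by rewrite PQ mxrank1.
apply/matrixP => -[[|[|//]] li] -[[|[|//]] lj];
  rewrite !mxE !big_ord_recl big_ord0 !mxE !big_ord_recl !big_ord0 !mxE /=; ring.
Qed.

Lemma double_comp_nonscalar c b : ~~ is_scalar_mx (double_comp c b : 'M[F]_4).
Proof.
apply/negP => /is_scalar_mxP[x E].
by have := rank_double_comp c b x; rewrite E subrr mxrank0.
Qed.

(** Transporting the quadratic relation through the similarity gives (c - c') + (b - b') D = 0 for D
    = [double_comp c b], and 1 and D are independent. *)
Lemma sim_double_comp_inj c b c' b' :
  sim (double_comp c b : 'M[F]_4) (double_comp c' b') -> c = c' /\ b = b'.
Proof.
case/simP=> g ug E.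
have : g *m (double_comp c b *m double_comp c b) =
       double_comp c' b' *m double_comp c' b' *m g.
  by rewrite mulmxA E -mulmxA E mulmxA.
rewrite !double_comp_sqr mulmxDr mulmxDl -scalemxAl -scalemxAr E scalar_mxC.
move/eqP; rewrite -subr_eq0 opprD addrACA -mulmxBl -scalerBl scalemxAl -mulmxDl.
rewrite -(mul0mx _ g) => /eqP /(can_inj (mulmxK ug)) /matrixP h.
have := h 0 1; have := h 0 0; rewrite !mxE /= => h00 h01.
have /subr0_eq -> : c - c' = 0 by rewrite -h00; ring.
by have /subr0_eq -> : b - b' = 0 by rewrite -h01; ring.
Qed.

Lemma cube_conj n (g M N : 'M[F]_n) c b : g \in unitmx -> g *m M = N *m g ->
  N *m N *m N = c *: N + b *: (N *m N) -> M *m M *m M = c *: M + b *: (M *m M).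
Proof.
move=> ug gM NE; apply: (can_inj (mulKmx ug)).
rewrite mulmxDr -!scalemxAr !mulmxA gM -[_ *m g *m M]mulmxA gM mulmxA.
by rewrite -[_ *m g *m M]mulmxA gM mulmxA NE mulmxDl -!scalemxAl.
Qed.

Lemma singular_comp_sqr c b : singular_comp c b *m singular_comp c b =
  mxs 4 [:: [:: 0; 0; 1]; [:: 0; c; b]; [:: 0; b * c; c + b * b]] :> 'M[F]_4.
Proof.
by mx_entries; ring.
Qed.

Lemma singular_comp_cube c b : let N := singular_comp c b : 'M[F]_4 in
  N *m N *m N = c *: N + b *: (N *m N).
Proof.
rewrite /= singular_comp_sqr.
by mx_entries; ring.
Qed.

Lemma singular_comp_quadrF x c b : ~ quadr (x%:M + singular_comp c b : 'M[F]_4).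
Proof.
move=> /quadr_shift/(_ (delta_mx 0 0))/negP[]; apply/free3P => y z t /rowP h.
have e0 : delta_mx 0 0 *m singular_comp c b = delta_mx 0 1 :> 'rV[F]_4.
  by apply/rowP => -[[|[|[|[|//]]]] li]; rewrite -rowE !mxE.
have e1 : delta_mx 0 1 *m singular_comp c b = delta_mx 0 2 :> 'rV[F]_4.
  by apply/rowP => -[[|[|[|[|//]]]] li]; rewrite -rowE !mxE.
rewrite e0 e1 in h; have := h 0; have := h 1; have := h 2; rewrite !mxE /=.
by rewrite !(mulr0, mulr1, addr0, add0r) => -> -> ->.
Qed.

(** With d = x - x', the matrix d + [singular_comp c b] satisfies the cubic relation of
    [singular_comp c' b']. Entry (0, 2) of that relation says b' = 3 d + b, while the traces say b'
    = 4 d + b, so d = 0 in every characteristic. Entry (0, 1) then gives c = c'. *)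
Lemma sim_singular_comp_inj x c b x' c' b' :
    sim (x%:M + singular_comp c b : 'M[F]_4) (x'%:M + singular_comp c' b') ->
  [/\ x = x', c = c' & b = b'].
Proof.
move=> s; have [g ug E] := simP _ _ s.
have [d dE] : exists d, x = d + x' by exists (x - x'); rewrite subrK.
pose M : 'M[F]_4 := d%:M + singular_comp c b.
have gM : g *m M = singular_comp c' b' *m g.
  apply: (addrI (x'%:M *m g)); rewrite -mulmxDl -E -scalar_mxC -mulmxDr.
  by rewrite /M addrA -raddfD /= [x' + d]addrC -dE.
have Mcube := cube_conj ug gM (singular_comp_cube c' b').
have := sim_trace s; rewrite !mxtraceD !mxtrace_scalar.
have tr e f : \tr (singular_comp e f) = f.
  by rewrite /mxtrace !big_ord_recl big_ord0 !mxE /=; ring.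
rewrite !tr => trE.
have b'E : b' = 3%:R * d + b.
  have := congr1 (fun A : 'M[F]_4 => A 0 2) Mcube.
  rewrite !mxE !big_ord_recl !big_ord0 !mxE !big_ord_recl !big_ord0 !mxE /=.
  by move=> H; apply/eqP; rewrite -subr_eq0; apply/eqP; move/eqP: H; rewrite -subr_eq0 => /eqP H;
    rewrite -[RHS]oppr0 -[in RHS]H; ring.
have dE0 : d = 0.
  have -> : d = 4%:R * d + b - b' by rewrite b'E; ring.
  apply/eqP; rewrite subr_eq0; apply/eqP; apply: (addrI (4%:R * x')).
  have -> : 4%:R * x' + b' = x' *+ 4 + b' by ring.
  by rewrite -trE dE; ring.
move: b'E Mcube; rewrite /M dE0 mulr0 !add0r => -> Mcube.
split=> //; first by rewrite dE dE0 add0r.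
have := congr1 (fun A : 'M[F]_4 => A 0 1) Mcube.
rewrite !mxE !big_ord_recl !big_ord0 !mxE !big_ord_recl !big_ord0 !mxE /= => H.
apply/eqP; rewrite -subr_eq0; apply/eqP; move/eqP: H; rewrite -subr_eq0 => /eqP H.
by rewrite -H; ring.
Qed.

End Invariants.

Lemma big_or (R : nmodType) (I : finType) (P Q : pred I) (f : I -> R) :
    (forall i, P i -> Q i -> False) ->
  \sum_(i | P i || Q i) f i = \sum_(i | P i) f i + \sum_(i | Q i) f i.
Proof.
move=> PQ; rewrite (bigID P) /=; congr (_ + _); apply: eq_bigl => i.
  by case: (P i); rewrite ?andbF.
by have := PQ i; case: (P i) => [|_]; rewrite ?andbT //=; case: (Q i) => // /(_ isT isT).
Qed.

(** * Orbit numbers as sums over similarity classes *)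

Section Recursion.
Variable F : finFieldType.
Local Notation q := (#|F|%:R : rat).

Lemma ugl_neq0 n : (ugl F n)%:R != 0 :> rat.
Proof. by rewrite pnatr_eq0 -lt0n ugl_wmx wmx0_gt0. Qed.

Lemma kap_sumE n m : kap m.+1 (0 : 'M[F]_n) =
  \sum_(a : 'M[F]_n) (wmx m a)%:R / (ugl F n)%:R.
Proof. by rewrite /kap wmx0S -ugl_wmx natr_sum mulr_suml. Qed.

(** The class size [ugl F n] / [wmx 0 a] turns the raw count of a class into its normalized
    count. *)
Lemma sum_family n (J : finType) (rep : J -> 'M[F]_n) m :
    (forall i j, sim (rep i) (rep j) -> i = j) ->
  \sum_(a | [exists j, sim a (rep j)]) (wmx m a)%:R / (ugl F n)%:R =
  \sum_j kap m (rep j).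
Proof.
move=> rep_inj; rewrite (sum_sim (f := fun a => (wmx m a)%:R / (ugl F n)%:R)) //.
  apply: eq_bigr => j _; rewrite /kap mulrC -mulrA; congr (_ * _).
  by rewrite mulrA mulVf ?ugl_neq0 // mul1r.
by move=> a b ab; rewrite (wmx_sim _ ab).
Qed.

Lemma sum_cyclic n' m : let n := n'.+1 in
  \sum_(a : 'M[F]_n | cyclic a) (wmx m a)%:R / (ugl F n)%:R = q ^+ n * q ^+ (n * m).
Proof.
rewrite /= -mulr_suml -natr_sum sum_wmx_cyclic !natrM -!natrX.
by rewrite mulrCA mulrA mulfK ?ugl_neq0 // mulrC.
Qed.

Lemma sum_scalar n m : (0 < n)%N ->
  \sum_(a : 'M[F]_n | is_scalar_mx a) (wmx m a)%:R / (ugl F n)%:R = q * kap m (0 : 'M[F]_n).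
Proof.
case: n => // n _.
rewrite (eq_bigl (fun a => [exists x : F, sim a x%:M])) => [|a]; last first.
  apply/is_scalar_mxP/existsP => -[x].
    by move=> ->; exists x; rewrite sim_refl.
  case/simP=> g ug ga; exists x.
  by apply: (can_inj (mulKmx ug)); rewrite ga scalar_mxC.
rewrite sum_family => [|x y /simP[g ug]]; last first.
  rewrite scalar_mxC => /(can_inj (mulmxK ug)) /matrixP/(_ 0 0).
  by rewrite !mxE eqxx.
rewrite (eq_bigr (fun=> kap m (0 : 'M[F]_n.+1))) => [|x _]; last first.
  by rewrite /kap /wmx cmx_scalar cmx0.
by rewrite sumr_const mulr_natl.
Qed.

Lemma kapS2 m : kap m.+1 (0 : 'M[F]_2) = q ^+ 2 * q ^+ (2 * m) + q * kap m (0 : 'M[F]_2).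
Proof.
rewrite kap_sumE (bigID (@cyclic F 1)) /= sum_cyclic; congr (_ + _).
rewrite -(@sum_scalar 2) //; apply: eq_bigl => a; apply/idP/idP => [nca|].
  apply: contraR nca => /nonscalar_free[v fv]; apply: (@free_cyclic _ _ _ v).
  by rewrite /= expr0 expr1 mulmx1.
move=> sa; apply/negP => /cyclic_free[v fv].
have /is_scalar_mxP[x aE] := sa.
have := fv (fun i => [:: x; - 1]`_i); rewrite !big_ord_recl big_ord0 /= addr0.
rewrite expr0 mulmx1 expr1 aE mul_mx_scalar scaleN1r subrr => /(_ erefl)/(_ 1)/eqP.
by rewrite oppr_eq0 oner_eq0.
Qed.

Lemma sum_rank1 n m :
  \sum_(a : 'M[F]_n.+3 | [exists p : F * F, sim a (p.1%:M + rank1 n.+3 p.2)])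
     (wmx m a)%:R / (ugl F n.+3)%:R = q * \sum_b kap m (rank1 n.+3 b : 'M[F]_n.+3).
Proof.
rewrite (sum_family (rep := fun p : F * F => p.1%:M + rank1 n.+3 p.2)); last first.
  by move=> [x b] [y c] /= /sim_rank1_inj[-> ->].
rewrite -(pair_big xpredT xpredT (fun x b => kap m (x%:M + rank1 n.+3 b))) /=.
rewrite (eq_bigr (fun=> \sum_(b : F) kap m (rank1 n.+3 b : 'M[F]_n.+3))) => [|x _]; last first.
  by apply: eq_bigr => b _; rewrite kap_addl.
by rewrite sumr_const mulr_natl.
Qed.

(** The span of v, v M, v M M is stable under a and has dimension at most 3, so no v is cyclic in
    size 4. *)
Lemma cyclic_cubeF x c b (a M : 'M[F]_4) : a = x%:M + M ->
  cyclic a -> M *m M *m M = c *: M + b *: (M *m M) -> False.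
Proof.
move=> aE /existsP[v uk] ME; pose W := <<[:: v; v *m M; v *m M *m M]>>%VS.
have stW w : w \in W -> w *m a \in W.
  have -> : w *m a = x *: w + w *m M.
    by rewrite aE mulmxDr mul_mx_scalar.
  move=> Ww; apply: rpredD; first exact: rpredZ.
  case/span3P: Ww => y [z [t ->]]; apply/span3P; exists 0, (y + t * c), (z + t * b).
  rewrite !mulmxDl -!scalemxAl -!mulmxA (mulmxA M) ME mulmxDr -!scalemxAr.
  move: (v *m M) (v *m (M *m M)) => vM vMM.
  by apply/rowP => i; rewrite !mxE; ring.
have Wk i : v *m a ^+ i \in W.
  elim: i => [|i IHi]; last by rewrite exprSr -mulmxE mulmxA stW.
  by rewrite expr0 mulmx1 memv_span // inE eqxx.
have full w : w \in W.
  rewrite -[w](mulmxKV uk) mulmx_sum_row rpred_sum // => i _.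
  by rewrite rpredZ // rowK.
have [w] := exists_notin_span (isT : (size [:: v; v *m M; v *m M *m M] < 4)%N).
by rewrite full.
Qed.

Lemma quadr_rank1_3 x b : quadr (x%:M + rank1 3 b : 'M[F]_3).
Proof.
apply: (@quadr_rel _ _ _ (- (x * x + b * x)) (x + x + b)).
by mx_entries; ring.
Qed.

Lemma quadr_rank1_4 x b : quadr (x%:M + rank1 4 b : 'M[F]_4).
Proof.
apply: (@quadr_rel _ _ _ (- (x * x + b * x)) (x + x + b)).
by mx_entries; ring.
Qed.

Lemma shift_rank1_nonscalar n x b : ~~ is_scalar_mx (x%:M + rank1 n.+2 b : 'M[F]_n.+2).
Proof.
apply: contra (rank1_nonscalar n b) => /is_scalar_mxP[y yE].
apply/is_scalar_mxP; exists (- x + y).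
by rewrite raddfD raddfN /= -yE addrA addNr add0r.
Qed.

Lemma kapS3 m : kap m.+1 (0 : 'M[F]_3) = q ^+ 3 * q ^+ (3 * m) +
  (q * kap m (0 : 'M[F]_3) + q * \sum_b kap m (rank1 3 b : 'M[F]_3)).
Proof.
rewrite kap_sumE (bigID (@cyclic F 2)) /= sum_cyclic; congr (_ + _).
rewrite -(@sum_scalar 3) // -(@sum_rank1 0) -big_or => [|a sa /existsP[p ap]]; last first.
  by move: sa; rewrite (sim_scalar ap) (negPf (shift_rank1_nonscalar _ _ _)).
apply: eq_bigl => a; apply/idP/orP => [nca|].
  case: (boolP (is_scalar_mx a)) => [|nsa]; first by left.
  by have [x [b ab]] := class3 nca nsa; right; apply/existsP; exists (x, b).
move=> h; apply/negP => /cyclic_quadrF; apply; case: h => [/quadr_scalar //|].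
by case/existsP=> p; rewrite sim_sym => /quadr_sim; apply; apply: quadr_rank1_3.
Qed.

(** The families do not overlap: scalarity, [quadr], and the rank of a - x tell them apart. They
    contain no cyclic matrix, as their members satisfy polynomial relations of degree at most 3. *)
Lemma kapS4 m : kap m.+1 (0 : 'M[F]_4) = q ^+ 4 * q ^+ (4 * m) +
  (q * kap m (0 : 'M[F]_4) + (q * \sum_b kap m (rank1 4 b : 'M[F]_4) +
  (\sum_c \sum_b kap m (double_comp c b : 'M[F]_4) +
   q * \sum_c \sum_b kap m (singular_comp c b : 'M[F]_4)))).
Proof.
rewrite kap_sumE (bigID (@cyclic F 3)) /= sum_cyclic; congr (_ + _).
pose P2 (a : 'M[F]_4) := [exists p : F * F, sim a (p.1%:M + rank1 4 p.2)].
pose P3 (a : 'M[F]_4) := [exists p : F * F, sim a (double_comp p.1 p.2)].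
pose P4 (a : 'M[F]_4) :=
  [exists p : F * (F * F), sim a (p.1%:M + singular_comp p.2.1 p.2.2)].
have q2 a : P2 a -> quadr a.
  by case/existsP=> p; rewrite sim_sym => /quadr_sim; apply; apply: quadr_rank1_4.
have q3 a : P3 a -> quadr a.
  case/existsP=> p; rewrite sim_sym => /quadr_sim; apply.
  exact: quadr_rel (double_comp_sqr _ _).
have q4 a : P4 a -> ~ quadr a.
  case/existsP=> p ap qa; apply: (@singular_comp_quadrF F p.1 p.2.1 p.2.2).
  exact: quadr_sim qa.
have s2 a : P2 a -> ~~ is_scalar_mx a.
  by case/existsP=> p ap; rewrite (sim_scalar ap) shift_rank1_nonscalar.
have s3 a : P3 a -> ~~ is_scalar_mx a.
  by case/existsP=> p ap; rewrite (sim_scalar ap) double_comp_nonscalar.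
have E3 : \sum_c \sum_b kap m (double_comp c b : 'M[F]_4) =
    \sum_(a | P3 a) (wmx m a)%:R / (ugl F 4)%:R.
  rewrite (sum_family (rep := fun p : F * F => double_comp p.1 p.2)); last first.
    by move=> [c b] [c' b'] /= /sim_double_comp_inj[-> ->].
  by rewrite pair_big.
have E4 : q * (\sum_c \sum_b kap m (singular_comp c b : 'M[F]_4)) =
    \sum_(a | P4 a) (wmx m a)%:R / (ugl F 4)%:R.
  rewrite (sum_family (rep := fun p : F * (F * F) => p.1%:M + singular_comp p.2.1 p.2.2));
    last first.
    by move=> [x [c b]] [x' [c' b']] /= /sim_singular_comp_inj[-> -> ->].
  rewrite pair_big -(pair_big xpredT xpredT (fun x (p : F * F) =>
    kap m (x%:M + singular_comp p.1 p.2))) /=.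
  rewrite [RHS](eq_bigr (fun=> \sum_(p : F * F) kap m (singular_comp p.1 p.2 : 'M[F]_4))) => [|x _].
    by rewrite sumr_const mulr_natl.
  by apply: eq_bigr => p _; rewrite kap_addl.
rewrite E3 E4 -(@sum_scalar 4) // -(@sum_rank1 1) -/P2.
rewrite -!big_or.
- apply: eq_bigl => a; apply/idP/or4P => [/class4|].
    case=> [sa|[x [b ab]]|[c [b ab]]|[x [c [b ab]]]].
    + by constructor 1.
    + by constructor 2; apply/existsP; exists (x, b).
    + by constructor 3; apply/existsP; exists (c, b).
    by constructor 4; apply/existsP; exists (x, (c, b)).
  move=> h; apply/negP => ca.
  case: h => [/quadr_scalar||/q3|]; try by apply: cyclic_quadrF.
    by move/q2; apply: cyclic_quadrF.
  case/existsP=> -[x [c b]] /simP[g ug /= ga].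
  apply: (@cyclic_cubeF x c b a (a - x%:M) _ ca); first by rewrite addrC subrK.
  apply: (cube_conj ug) (singular_comp_cube c b).
  by rewrite mulmxBr ga scalar_mxC -mulmxBl addrC addKr.
- by move=> a sa /orP[/s2|/orP[/s3|/q4]]; rewrite ?sa //; apply; apply: quadr_scalar.
- move=> a /[dup] /q2 qa /existsP[p ap] /orP[/existsP[p' ap']|/q4 //].
  have := rank_double_comp p'.1 p'.2 p.1.
  by rewrite -(sim_rank _ ap') (sim_rank _ ap) addrC addKr ltnNge rank_rank1.
by move=> a /q3 qa /q4.
Qed.
End Recursion.

(** * Splitting representatives into smaller blocks *)

Section Blocks.
Variable F : finFieldType.
Local Notation q := (#|F|%:R : rat).

Definition disjoint_mx n1 n2 (a1 : 'M[F]_n1) (a2 : 'M[F]_n2) :=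
  (forall x, a1 *m x = x *m a2 -> x = 0) /\ (forall x, a2 *m x = x *m a1 -> x = 0).

Lemma disjoint_nil_unit n1 n2 (a1 : 'M[F]_n1) (a2 : 'M[F]_n2) :
  a1 *m a1 = 0 -> a2 \in unitmx -> disjoint_mx a1 a2.
Proof.
move=> a10 u2; split=> x ax.
  apply: (can_inj (mulmxK u2)); apply: (can_inj (mulmxK u2)).
  by rewrite /= -ax -[a1 *m x *m a2]mulmxA -ax mulmxA a10 !mul0mx.
apply: (can_inj (mulKmx u2)); apply: (can_inj (mulKmx u2)).
by rewrite /= ax [a2 *m (x *m a1)]mulmxA ax -mulmxA a10 !mulmx0.
Qed.

(** The off-diagonal blocks of a commuting matrix are intertwiners, hence zero, so the centralizer
    is a product algebra. *)
Lemma wmx_block m n1 n2 (a1 : 'M[F]_n1) (a2 : 'M[F]_n2) : disjoint_mx a1 a2 ->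
  wmx m (block_mx a1 0 0 a2) = (wmx m a1 * wmx m a2)%N.
Proof.
case=> d12 d21; pose f (p : 'M[F]_n1 * 'M[F]_n2) := block_mx p.1 0 0 p.2.
have fM p s : f p *m f s = f (p.1 *m s.1, p.2 *m s.2).
  by rewrite /f mulmx_block !(mulmx0, mul0mx, addr0, add0r).
have f_inj : injective f by move=> [x y] [z t] /eq_block_mx[/= -> _ _ ->].
rewrite /wmx -wcomm_prod; have -> : cmx (block_mx a1 0 0 a2) = f @: setX (cmx a1) (cmx a2).
  apply/setP => x; rewrite mem_cmx; apply/eqP/imsetP => [|[[x1 x2]]]; last first.
    by rewrite inE !mem_cmx /= => /andP[/eqP e1 /eqP e2] ->;
       rewrite -[block_mx a1 _ _ _]/(f (a1, a2)) !fM /= e1 e2.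
  rewrite -[x]submxK !mulmx_block !(mulmx0, mul0mx, addr0, add0r).
  case/eq_block_mx => e1 e2 e3 e4; exists (ulsubmx x, drsubmx x).
    by rewrite inE !mem_cmx /= e1 e4 !eqxx.
  by rewrite /f /= (d12 _ e2) (d21 _ e3).
apply: wcomm_imset.
- by move=> p s _ _; apply: f_inj.
- move=> p s _ _; rewrite /comm_mxb !fM (inj_eq f_inj) /=.
  by rewrite xpair_eqE.
by move=> p _; rewrite /= /f !unitmxE det_ublock unitrM.
Qed.

Lemma kap_block m n1 n2 (a1 : 'M[F]_n1) (a2 : 'M[F]_n2) : disjoint_mx a1 a2 ->
  kap m (block_mx a1 0 0 a2) = kap m a1 * kap m a2.
Proof. by move=> d; rewrite /kap !wmx_block // !natrM invfM mulrACA. Qed.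

Lemma kap_cyclic m n' (a : 'M[F]_n'.+1) : cyclic a -> kap m a = q ^+ (n'.+1 * m).
Proof.
move=> ca; rewrite /kap {1}/wmx; have [aC cardC _] := cmx_cyclic ca.
rewrite wcomm_abelian ?cardC => [|c d Cc Cd]; last by rewrite /comm_mxb aC.
by rewrite -expnM natrM mulfK ?natrX // pnatr_eq0 -lt0n wmx0_gt0.
Qed.

Lemma cyclic1 (a : 'M[F]_1) : cyclic a.
Proof.
apply: (@free_cyclic _ _ _ (const_mx 1)); rewrite /= expr0 mulmx1 seq1_free.
by apply/eqP => /rowP/(_ 0)/eqP; rewrite !mxE oner_eq0.
Qed.

Lemma sim_inv n (g h a b : 'M[F]_n) : g *m h = 1%:M -> g *m a = b *m g -> sim a b.
Proof.
by move=> gh ga; apply/simP; exists g => //; have [] := mulmx1_unit gh.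
Qed.

(** For b nonzero the matrix is diagonalizable: e0 - e1 / b and e2 span the kernel and e1 has
    eigenvalue b. The explicit matrices are this change of basis and its inverse. *)
Lemma kap_rank1_3 m b : b != 0 ->
  kap m (rank1 3 b : 'M[F]_3) = kap m (0 : 'M[F]_2) * q ^+ m.
Proof.
move=> b0; have -> : q ^+ m = kap m (b%:M : 'M[F]_1) by rewrite kap_cyclic ?cyclic1 ?mul1n.
have ub : (b%:M : 'M[F]_1) \in unitmx by rewrite unitmxE det_scalar1 unitfE.
rewrite -(@kap_block _ 2 1); last by apply: disjoint_nil_unit; rewrite ?mulmx0.
apply: kap_sim; apply: (@sim_inv 3 (mxs 3 [:: [:: 1; - b^-1; 0]; [:: 0; 0; 1]; [:: 0; 1; 0]])
   (mxs 3 [:: [:: 1; 0; b^-1]; [:: 0; 0; 1]; [:: 0; 1; 0]])).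
  by mx_entries; ring.
by mx_entries; field.
Qed.

Lemma cyclic2 (a : 'M[F]_2) : ~~ is_scalar_mx a -> cyclic a.
Proof.
case/nonscalar_free=> v fv; apply: (@free_cyclic _ _ _ v).
by rewrite /= expr0 expr1 mulmx1.
Qed.

Lemma scalar_unit n (b : F) : b != 0 -> (b%:M : 'M[F]_n) \in unitmx.
Proof. by move=> b0; rewrite unitmxE det_scalar unitrX // unitfE. Qed.

Lemma kap_scalar n m (b : F) : kap m (b%:M : 'M[F]_n) = kap m (0 : 'M[F]_n).
Proof. by rewrite /kap /wmx cmx_scalar cmx0. Qed.

Lemma kap_rank1_4 m b : b != 0 ->
  kap m (rank1 4 b : 'M[F]_4) = kap m (0 : 'M[F]_3) * q ^+ m.
Proof.
move=> b0; have -> : q ^+ m = kap m (b%:M : 'M[F]_1) by rewrite kap_cyclic ?cyclic1 ?mul1n.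
rewrite -(@kap_block _ 3 1); last by apply: disjoint_nil_unit; rewrite ?mulmx0 ?scalar_unit.
apply: kap_sim; apply: (@sim_inv 4
  (mxs 4 [:: [:: 1; - b^-1]; [:: 0; 0; 1]; [:: 0; 0; 0; 1]; [:: 0; 1]])
  (mxs 4 [:: [:: 1; 0; 0; b^-1]; [:: 0; 0; 0; 1]; [:: 0; 1]; [:: 0; 0; 1]])).
  by mx_entries; ring.
by mx_entries; field.
Qed.

(** For c nonzero, t^2 - b t - c is coprime to t, so the matrix splits into a zero block of size 2,
    with new kernel vector - c e0 - b e1 + e2, and an invertible companion block. *)
Lemma kap_singular_comp m c b : c != 0 ->
  kap m (singular_comp c b : 'M[F]_4) = kap m (0 : 'M[F]_2) * q ^+ (2 * m).
Proof.
move=> c0; pose B : 'M[F]_2 := mxs 2 [:: [:: 0; 1]; [:: c; b]].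
have cB : cyclic B.
  apply/cyclic2/is_scalar_mxP => -[x /matrixP/(_ 0 1)/eqP].
  by rewrite !mxE /= mulr0n oner_eq0.
have uB : B \in unitmx.
  have : B *m mxs 2 [:: [:: - b / c; c^-1]; [:: 1; 0]] = 1%:M.
    by rewrite /B; mx_entries; field.
  by case/mulmx1_unit.
rewrite -(kap_cyclic _ cB) -(@kap_block _ 2 2); last first.
  by apply: disjoint_nil_unit; rewrite ?mulmx0.
apply: kap_sim; apply: (@sim_inv 4
  (mxs 4 [:: [:: - c; - b; 1]; [:: 0; 0; 0; 1]; [:: 0; 1]; [:: 0; 0; 1]])
  (mxs 4 [:: [:: - c^-1; 0; - b / c; c^-1]; [:: 0; 0; 1]; [:: 0; 0; 0; 1]; [:: 0; 1]])).
  by mx_entries; field.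
by rewrite /B; mx_entries; ring.
Qed.

Lemma rank1_0_sqr n : rank1 n 0 *m rank1 n 0 = 0 :> 'M[F]_n.
Proof.
apply/matrixP => i j; rewrite !mxE big1 // => k _; rewrite !mxE.
case: i k => [[|[|i]] li] [[|[|k]] lk] /=; rewrite ?nth_nil ?mul0r ?mulr0 //.
by case: (nat_of_ord j) => [|[|l]]; rewrite /= ?mulr0 ?mul0r // nth_nil mulr0.
Qed.

(** The factor t - b of t^2 (t - b) splits off and leaves a nilpotent block of type (2,1). *)
Lemma kap_singular_comp0 m b : b != 0 ->
  kap m (singular_comp 0 b : 'M[F]_4) = kap m (rank1 3 0 : 'M[F]_3) * q ^+ m.
Proof.
move=> b0; have -> : q ^+ m = kap m (b%:M : 'M[F]_1) by rewrite kap_cyclic ?cyclic1 ?mul1n.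
rewrite -(@kap_block _ 3 1); last first.
  by apply: disjoint_nil_unit; rewrite ?rank1_0_sqr ?scalar_unit.
apply: kap_sim; apply: (@sim_inv 4
  (mxs 4 [:: [:: 1; - b^-1]; [:: 0; 1; - b^-1]; [:: 0; 0; 0; 1]; [:: 0; 0; 1]])
  (mxs 4 [:: [:: 1; b^-1; 0; b^-1 / b]; [:: 0; 1; 0; b^-1]; [:: 0; 0; 0; 1]; [:: 0; 0; 1]])).
  by mx_entries; field.
by mx_entries; field.
Qed.

(** The quadratic is (t - x) (t - y), so the matrix is similar to the sum of two scalar blocks of
    size 2 with different eigenvalues. *)
Lemma kap_double_split m x y : x != y ->
  kap m (double_comp (- (x * y)) (x + y) : 'M[F]_4) = kap m (0 : 'M[F]_2) ^+ 2.
Proof.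
move=> xy; have d0 : x - y != 0 by rewrite subr_eq0.
have d0' : y - x != 0 by rewrite subr_eq0 eq_sym.
rewrite expr2 -{2}(kap_scalar _ _ (y - x)) -(@kap_block _ 2 2); last first.
  by apply: disjoint_nil_unit; rewrite ?mulmx0 ?scalar_unit.
rewrite -[RHS](kap_addl _ x).
apply: kap_sim; apply: (@sim_inv 4
  (mxs 4 [:: [:: - y; 1]; [:: 0; 0; - y; 1]; [:: - x; 1]; [:: 0; 0; - x; 1]])
  (mxs 4 [:: [:: (x - y)^-1; 0; - (x - y)^-1]; [:: x / (x - y); 0; - y / (x - y)];
    [:: 0; (x - y)^-1; 0; - (x - y)^-1]; [:: 0; x / (x - y); 0; - y / (x - y)]])).
  by mx_entries; field.
by mx_entries; ring.
Qed.

Lemma kap_double_double m x :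
  kap m (double_comp (- (x * x)) (x + x) : 'M[F]_4) =
  kap m (block_mx 0 1%:M 0 0 : 'M[F]_(2 + 2)).
Proof.
rewrite -[RHS](kap_addl _ x).
apply: kap_sim; apply: (@sim_inv 4
  (mxs 4 [:: [:: 1]; [:: 0; 0; 1]; [:: - x; 1]; [:: 0; 0; - x; 1]])
  (mxs 4 [:: [:: 1]; [:: x; 0; 1]; [:: 0; 1]; [:: 0; x; 0; 1]])).
  by mx_entries; ring.
by mx_entries; ring.
Qed.

End Blocks.

(** * Centralizers of nilpotent representatives *)

Section Structures.
Variable F : finFieldType.
Local Notation q := #|F|.

Lemma ncomm_line (T : finType) (r : rel T) (f : F -> T) (S : {set T}) m :
    injective f -> (forall x y, r (f x) (f y)) -> S = f @: setT ->
  ncomm r m S = (q ^ m)%N.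
Proof.
move=> f_inj rf ->; rewrite ncomm_abelian ?card_imset ?cardsT //.
by move=> _ _ /imsetP[x _ ->] /imsetP[y _ ->].
Qed.

(* Commutation in the centralizers of nilpotent matrices, modulo a central part: *)
(* the listed 2 x 2 minors of the pair (u, v) vanish.                            *)
Definition rel30 : rel (F * F * F) := [rel u v |
  [&& u.1.1 * v.1.2 == v.1.1 * u.1.2, u.1.1 * v.2 == v.1.1 * u.2
    & u.1.2 * v.2 == v.1.2 * u.2]].

Definition rel12 : rel (F * F * F) := [rel u v |
  (u.1.1 * v.1.2 == v.1.1 * u.1.2) && (u.1.1 * v.2 == v.1.1 * u.2)].

Definition rel22 : rel (F * F * (F * F)) := [rel u v |
  [&& u.1.1 * v.1.2 == v.1.1 * u.1.2,
      u.1.1 * v.2.1 == v.1.1 * u.2.1, u.1.1 * v.2.2 == v.1.1 * u.2.2,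
      u.1.2 * v.2.1 == v.1.2 * u.2.1 & u.1.2 * v.2.2 == v.1.2 * u.2.2]].

Lemma scale_eq (x y z t : F) : x != 0 -> x * y = z * t -> y = z / x * t.
Proof. by move=> x0 E; apply: (mulfI x0); rewrite E; field. Qed.

Lemma ncomm30_cent m v : v != (0, 0, 0) -> ncomm rel30 m (cent rel30 setT v) = (q ^ m)%N.
Proof.
case: v => [[a b] c] v0; apply: (@ncomm_line _ _ (fun t => (t * a, t * b, t * c))).
- move=> t s [e1 e2 e3]; move: v0; rewrite !xpair_eqE !negb_and -orbA.
  by case/or3P=> n0; [apply: (mulIf n0) e1 | apply: (mulIf n0) e2 | apply: (mulIf n0) e3].
- by move=> x y; rewrite /rel30 /=; apply/and3P; split; apply/eqP; ring.
apply/setP => -[[x y] z]; rewrite !inE /rel30 /=; apply/and3P/imsetP; last first.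
  by case=> t _ [-> -> ->]; split; apply/eqP; ring.
case=> /eqP e1 /eqP e2 /eqP e3; move: v0; rewrite !xpair_eqE !negb_and -orbA.
case/or3P=> n0.
- by exists (x / a) => //; rewrite -(scale_eq n0 e1) -(scale_eq n0 e2) divfK.
- exists (y / b) => //; rewrite -(scale_eq n0 e3) divfK //.
  by rewrite -(@scale_eq b x y a) // mulrC -e1 mulrC.
exists (z / c) => //; rewrite divfK //.
by rewrite -(@scale_eq c x z a) -?(@scale_eq c y z b) // mulrC -?e2 -?e3 mulrC.
Qed.

Lemma ncomm30S m :
  ncomm rel30 m.+1 setT = (ncomm rel30 m setT + (q ^ 3 - 1) * q ^ m)%N.
Proof.
rewrite /= (bigD1 (0, 0, 0)) ?inE //=; congr (_ + _)%N.
  by congr ncomm; apply/setP => v; rewrite !inE /rel30 /= !mul0r !mulr0 !eqxx.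
rewrite (eq_bigr (fun=> q ^ m)%N) => [|v /andP[_ v0]]; last exact: ncomm30_cent.
rewrite sum_nat_cond_const; congr (_ * _)%N.
have -> : (q ^ 3)%N = #|{: F * F * F}| by rewrite !card_prod !expnS muln1 mulnA.
have := cardsD1 (0, 0, 0) [set: F * F * F]; rewrite inE cardsT => ->.
rewrite add1n subn1 /=.
by apply: eq_card => v; rewrite !inE andbT.
Qed.

(** When the first coordinate of v vanishes, the centralizer is the plane of all such vectors, where
    everything commutes; otherwise it is the line through v. *)
Lemma ncomm12_cent m v : v != (0, 0, 0) ->
  ncomm rel12 m (cent rel12 setT v) = (if v.1.1 == 0%R then (q ^ 2) ^ m else q ^ m)%N.
Proof.
case: v => [[a b] c] v0 /=; case: (eqVneq a 0) => [a0|n0].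
  have -> : cent rel12 setT (a, b, c) = [set (0, x.1, x.2) | x : F * F].
    apply/setP => -[[x y] z]; rewrite !inE /rel12 /= a0 !mul0r.
    apply/andP/imsetP => [[/eqP e1 /eqP e2]|[[s t] _ [-> _ _]]]; last by rewrite !mul0r eqxx.
    exists (y, z) => //=; congr (_, _, _); move: v0; rewrite a0 !xpair_eqE eqxx /=.
    by rewrite negb_and => /orP[] n0; apply: (mulIf n0); rewrite mul0r.
  rewrite ncomm_abelian ?card_imset ?cardsT ?card_prod ?mulnn //.
    by move=> [x y] [z t] [-> ->].
  by move=> _ _ /imsetP[x _ ->] /imsetP[y _ ->]; rewrite /rel12 /= !mul0r eqxx.
apply: (@ncomm_line _ _ (fun t => (t * a, t * b, t * c))).
- by move=> t s [e1 _ _]; apply: (mulIf n0) e1.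
- by move=> x y; rewrite /rel12 /=; apply/andP; split; apply/eqP; ring.
apply/setP => -[[x y] z]; rewrite !inE /rel12 /=; apply/andP/imsetP; last first.
  by case=> t _ [-> -> ->]; split; apply/eqP; ring.
case=> /eqP e1 /eqP e2.
by exists (x / a) => //; rewrite -(scale_eq n0 e1) -(scale_eq n0 e2) divfK.
Qed.

Lemma ncomm12S m : ncomm rel12 m.+1 setT =
  (ncomm rel12 m setT + (q ^ 3 - q ^ 2) * q ^ m + (q ^ 2 - 1) * (q ^ 2) ^ m)%N.
Proof.
rewrite /= (bigD1 (0, 0, 0)) ?inE //= -addnA; congr (_ + _)%N.
  by congr ncomm; apply/setP => v; rewrite !inE /rel12 /= !mul0r !mulr0 !eqxx.
rewrite (eq_bigr (fun v => if v.1.1 == 0%R then (q ^ 2) ^ m else q ^ m)%N) => [|v /andP[_ v0]];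
  last exact: ncomm12_cent.
rewrite (bigID (fun v : F * F * F => v.1.1 != 0)) /=; congr (_ + _)%N.
  rewrite (eq_bigr (fun=> q ^ m)%N) => [|v /andP[_ /negPf ->]] //.
  rewrite sum_nat_cond_const; congr (_ * _)%N.
  transitivity #|setX (setX (~: [set 0 : F]) [set: F]) [set: F]|.
    apply: eq_card => -[[x y] z]; rewrite !inE /= !andbT.
    by rewrite !xpair_eqE; case: (eqVneq x 0); rewrite ?andbF.
  by rewrite !cardsX cardsC1 !cardsT -mulnA mulnn -subn1 mulnBl mul1n -expnS.
rewrite (eq_bigr (fun=> (q ^ 2) ^ m)%N) => [|v /andP[_]]; last by rewrite negbK => ->.
rewrite sum_nat_cond_const; congr (_ * _)%N.
transitivity #|setX (setX [set 0 : F] [set: F]) [set: F] :\ (0, 0, 0)|.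
  by apply: eq_card => -[[x y] z]; rewrite !inE /= !andbT negbK.
have := cardsD1 (0, 0, 0) (setX (setX [set 0 : F] [set: F]) [set: F]).
by rewrite !inE eqxx /= !cardsX cards1 !cardsT mul1n mulnn => ->; rewrite add1n subn1.
Qed.

(** The minor of the last two coordinates is not imposed: vectors with zero first pair commute with
    each other and form the centralizer of each nonzero one of them. Any other v commutes only with
    its line. *)
Lemma ncomm22_cent m v : v != (0, 0, (0, 0)) ->
  ncomm rel22 m (cent rel22 setT v) = (if v.1 == (0, 0)%R then (q ^ 2) ^ m else q ^ m)%N.
Proof.
case: v => [[a b] [c d]] v0 /=; case: (boolP ((a, b) == (0, 0))) => [ab0|].
  move: ab0 v0; rewrite xpair_eqE => /andP[/eqP -> /eqP ->] v0.
  have -> : cent rel22 setT (0, 0, (c, d)) = [set (0, 0, x) | x : F * F].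
    apply/setP => -[[x y] z]; rewrite !inE /rel22 /= !mul0r.
    apply/and5P/imsetP => [[_ /eqP e1 /eqP e2 /eqP e3 /eqP e4]|[s _ [-> -> _]]];
      last by rewrite !mul0r eqxx.
    exists z => //=; congr (_, _, _); move: v0; rewrite !xpair_eqE eqxx /=.
      by rewrite negb_and => /orP[] n0; apply: (mulIf n0); rewrite mul0r.
    by rewrite negb_and => /orP[] n0; apply: (mulIf n0); rewrite mul0r.
  rewrite ncomm_abelian ?card_imset ?cardsT ?card_prod ?mulnn //.
    by move=> x y [].
  by move=> _ _ /imsetP[x _ ->] /imsetP[y _ ->]; rewrite /rel22 /= !mul0r eqxx.
rewrite xpair_eqE negb_and => n0.
apply: (@ncomm_line _ _ (fun t => (t * a, t * b, (t * c, t * d)))).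
- by move=> t s [e1 e2 _ _]; case/orP: n0 => n0; [apply: (mulIf n0) e1 | apply: (mulIf n0) e2].
- by move=> x y; rewrite /rel22 /=; apply/and5P; split; apply/eqP; ring.
apply/setP => -[[x y] [z u]]; rewrite !inE /rel22 /=; apply/and5P/imsetP; last first.
  by case=> t _ [-> -> -> ->]; split; apply/eqP; ring.
case=> /eqP e1 /eqP e2 /eqP e3 /eqP e4 /eqP e5; case/orP: n0 => n0.
  by exists (x / a) => //; rewrite -(scale_eq n0 e1) -(scale_eq n0 e2) -(scale_eq n0 e3) divfK.
exists (y / b) => //; rewrite -(scale_eq n0 e4) -(scale_eq n0 e5) divfK //.
by rewrite -(@scale_eq b x y a) // mulrC -e1 mulrC.
Qed.

Lemma ncomm22S m : ncomm rel22 m.+1 setT =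
  (ncomm rel22 m setT + (q ^ 4 - q ^ 2) * q ^ m + (q ^ 2 - 1) * (q ^ 2) ^ m)%N.
Proof.
rewrite /= (bigD1 (0, 0, (0, 0))) ?inE //= -addnA; congr (_ + _)%N.
  by congr ncomm; apply/setP => v; rewrite !inE /rel22 /= !mul0r !mulr0 !eqxx.
rewrite (eq_bigr (fun v => if v.1 == (0, 0)%R then (q ^ 2) ^ m else q ^ m)%N) => [|v /andP[_ v0]];
  last exact: ncomm22_cent.
rewrite (bigID (fun v : F * F * (F * F) => v.1 != (0, 0))) /=; congr (_ + _)%N.
  rewrite (eq_bigr (fun=> q ^ m)%N) => [|v /andP[_ /negPf ->]] //.
  rewrite sum_nat_cond_const; congr (_ * _)%N.
  transitivity #|setX (~: [set (0, 0) : F * F]) [set: F * F]|.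
    apply: eq_card => -[x y]; rewrite !inE /= !andbT.
    by rewrite xpair_eqE; case: (x == _); rewrite ?andbF.
  rewrite !cardsX cardsC1 !cardsT !card_prod mulnn -subn1 mulnBl mul1n.
  by rewrite -expnD.
rewrite (eq_bigr (fun=> (q ^ 2) ^ m)%N) => [|v /andP[_]]; last by rewrite negbK => ->.
rewrite sum_nat_cond_const; congr (_ * _)%N.
transitivity #|setX [set (0, 0) : F * F] [set: F * F] :\ (0, 0, (0, 0))|.
  by apply: eq_card => -[x y]; rewrite !inE /= !andbT negbK.
have := cardsD1 (0, 0, (0, 0)) (setX [set (0, 0) : F * F] [set: F * F]).
rewrite !inE eqxx /= !cardsX cards1 !cardsT !card_prod mul1n mulnn => ->.
by rewrite add1n subn1.
Qed.

End Structures.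

Lemma ncomm_full (T : finType) m (S : {set T}) : ncomm (fun _ _ => true) m S = (#|S| ^ m)%N.
Proof. by rewrite ncomm_abelian. Qed.

(** The first components impose no condition on the tuple, so m of them are chosen freely; only the
    mark u links them to the rest. *)
Lemma wcomm_center (T1 T2 : finType) (r2 : rel T2) (u : pred (T1 * T2)) m :
  wcomm (prod_rel (fun _ _ => true) r2) u m setT =
  (#|T1| ^ m * \sum_v #|[set z | u (z, v)]| * ncomm r2 m (cent r2 setT v))%N.
Proof.
have setTT : [set: T1 * T2] = setX setT setT by apply/setP => p; rewrite !inE.
rewrite /wcomm setTT.
transitivity (\sum_(p | u p) #|T1| ^ m * ncomm r2 m (cent r2 setT p.2))%N.
  apply: eq_big => [p|p _]; first by rewrite !inE.
  rewrite cent_prod ncomm_prod ncomm_full; congr (_ ^ _ * _)%N.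
  by rewrite -cardsT; apply: eq_card => z; rewrite !inE.
rewrite -big_distrr /=; congr (_ * _)%N.
rewrite (eq_bigl (fun p => xpredT p.2 && u (p.1, p.2))) => [|[z v]] //.
rewrite -(pair_big_dep xpredT (fun (z : T1) v => u (z, v))
   (fun z v => ncomm r2 m (cent r2 setT v))) /=.
rewrite (exchange_big_dep xpredT) //=; apply: eq_bigr => v _.
by rewrite sum_nat_cond_const.
Qed.

Lemma lin1 (V : zmodType) (x1 y1 a b : V) : x1 = y1 -> a - b = x1 - y1 -> a = b.
Proof. by move=> -> /eqP; rewrite subrr subr_eq0 => /eqP. Qed.

(** Closes an equation whose difference of sides equals that of e up to sign. *)
Ltac lin e := first [apply: (lin1 e); ring | apply: (lin1 (esym e)); ring].

Lemma lin2 (R : pzRingType) (x1 y1 x2 y2 a b k1 k2 : R) : x1 = y1 -> x2 = y2 ->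
  a - b = k1 * (x1 - y1) + k2 * (x2 - y2) -> a = b.
Proof. by move=> -> -> /eqP; rewrite !subrr !mulr0 addr0 subr_eq0 => /eqP. Qed.

Lemma lin3 (R : pzRingType) (x1 y1 x2 y2 x3 y3 a b k1 k2 k3 : R) : x1 = y1 -> x2 = y2 -> x3 = y3 ->
  a - b = k1 * (x1 - y1) + k2 * (x2 - y2) + k3 * (x3 - y3) -> a = b.
Proof. by move=> -> -> -> /eqP; rewrite !subrr !mulr0 !addr0 subr_eq0 => /eqP. Qed.

(** * Nilpotent matrices of types (2,1) and (3,1) *)

Section Nilpotent.
Variable F : finFieldType.
Local Notation q := (#|F|).

Lemma wmx_center n (N : 'M[F]_n) (T1 T2 : finType) (r2 : rel T2) (u : pred (T1 * T2))
    (f : T1 * T2 -> 'M[F]_n) m :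
    injective f -> (forall p, f p *m N = N *m f p) ->
    (forall g, g *m N = N *m g -> exists p, g = f p) ->
    (forall p s, comm_mxb (f p) (f s) = r2 p.2 s.2) ->
    (forall p, (f p \in unitmx) = u p) ->
  wmx m N =
  (#|T1| ^ m * \sum_v #|[set z | u (z, v)]| * ncomm r2 m (cent r2 setT v))%N.
Proof.
move=> f_inj fC Cf fr fu; rewrite -wcomm_center /wmx.
have -> : cmx N = f @: setT.
  apply/setP => g; rewrite mem_cmx; apply/eqP/imsetP => [gN|[p _ ->]].
    by have [p ->] := Cf g (esym gN); exists p.
  by rewrite fC.
by apply: wcomm_imset => [p s _ _|p s _ _|p _]; [apply: f_inj | apply: fr | apply: fu].
Qed.

Lemma mxs_eq n s t : mxs n s = mxs n t :> 'M[F]_n -> forall i j, (i < n)%N -> (j < n)%N ->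
  (nth [::] s i)`_j = (nth [::] t i)`_j.
Proof.
by move=> /matrixP st i j li lj; have := st (Ordinal li) (Ordinal lj); rewrite !mxE.
Qed.

Lemma mxs_nat n (g : 'M[F]_n.+1) :
  g = mxs n.+1 (lmx n.+1 n.+1 (fun i j => g (inord i) (inord j))).
Proof. by apply/matrixP => i j; rewrite mxs_lmx !inord_val. Qed.

Lemma mx3_entries (g : 'M[F]_3) : exists a b c d e f h i j,
  g = mxs 3 [:: [:: a; b; c]; [:: d; e; f]; [:: h; i; j]].
Proof. by rewrite [g]mxs_nat /lmx /=; do 9!eexists. Qed.

Lemma mx4_entries (g : 'M[F]_4) : exists a b c d e f h i j k l m n o p s,
  g = mxs 4 [:: [:: a; b; c; d]; [:: e; f; h; i]; [:: j; k; l; m]; [:: n; o; p; s]].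
Proof. by rewrite [g]mxs_nat /lmx /=; do 16!eexists. Qed.

(** The centralizer of the matrix N with a single 1 in the lower left corner. The central part x + c
    N is separated, and the triples (s, b, d) commute when they are proportional. *)
Definition z21 (p : F * F * (F * F * F)) : 'M[F]_3 :=
  let: (x, c, (s, b, d)) := p in mxs 3 [:: [:: x]; [:: d; x + s]; [:: c; b; x]].

(** Every nonzero v contributes q^m, so only the total weight and the weight at 0 matter. *)
Lemma sum_cross (w : F * F * F -> nat) m :
  (\sum_v w v * ncomm (@rel30 F) m (cent (@rel30 F) setT v) =
   w (0, 0, 0)%R * ncomm (@rel30 F) m setT + (\sum_v w v - w (0, 0, 0)%R) * q ^ m)%N.
Proof.
rewrite (bigD1 (0, 0, 0)) //= [in X in (X - _)%N](bigD1 (0, 0, 0)) //= addKn.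
congr (_ * _ + _)%N.
  by congr ncomm; apply/setP => v; rewrite !inE /rel30 /= !mul0r !mulr0 !eqxx.
by rewrite big_distrl; apply: eq_bigr => v v0; rewrite ncomm30_cent.
Qed.

(** Invertibility in [z21] and [z31]: the matrices are triangular with diagonal entries x and x +
    s. *)
Definition unit_pair (C : finType) : pred (F * C * (F * F * F)) :=
  fun p => (p.1.1 != 0) && (p.1.1 + p.2.1.1 != 0).

Lemma sum_unit_pair (C : finType) m :
  (\sum_v #|[set z | @unit_pair C (z, v)]| * ncomm (@rel30 F) m (cent (@rel30 F) setT v) =
   q.-1 * #|C| * ncomm (@rel30 F) m setT +
    (q.-1 ^ 2 * #|C| * q ^ 2 - q.-1 * #|C|) * q ^ m)%N.
Proof.
rewrite (sum_cross (fun v => #|[set z | @unit_pair C (z, v)]|)).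
have -> : #|[set z | @unit_pair C (z, (0, 0, 0)%R)]| = (q.-1 * #|C|)%N.
  rewrite -(cardsC1 (0 : F)) -cardsT -cardsX; apply: eq_card => -[x c].
  by rewrite !inE /unit_pair /= addr0 andbb andbT.
congr (_ + (_ - _) * _)%N.
(* Replacing s by the diagonal entry x + s makes the unit condition a product of two independent
   conditions. *)
pose h (p : F * C * (F * F * F)) := (p.1, (p.2.1.1 - p.1.1, p.2.1.2, p.2.2)).
transitivity #|h @: setX (setX (~: [set 0 : F]) [set: C])
                    (setX (setX (~: [set 0 : F]) [set: F]) [set: F])|.
  rewrite -sum1_card [RHS](partition_big (fun p => p.2) xpredT) //=.
  apply: eq_bigr => v _; rewrite -sum1_card.
  rewrite [RHS](reindex_onto (fun z => (z, v)) (fun p => p.1)) /=.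
    apply: eq_bigl => -[x c]; rewrite !inE !eqxx !andbT /unit_pair /=.
    apply/andP/imsetP => [[x0 y0]|[[[y e] [[s b] d]]]].
      exists ((x, c), (x + v.1.1, v.1.2, v.2)); first by rewrite !inE /= x0 y0.
      by case: v {y0} => [[s b] d]; rewrite /h /= addrC addKr.
    rewrite !inE /= !andbT => /andP[y0 s0] [-> _ ->] /=.
    by rewrite y0 addrC subrK.
  by move=> [z w] /andP[_ /eqP <-].
rewrite card_imset ?cardsX ?cardsC1 ?cardsT; last first.
  by move=> [[x c] [[s b] d]] [[x' c'] [[s' b'] d']] [-> -> /addIr -> -> ->].
by rewrite !expnS !expn0; ring.
Qed.

Lemma wmx_z21 m : wmx m (rank1 3 0 : 'M[F]_3) =
  ((q ^ 2) ^ m * ((q.-1 * q) * ncomm (@rel30 F) m setT +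
     (q.-1 ^ 2 * q ^ 3 - q.-1 * q) * q ^ m))%N.
Proof.
(* Permuting the basis makes the centralizer lower triangular. *)
pose N : 'M[F]_3 := mxs 3 [:: [::]; [::]; [:: 1]].
have -> : wmx m (rank1 3 0 : 'M[F]_3) = wmx m N.
  apply: wmx_sim; apply: (@sim_inv _ _ (mxs 3 [:: [:: 0; 1]; [:: 0; 0; 1]; [:: 1]])
    (mxs 3 [:: [:: 0; 0; 1]; [:: 1]; [:: 0; 1]])); rewrite /N; by mx_entries; ring.
rewrite (@wmx_center _ _ _ _ (@rel30 F) (@unit_pair F) z21); first last.
- move=> [[x c] [[s b] d]]; rewrite unitmxE det_trig; last first.
    by apply/is_trig_mxP => -[[|[|[|//]]] li] -[[|[|[|//]]] lj]; rewrite !mxE.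
  rewrite !big_ord_recl big_ord0 !mxE /= !unitrM unitr1 !unitfE /unit_pair /= andbT.
  by rewrite andbA andbAC andbb.
- move=> [[x c] [[s b] d]] [[x' c'] [[s' b'] d']] /=.
  apply/eqP/and3P => [|[/eqP e1 /eqP e2 /eqP e3]].
    rewrite !mxs_mul => /mxs_eq E.
    have := E 1%N 0%N isT isT; have := E 2 0%N isT isT; have := E 2 1%N isT isT => /= e1 e2 e3.
    by split; apply/eqP; [lin e1 | lin e3 | lin e2].
  by move: e1 e2 e3 => /= e1 e2 e3; mx_entries; first [ring | lin e1 | lin e2 | lin e3].
- move=> g; have [a [b [c [d [e [f [h [i [j ->]]]]]]]]] := mx3_entries g.
  rewrite /N !mxs_mul => /mxs_eq E.
  have := E 0%N 0%N isT isT; have := E 0%N 1%N isT isT; have := E 0%N 2 isT isT.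
  have := E 1%N 0%N isT isT; have := E 2 0%N isT isT; have := E 2 1%N isT isT.
  rewrite /= !(mul0r, mulr0, add0r, addr0, mul1r, mulr1) => e1 e2 e3 e4 e5 e6.
  exists (a, h, (e - a, i, d)); rewrite /z21 e3 e6 -e1 -e2.
  by mx_entries; ring.
- move=> [[x c] [[s b] d]]; rewrite /z21 /N; mx_entries; ring.
- move=> [[x c] [[s b] d]] [[x' c'] [[s' b'] d']] /mxs_eq E.
  have /= e1 := E 0%N 0%N isT isT; have /= e2 := E 1%N 1%N isT isT.
  have /= e3 := E 1%N 0%N isT isT; have /= e4 := E 2 0%N isT isT.
  have /= e5 := E 2 1%N isT isT.
  by move: e2; rewrite e1 e3 e4 e5 => /addrI ->.
rewrite -/(@unit_pair F) sum_unit_pair card_prod mulnn.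
by congr (_ * (_ + (_ - _) * _))%N; ring.
Qed.

(** The same structure as [z21], with central part x + f N + h N^2 for the nilpotent N of type
    (3,1). *)
Definition z31 (p : F * (F * F) * (F * F * F)) : 'M[F]_4 :=
  let: (x, (f, h), (s, b, d)) := p in
  mxs 4 [:: [:: x]; [:: d; x + s]; [:: f; 0; x]; [:: h; b; f; x]].

Lemma wmx_z31 m : wmx m (singular_comp 0 0 : 'M[F]_4) =
  ((q ^ 3) ^ m * ((q.-1 * q ^ 2) * ncomm (@rel30 F) m setT +
     (q.-1 ^ 2 * q ^ 4 - q.-1 * q ^ 2) * q ^ m))%N.
Proof.
pose N : 'M[F]_4 := mxs 4 [:: [::]; [::]; [:: 1]; [:: 0; 0; 1]].
have -> : wmx m (singular_comp 0 0 : 'M[F]_4) = wmx m N.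
  apply: wmx_sim; apply: (@sim_inv _ _
    (mxs 4 [:: [:: 0; 0; 1]; [:: 0; 0; 0; 1]; [:: 0; 1]; [:: 1]])
    (mxs 4 [:: [:: 0; 0; 0; 1]; [:: 0; 0; 1]; [:: 1]; [:: 0; 1]]));
    rewrite /N; by mx_entries; ring.
rewrite (@wmx_center _ _ _ _ (@rel30 F) (@unit_pair (F * F)%type) z31); first last.
- move=> [[x [f h]] [[s b] d]]; rewrite unitmxE det_trig; last first.
    by apply/is_trig_mxP => -[[|[|[|[|//]]]] li] -[[|[|[|[|//]]]] lj]; rewrite !mxE.
  rewrite !big_ord_recl big_ord0 !mxE /= !unitrM unitr1 !unitfE /unit_pair /= andbT.
  by rewrite andbb; case: (x == 0) => //=; rewrite andbT.
- move=> [[x [f h]] [[s b] d]] [[x' [f' h']] [[s' b'] d']] /=.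
  apply/eqP/and3P => [|[/eqP e1 /eqP e2 /eqP e3]].
    rewrite !mxs_mul => /mxs_eq E.
    have := E 1%N 0%N isT isT; have := E 3 0%N isT isT; have := E 3 1%N isT isT => /= e1 e2 e3.
    by split; apply/eqP; [lin e1 | lin e3 | lin e2].
  by move: e1 e2 e3 => /= e1 e2 e3; mx_entries; first [ring | lin e1 | lin e2 | lin e3].
- move=> g; have [a [b [c [d [e [f [h [i [j [k [l [m' [n [o [p [s ->]]]]]]]]]]]]]]]] :=
    mx4_entries g.
  rewrite /N !mxs_mul => /mxs_eq E.
  have := E 0%N 0%N isT isT; have := E 0%N 2 isT isT.
  have := E 1%N 0%N isT isT; have := E 1%N 2 isT isT.
  have := E 2 0%N isT isT; have := E 2 1%N isT isT; have := E 2 2 isT isT.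
  have := E 3 0%N isT isT; have := E 3 1%N isT isT; have := E 3 2 isT isT.
  rewrite /= !(mul0r, mulr0, add0r, addr0, mul1r, mulr1).
  move=> -> <- -> e4 <- -> e7 e8 e9 e10; move: e4 e7 e8 e9 e10 => -> -> -> -> ->.
  exists (a, (j, n), (f - a, o, e)); rewrite /z31.
  by mx_entries; ring.
- move=> [[x [f h]] [[s b] d]]; rewrite /z31 /N; mx_entries; ring.
- move=> [[x [f h]] [[s b] d]] [[x' [f' h']] [[s' b'] d']] /mxs_eq E.
  have /= e1 := E 0%N 0%N isT isT; have /= e2 := E 1%N 1%N isT isT.
  have /= e3 := E 1%N 0%N isT isT; have /= e4 := E 2 0%N isT isT.
  have /= e5 := E 3 0%N isT isT; have /= e6 := E 3 1%N isT isT.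
  by move: e2; rewrite e1 e3 e4 e5 e6 => /addrI ->.
rewrite sum_unit_pair !card_prod.
by congr (_ ^ _ * (_ + (_ - _) * _))%N; ring.
Qed.

End Nilpotent.

(** * The type (2,2): matrices of size 2 over the dual numbers *)

Section TwoByTwo.
Variable F : finFieldType.
Local Notation q := (#|F|).

Lemma mx2_entries (g : 'M[F]_2) : exists a b c d, g = mxs 2 [:: [:: a; b]; [:: c; d]].
Proof. by rewrite [g]mxs_nat /lmx /=; do 4!eexists. Qed.

Lemma scalar_line_inj n (Y : 'M[F]_n.+1) : ~~ is_scalar_mx Y ->
  injective (fun p : F * F => p.1%:M + p.2 *: Y).
Proof.
move=> nsY [p r] [p' r'] /= E.
have rr' : r = r'.
  apply/eqP/negPn/negP => rr'; case/is_scalar_mxP: nsY; exists ((r' - r)^-1 * (p - p')).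
  have d0 : r' - r != 0 by rewrite subr_eq0 eq_sym.
  apply: (scalerI d0); rewrite scale_scalar_mx mulrA divff // mul1r.
  rewrite scalerBl raddfB /=; apply/esym/eqP; rewrite -subr_eq0 opprB addrACA -opprD E.
  by rewrite subrr.
move: E; rewrite rr' => /addIr /matrixP/(_ 0 0).
by rewrite !mxE eqxx !mulr1n => ->.
Qed.

Lemma cmx2_nonscalar (Y : 'M[F]_2) : ~~ is_scalar_mx Y ->
  cmx Y = [set p.1%:M + p.2 *: Y | p : F * F].
Proof.
move=> nsY; apply/esym/eqP; rewrite eqEcard; apply/andP; split.
  apply/subsetP => _ /imsetP[[p r] _ ->]; rewrite mem_cmx /=.
  by rewrite mulmxDl mulmxDr scalar_mxC -scalemxAl -scalemxAr.
have [_ -> _] := cmx_cyclic (cyclic2 nsY).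
by rewrite (card_imset _ (scalar_line_inj nsY)) card_prod mulnn.
Qed.

Lemma card_scalar_mx n : #|[set a : 'M[F]_n.+1 | is_scalar_mx a]| = q.
Proof.
have -> : [set a : 'M[F]_n.+1 | is_scalar_mx a] = (fun x : F => x%:M) @: setT.
  apply/setP => a; rewrite inE; apply/is_scalar_mxP/imsetP => -[x].
    by exists x.
  by move=> _ ->; exists x.
rewrite card_imset ?cardsT // => x y /matrixP/(_ 0 0).
by rewrite !mxE eqxx !mulr1n.
Qed.

Lemma sim_comp2 (Y : 'M[F]_2) : ~~ is_scalar_mx Y ->
  exists c b, sim Y (mxs 2 [:: [:: 0; 1]; [:: c; b]]).
Proof.
case/nonscalar_free => v fv.
have : v *m Y *m Y \in <<[:: v; v *m Y]>>%VS by rewrite span_full ?memvf.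
case/span2P=> c [b E]; exists c, b; apply: (@sim_rows _ _ [:: v; v *m Y]) => //.
case=> [[|[|//]] li] /=; rewrite !big_ord_recl big_ord0 !mxE /=.
  by rewrite scale0r scale1r add0r addr0.
by rewrite E addr0.
Qed.

(* A pair (Y0, Y1) stands for Y0 + Y1 e in M_2(F[e]/e^2). *)
Definition rel_eps : rel ('M[F]_2 * 'M[F]_2) := [rel u v |
  (u.1 *m v.1 == v.1 *m u.1) && (u.1 *m v.2 + u.2 *m v.1 == v.1 *m u.2 + v.2 *m u.1)].

Lemma wmx_eps m : wmx m (block_mx 0 1%:M 0 0 : 'M[F]_(2 + 2)) =
  wcomm rel_eps (fun u => u.1 \in unitmx) m setT.
Proof.
pose f (u : 'M[F]_2 * 'M[F]_2) : 'M[F]_(2 + 2) := block_mx u.1 u.2 0 u.1.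
rewrite /wmx; have -> : cmx (block_mx 0 1%:M 0 0 : 'M[F]_(2 + 2)) = f @: setT.
  apply/setP => g; rewrite mem_cmx -[g]submxK !mulmx_block.
  rewrite !(mul0mx, mulmx0, mul1mx, mulmx1, addr0, add0r).
  apply/eqP/imsetP => [/eq_block_mx[e1 e2 _ _]|[u _ /eq_block_mx[-> _ -> ->]]] //.
  by exists (ulsubmx g, ursubmx g); rewrite // /f /= e1 e2.
apply: wcomm_imset.
- by move=> [x y] [z t] _ _ /eq_block_mx[/= -> -> _ _].
- move=> [x y] [z t] _ _; rewrite /comm_mxb /f /rel_eps !mulmx_block /=.
  rewrite !(mul0mx, mulmx0, addr0, add0r).
  by apply/eqP/andP => [/eq_block_mx[-> -> _ _]|[/eqP -> /eqP ->]].
by move=> [x y] _; rewrite /= /f unitmxE det_ublock unitrM andbb unitmxE.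
Qed.

(** The centralizer of X + Y e is the set of all (p + s e) + (r + t e) (X + Y e), which is
    commutative of order q^4. *)
Lemma ncomm_eps_abelian m (u : 'M[F]_2 * 'M[F]_2) : ~~ is_scalar_mx u.1 ->
  ncomm rel_eps m (cent rel_eps setT u) = ((q ^ 4) ^ m)%N.
Proof.
case: u => X Y /= nsX.
pose h (p : F * F * (F * F)) :=
  (p.1.1%:M + p.1.2 *: X, p.1.2 *: Y + (p.2.1%:M + p.2.2 *: X)).
have -> : cent rel_eps setT (X, Y) = h @: setT.
  apply/setP => -[X' Y']; rewrite !inE /rel_eps /=; apply/andP/imsetP.
    case=> XX'; have : X' \in cmx X by rewrite mem_cmx.
    rewrite cmx2_nonscalar // => /imsetP[[p r] _ /= ->] /eqP E.
    have : Y' - r *: Y \in cmx X.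
      move: E; rewrite mem_cmx mulmxBl mulmxBr mulmxDl mulmxDr mul_scalar_mx mul_mx_scalar.
      rewrite -!scalemxAl -!scalemxAr.
      move: (X *m Y') (Y *m X) (X *m Y) (Y' *m X) => M1 M2 M3 M4 /matrixP E.
      by apply/eqP/matrixP => i j; have := E i j; rewrite !mxE => e; lin e.
    rewrite cmx2_nonscalar // => /imsetP[[s t] _ /= E'].
    by exists (p, r, (s, t)) => //; congr pair; rewrite /= -E' addrC subrK.
  case=> -[[p r] [s t]] _ [-> ->]; have [a [b [c [d ->]]]] := mx2_entries X.
  have [a' [b' [c' [d' ->]]]] := mx2_entries Y.
  by split; apply/eqP; mx_entries; ring.
rewrite ncomm_abelian.
  rewrite card_imset ?cardsT ?card_prod ?mulnn -?expnM ?mulnA //.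
  move=> [[p r] [s t]] [[p' r'] [s' t']] [].
  move=> /(@scalar_line_inj _ _ nsX (p, r) (p', r')) [-> ->] /addrI.
  by move=> /(@scalar_line_inj _ _ nsX (s, t) (s', t')) [-> ->].
move=> _ _ /imsetP[[[p r] [s t]] _ ->] /imsetP[[[p' r'] [s' t']] _ ->].
rewrite /rel_eps /h /=; have [a [b [c [d ->]]]] := mx2_entries X.
have [a' [b' [c' [d' ->]]]] := mx2_entries Y.
by apply/andP; split; apply/eqP; mx_entries; ring.
Qed.

(** Commuting with x + Y e only requires X' to commute with Y. After conjugating Y to its companion
    matrix B, X' = p + r B, and Y' is s + e B plus a matrix with second row (y, w). The parameters
    p, s, e are central, and two elements commute when r (y', w') = r' (y, w), which is [rel12]. *)
Lemma ncomm_eps_mixed m (u : 'M[F]_2 * 'M[F]_2) :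
    is_scalar_mx u.1 -> ~~ is_scalar_mx u.2 ->
  ncomm rel_eps m (cent rel_eps setT u) = ((q ^ 3) ^ m * ncomm (@rel12 F) m setT)%N.
Proof.
case: u => X Y /= /is_scalar_mxP[x ->] nsY.
have [c [b /simP[g ug gY]]] := sim_comp2 nsY.
set B := mxs 2 _ in gY.
have nsB : ~~ is_scalar_mx B by rewrite -(@sim_scalar _ _ Y) //; apply/simP; exists g.
pose h (p : F * F * F * (F * F * F)) : 'M[F]_2 * 'M[F]_2 :=
  let: (p, s, e, (r, y, w)) := p in
  (invmx g *m (p%:M + r *: B) *m g,
   invmx g *m mxs 2 [:: [:: s; e]; [:: y + c * e; w + s + b * e]] *m g).
have gK (A : 'M[F]_2) : g *m (invmx g *m A *m g) *m invmx g = A.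
  by rewrite !mulmxA mulmxV // mul1mx mulmxK.
have Kg (A : 'M[F]_2) : invmx g *m (g *m A *m invmx g) *m g = A.
  by rewrite !mulmxA mulVmx // mul1mx mulmxKV.
have conjM (A C : 'M[F]_2) :
    invmx g *m A *m g *m (invmx g *m C *m g) = invmx g *m (A *m C) *m g.
  by rewrite !mulmxA mulmxK.
have conj_inj : injective (fun A : 'M[F]_2 => invmx g *m A *m g).
  by move=> A C /= E; rewrite -[A]gK -[C]gK E.
have -> : cent rel_eps setT (x%:M, Y) = h @: setT.
  apply/setP => -[X' Y']; rewrite !inE /rel_eps /=.
  rewrite !scalar_mxC eqxx /= addrC (inj_eq (addIr _)).
  have YE : Y = invmx g *m B *m g by rewrite -mulmxA -gY mulKmx.
  apply/eqP/imsetP => [E|[[[[p s] e] [[r y] w]] _ [-> _]]]; last first.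
    rewrite YE !conjM; congr (_ *m _ *m _).
    by rewrite mulmxDl mulmxDr scalar_mxC -scalemxAl -scalemxAr.
  have : g *m X' *m invmx g \in cmx B.
    rewrite mem_cmx; apply/eqP/conj_inj; rewrite /= -(conjM B) -(conjM _ B) Kg -YE; exact: E.
  rewrite cmx2_nonscalar // => /imsetP[[p r] _ /= E1].
  have [s [e [k [l E2]]]] := mx2_entries (g *m Y' *m invmx g).
  exists (p, s, e, (r, k - c * e, l - s - b * e)) => //; rewrite /h -E1 Kg.
  congr pair; rewrite -[Y']Kg E2; congr (_ *m _ *m _); mx_entries; ring.
have h_inj : injective h.
  move=> [[[p s] e] [[r y] w]] [[[p' s'] e'] [[r' y'] w']] [/conj_inj + /conj_inj].
  move=> /(@scalar_line_inj _ _ nsB (p, r) (p', r')) [-> ->] /mxs_eq E.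
  have /= -> := E 0%N 0%N isT isT; have /= -> := E 0%N 1%N isT isT.
  have /= := E 1%N 0%N isT isT; have /= := E 1%N 1%N isT isT.
  have /= -> := E 0%N 0%N isT isT; have /= -> := E 0%N 1%N isT isT.
  by move=> /addIr/addIr -> /addIr ->.
rewrite (ncomm_imset (r := prod_rel (fun _ _ => true) (@rel12 F))).
- have -> : [set: F * F * F * (F * F * F)] = setX setT setT.
    by apply/setP => p; rewrite !inE.
  by rewrite ncomm_prod ncomm_full cardsT !card_prod; congr (_ ^ _ * _)%N; ring.
- by move=> p p' _ _; apply: h_inj.
move=> [[[p s] e] [[r y] w]] [[[p' s'] e'] [[r' y'] w']] _ _.
rewrite /rel_eps /h /= !conjM -!mulmxDl -!mulmxDr !(inj_eq conj_inj).
rewrite [X in X && _](_ : _ = true) /=; last first.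
  by apply/eqP; rewrite /B; mx_entries; ring.
rewrite [RHS]andTb; apply/eqP/andP => [|[/= /eqP e1 /eqP e2]].
  rewrite /B ?(mxs_scalar, mxs_mul, mxs_add, mxs_scale) /lmx /= => /mxs_eq E.
  have /= e1 := E 0%N 0%N isT isT; have /= e2 := E 0%N 1%N isT isT.
  by split; apply/eqP; [lin e1 | lin e2].
rewrite /B; mx_entries; try by first [lin e1 | lin e2].
by apply: (@lin2 _ _ _ _ _ _ _ b (- c) e1 e2); ring.
Qed.

Lemma ncomm_eps_scalar m (u : 'M[F]_2 * 'M[F]_2) :
    is_scalar_mx u.1 -> is_scalar_mx u.2 ->
  ncomm rel_eps m (cent rel_eps setT u) = ncomm rel_eps m setT.
Proof.
case: u => X Y /= /is_scalar_mxP[x ->] /is_scalar_mxP[y ->]; congr ncomm.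
apply/setP => -[X' Y']; rewrite !inE /rel_eps /=.
by rewrite !scalar_mxC !eqxx /= addrC eqxx.
Qed.

Lemma card_nonscalar_mx n : #|[set a : 'M[F]_n.+1 | ~~ is_scalar_mx a]| =
  (q ^ (n.+1 * n.+1) - q)%N.
Proof.
rewrite -{2}(card_scalar_mx n) -card_mx -(cardsC [set a | is_scalar_mx a]) addKn.
by apply: eq_card => a; rewrite !inE.
Qed.

Lemma sum_scalar_cases n (P : pred 'M[F]_n.+1) (f : 'M[F]_n.+1 -> nat) x y :
    (forall a, is_scalar_mx a -> f a = x) -> (forall a, ~~ is_scalar_mx a -> f a = y) ->
  (\sum_(a | P a) f a = #|[set a | P a & is_scalar_mx a]| * x +
     #|[set a | P a & ~~ is_scalar_mx a]| * y)%N.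
Proof.
move=> fx fy; rewrite (bigID (@is_scalar_mx F n.+1)) /=; congr (_ + _)%N.
  rewrite (eq_bigr (fun=> x)) => [|a /andP[_ sa]]; last exact: fx.
  by rewrite sum_nat_cond_const.
rewrite (eq_bigr (fun=> y)) => [|a /andP[_ sa]]; last exact: fy.
by rewrite sum_nat_cond_const.
Qed.

Lemma sum_eps (P : pred 'M[F]_2) m :
  (\sum_(u : 'M[F]_2 * 'M[F]_2 | P u.1) ncomm rel_eps m (cent rel_eps setT u) =
   #|[set a | P a & is_scalar_mx a]| *
     (q * ncomm rel_eps m setT + (q ^ 4 - q) * ((q ^ 3) ^ m * ncomm (@rel12 F) m setT)) +
   #|[set a | P a & ~~ is_scalar_mx a]| * (q ^ 4 * (q ^ 4) ^ m))%N.
Proof.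
rewrite (eq_bigl (fun u => P u.1 && xpredT u.2)) => [|u]; last by rewrite andbT.
rewrite -(pair_big P xpredT (fun X Y => ncomm rel_eps m (cent rel_eps setT (X, Y)))) /=.
apply: sum_scalar_cases => X sX.
  rewrite (@sum_scalar_cases _ _ _ (ncomm rel_eps m setT)
    ((q ^ 3) ^ m * ncomm (@rel12 F) m setT)%N).
  - have -> : [set a : 'M[F]_2 | xpredT a & is_scalar_mx a] = [set a | is_scalar_mx a] by [].
    have -> : [set a : 'M[F]_2 | xpredT a & ~~ is_scalar_mx a] = [set a | ~~ is_scalar_mx a] by [].
    by rewrite card_scalar_mx card_nonscalar_mx.
  - by move=> Y sY; apply: ncomm_eps_scalar.
  by move=> Y sY; apply: ncomm_eps_mixed.
rewrite (eq_bigr (fun=> (q ^ 4) ^ m)%N) => [|Y _]; last exact: ncomm_eps_abelian.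
by rewrite sum_nat_const card_mx.
Qed.

Lemma ncomm_epsS m : ncomm rel_eps m.+1 setT =
  (q * (q * ncomm rel_eps m setT + (q ^ 4 - q) * ((q ^ 3) ^ m * ncomm (@rel12 F) m setT)) +
   (q ^ 4 - q) * (q ^ 4 * (q ^ 4) ^ m))%N.
Proof.
rewrite /= (eq_bigl (fun u => xpredT u.1)) => [|u]; last by rewrite inE.
rewrite (sum_eps xpredT).
have -> : [set a : 'M[F]_2 | xpredT a & is_scalar_mx a] = [set a | is_scalar_mx a] by [].
have -> : [set a : 'M[F]_2 | xpredT a & ~~ is_scalar_mx a] = [set a | ~~ is_scalar_mx a] by [].
by rewrite card_scalar_mx card_nonscalar_mx.
Qed.

Lemma card_unit_scalar n : #|[set a : 'M[F]_n.+1 | (a \in unitmx) && is_scalar_mx a]| = q.-1.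
Proof.
have -> : [set a : 'M[F]_n.+1 | (a \in unitmx) && is_scalar_mx a] =
    (fun x : F => x%:M) @: (~: [set 0]).
  apply/setP => a; rewrite inE; apply/andP/imsetP => [[ua /is_scalar_mxP[x aE]]|[x]].
    exists x => //; rewrite !inE; apply: contraTneq ua => x0.
    by rewrite aE x0 raddf0 unitmxE det0 unitr0.
  by rewrite !inE => x0 ->; rewrite scalar_unit //; split=> //; apply/is_scalar_mxP; exists x.
rewrite card_imset ?cardsC1 // => x y /matrixP/(_ 0 0).
by rewrite !mxE eqxx !mulr1n.
Qed.

Lemma card_unit_nonscalar n :
  #|[set a : 'M[F]_n.+1 | (a \in unitmx) && ~~ is_scalar_mx a]| = (ugl F n.+1 - q.-1)%N.
Proof.
rewrite /ugl -[X in (X - _)%N](cardsID [set a | is_scalar_mx a]) -(card_unit_scalar n).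
rewrite (_ : _ :&: _ = [set a : 'M[F]_n.+1 | (a \in unitmx) && is_scalar_mx a]); last first.
  by apply/setP => a; rewrite !inE.
by rewrite addKn; apply: eq_card => a; rewrite !inE andbC.
Qed.

Lemma wmx_epsE m : wmx m (block_mx 0 1%:M 0 0 : 'M[F]_(2 + 2)) =
  (q.-1 * (q * ncomm rel_eps m setT + (q ^ 4 - q) * ((q ^ 3) ^ m * ncomm (@rel12 F) m setT)) +
   (ugl F 2 - q.-1) * (q ^ 4 * (q ^ 4) ^ m))%N.
Proof.
rewrite wmx_eps /wcomm (eq_bigl (fun u => u.1 \in unitmx)) => [|u]; last by rewrite !inE.
by rewrite (sum_eps (fun a => a \in unitmx)) card_unit_scalar card_unit_nonscalar.
Qed.

End TwoByTwo.

(** * The type (2,1,1) *)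

Section RankOneSquareZero.
Variable F : finFieldType.
Local Notation q := (#|F|).

Definition tri := ('M[F]_2 * ('rV[F]_2 * 'cV[F]_2))%type.

(* z211 below parametrizes the centralizer of a square-zero matrix of rank 1 in    *)
(* size 4; rel8 is commutation of its last component, the first two being central. *)
Definition rel8 : rel tri := [rel u v |
  [&& u.1 *m v.1 == v.1 *m u.1, u.2.1 *m v.1 == v.2.1 *m u.1,
      u.1 *m v.2.2 == v.1 *m u.2.2 & u.2.1 *m v.2.2 == v.2.1 *m u.2.2]].

Lemma eq_sub_eq (V : zmodType) (a b c d : V) : a - b = c - d -> (a == b) = (c == d).
Proof. by move=> abcd; rewrite -subr_eq0 abcd subr_eq0. Qed.

Lemma eqE_block_mx m1 m2 n1 n2 (A A' : 'M[F]_(m1, n1)) (B B' : 'M_(m1, n2))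
    (C C' : 'M_(m2, n1)) (D D' : 'M_(m2, n2)) :
  (block_mx A B C D == block_mx A' B' C' D') = [&& A == A', B == B', C == C' & D == D'].
Proof.
apply/eqP/and4P => [/eq_block_mx[-> -> -> ->] //|].
by case=> /eqP-> /eqP-> /eqP-> /eqP->.
Qed.

Lemma eqE_col_mx m1 m2 n (A A' : 'M[F]_(m1, n)) (B B' : 'M_(m2, n)) :
  (col_mx A B == col_mx A' B') = (A == A') && (B == B').
Proof. by apply/eqP/andP => [/eq_col_mx[-> ->] //|[/eqP-> /eqP->]]. Qed.

(** Block lower triangular with diagonal blocks x, x + T, x; writing the middle block as x + T
    removes x from the commutation relation. *)
Definition z211 (p : F * F * tri) : 'M[F]_(1 + (2 + 1)) :=
  block_mx p.1.1%:M 0 (col_mx p.2.2.2 p.1.2%:M)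
    (block_mx (p.1.1%:M + p.2.1) 0 p.2.2.1 p.1.1%:M).

Definition unit211 (p : F * F * tri) := (p.1.1 != 0) && (p.1.1%:M + p.2.1 \in unitmx).

Lemma wmx_z211 m : wmx m (rank1 4 0 : 'M[F]_4) =
  ((q ^ 2) ^ m * \sum_v #|[set z | unit211 (z, v)]| * ncomm rel8 m (cent rel8 setT v))%N.
Proof.
pose N : 'M[F]_(1 + (2 + 1)) := block_mx 0 0 (col_mx 0 1%:M) 0.
have -> : wmx m (rank1 4 0 : 'M[F]_4) = wmx m N.
  have NE : N = mxs 4 [:: [::]; [::]; [::]; [:: 1]].
    rewrite /N; apply/matrixP => i j; rewrite [RHS]mxE.
    case: (split_ordP i) => i' ->; case: (split_ordP j) => j' ->.
    - by rewrite block_mxEul mxE /= !ord1 /= ?nth_nil.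
    - by rewrite block_mxEur mxE /= !ord1 /= ?nth_nil.
    - rewrite block_mxEdl ord1; case: (split_ordP i') => k ->.
        by rewrite col_mxEu mxE /=; case: k => [[|[|//]] lk].
      by rewrite col_mxEd !ord1 mxE.
    rewrite block_mxEdr mxE /=; case: i' => [[|[|[|//]]] li] //=.
    by case: j' => [[|[|[|//]]] lj].
  apply: (@wmx_sim F 4 m _ N); rewrite NE; apply: (@sim_inv _ 4
    (mxs 4 [:: [:: 0; 1]; [:: 0; 0; 1]; [:: 0; 0; 0; 1]; [:: 1]])
    (mxs 4 [:: [:: 0; 0; 0; 1]; [:: 1]; [:: 0; 1]; [:: 0; 0; 1]])); by mx_entries; ring.
rewrite (@wmx_center _ _ _ _ _ rel8 unit211 z211); first last.
- move=> [[x c] [T [b d]]]; rewrite /z211 /unit211 !unitmxE !det_lblock /= !unitrM.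
  by rewrite !det_scalar1 !unitfE; case: (x == 0); rewrite ?andbF ?andbT.
- move=> [[x c] [T [b d]]] [[x' c'] [T' [b' d']]].
  rewrite /comm_mxb /z211 /rel8 /= !mulmx_block !(mulmx0, mul0mx, addr0, add0r).
  rewrite !mul_block_col !mul_col_mx !add_col_mx !(mulmx0, mul0mx, addr0, add0r).
  rewrite -!scalar_mxM [x' * x]mulrC [c' * x]mulrC [c * x']mulrC [x' * c]mulrC.
  rewrite !eqE_block_mx eqE_col_mx !eqxx /= !andbT.
  rewrite !mulmxDl !mulmxDr !mul_mx_scalar !mul_scalar_mx.
  rewrite !scale_scalar_mx [x' * x]mulrC.
  transitivity [&& (T *m d' == T' *m d) && (b *m d' == b' *m d),
      T *m T' == T' *m T & b *m T' == b' *m T]; last first.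
    by case: (T *m T' == _); case: (b *m T' == _); rewrite ?andbF ?andbT.
  move: (T *m d') (T' *m d) (b *m d') (b' *m d) (T *m T') (T' *m T) (b *m T') (b' *m T).
  move=> M1 M2 M3 M4 M5 M6 M7 M8.
  by congr [&& _ && _, _ & _]; apply: eq_sub_eq; apply/matrixP => i j; rewrite !mxE; ring.
- move=> g; rewrite -[g]submxK -[drsubmx g]submxK -[dlsubmx g]vsubmxK /N.
  rewrite !mulmx_block !(mulmx0, mul0mx, addr0, add0r).
  rewrite mul_block_col !mul_col_mx !(mulmx0, mul0mx, mulmx1, mul1mx, addr0, add0r).
  case/eq_block_mx=> _ _ /eq_col_mx[D2 D4].
  move=> /(congr1 dsubmx); rewrite col_mxKd linear0 => r0.
  exists (ulsubmx g 0 0, dsubmx (dlsubmx g) 0 0,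
    (ulsubmx (drsubmx g) - (ulsubmx g 0 0)%:M,
      (dlsubmx (drsubmx g), usubmx (dlsubmx g)))).
  by rewrite /z211 /= -!mx11_scalar [_ + (_ - _)]addrC subrK D2 D4 -r0.
- move=> [[x c] [T [b d]]]; rewrite /N /z211 /=.
  rewrite !mulmx_block !(mulmx0, mul0mx, addr0, add0r).
  rewrite mul_block_col mul_col_mx !(mulmx0, mul0mx, addr0, add0r, mulmx1, mul1mx).
  by [].
- move=> [[x c] [T [b d]]] [[x' c'] [T' [b' d']]] /eq_block_mx[/= + _].
  move=> /matrixP/(_ 0 0); rewrite !mxE !mulr1n => ->.
  case/eq_col_mx=> -> /matrixP/(_ 0 0); rewrite !mxE !mulr1n => ->.
  by case/eq_block_mx => /addrI -> _ ->.
by rewrite card_prod mulnn.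
Qed.

End RankOneSquareZero.

Section Triples.
Variable F : finFieldType.
Local Notation q := (#|F|).
Local Notation tri := (tri F).
Local Notation rel8 := (@rel8 F).

Definition n8 m (v : tri) := ncomm rel8 m (cent rel8 setT v).

Lemma rel8P (u v : tri) : reflect
  [/\ u.1 *m v.1 = v.1 *m u.1, u.2.1 *m v.1 = v.2.1 *m u.1,
      u.1 *m v.2.2 = v.1 *m u.2.2 & u.2.1 *m v.2.2 = v.2.1 *m u.2.2] (rel8 u v).
Proof.
apply: (iffP and4P) => -[]; last by move=> e1 e2 e3 e4; split; apply/eqP.
by move=> /eqP e1 /eqP e2 /eqP e3 /eqP e4.
Qed.

Lemma n8_iso (f : tri -> tri) m v : bijective f ->
  (forall u w, rel8 (f u) (f w) = rel8 u w) -> n8 m (f v) = n8 m v.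
Proof.
move=> bf rf; have f_inj := bij_inj bf; have fT : f @: setT = setT.
  apply/setP => u; rewrite inE; have [g fK gK] := bf.
  by apply/imsetP; exists (g u); rewrite // gK.
rewrite /n8 -{1}fT (cent_imset (r := rel8)) ?inE // (ncomm_imset (r := rel8)) // => u w _ _.
exact: f_inj.
Qed.

Lemma n8_conj m (g : 'M[F]_2) (v : tri) : g \in unitmx ->
  n8 m (g *m v.1 *m invmx g, (v.2.1 *m invmx g, g *m v.2.2)) = n8 m v.
Proof.
move=> ug; pose f (v : tri) : tri := (g *m v.1 *m invmx g, (v.2.1 *m invmx g, g *m v.2.2)).
have f_inj : injective f.
  move=> [T [b d]] [T' [b' d']] [/= e1 e2 e3].
  have ui : invmx g \in unitmx by rewrite unitmx_inv.
  congr (_, (_, _)); last by apply: (can_inj (mulKmx ug)).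
    by apply: (can_inj (mulKmx ug)); apply: (can_inj (mulmxK ui)).
  by apply: (can_inj (mulmxK ui)).
rewrite -[LHS]/(n8 m (f v)); apply: n8_iso; first exact: injF_bij.
move=> u w; have conjM (A C : 'M[F]_2) :
    g *m A *m invmx g *m (g *m C *m invmx g) = g *m (A *m C) *m invmx g.
  by rewrite !mulmxA mulmxKV.
apply/rel8P/rel8P => -[e1 e2 e3 e4]; move: e1 e2 e3 e4 => /=;
  rewrite !conjM => e1 e2 e3 e4; split.
- apply: (can_inj (mulKmx ug)); apply: (can_inj (mulmxK _)); last exact: e1.
  by rewrite unitmx_inv.
- move: e2; rewrite !mulmxA !mulmxKV // => e2.
  by apply: (can_inj (mulmxK _)); last exact: e2; rewrite unitmx_inv.
- move: e3; rewrite -!mulmxA !mulKmx // => e3.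
  by apply: (can_inj (mulKmx ug)).
- by move: e4; rewrite -!mulmxA !mulKmx.
- by rewrite e1.
- by rewrite !mulmxA !mulmxKV // e2.
- by rewrite -!mulmxA !mulKmx // e3.
by rewrite -!mulmxA !mulKmx.
Qed.

Lemma n8_tr m (T : 'M[F]_2) b d : n8 m (T^T, (d^T, b^T)) = n8 m (T, (b, d)).
Proof.
pose f (v : tri) : tri := (v.1^T, (v.2.2^T, v.2.1^T)).
rewrite -[LHS]/(n8 m (f (T, (b, d)))); apply: n8_iso.
  by exists f => -[A [x y]]; rewrite /f /= !trmxK.
move=> [A [x y]] [A' [x' y']].
apply/rel8P/rel8P => /= -[]; last first.
  by move=> e1 e2 e3 e4; split; rewrite -!trmx_mul ?e1 ?e2 ?e3 ?e4.
rewrite -!trmx_mul => /trmx_inj e1 /trmx_inj e2 /trmx_inj e3 /trmx_inj e4.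
by split; rewrite ?e1 ?e2 ?e3 ?e4.
Qed.

(** For T invertible, the row and column of a commuting element are determined by its matrix part A,
    so the centralizer is a graph over [cmx T]; between two points of the graph, commutation of the
    matrix parts implies the other relations. *)
Lemma n8_unit m (T : 'M[F]_2) b d : T \in unitmx ->
  n8 m (T, (b, d)) = ncomm comm_mxb m (cmx T).
Proof.
move=> uT; pose f (A : 'M[F]_2) : tri := (A, (b *m A *m invmx T, invmx T *m A *m d)).
have cinv A : T *m A = A *m T -> invmx T *m A = A *m invmx T.
  by move=> TA; apply: (can_inj (mulKmx uT)); rewrite mulKVmx // mulmxA TA mulmxK.
rewrite /n8; have -> : cent rel8 setT (T, (b, d)) = f @: cmx T.
  apply/setP => -[A [x y]]; rewrite inE in_setT /=; apply/rel8P/imsetP => /=.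
    case=> TA bA Ty by_; exists A; first by rewrite mem_cmx; apply/eqP.
    by rewrite /f bA mulmxK // -mulmxA -Ty mulKmx.
  case=> C; rewrite mem_cmx => /eqP TC [-> -> ->]; split=> //.
  - by rewrite mulmxKV.
  - by rewrite !mulmxA mulmxV // mul1mx.
  by rewrite -!mulmxA [invmx T *m (C *m _)]mulmxA cinv // !mulmxA.
apply: ncomm_imset; first by move=> A C _ _ [].
move=> A C; rewrite !mem_cmx => /eqP TA /eqP TC; apply/rel8P/eqP => [[] //|/= AC].
have e1 : A *m invmx T *m C = C *m invmx T *m A.
  by rewrite -!mulmxA !cinv // !mulmxA AC.
split=> //=.
- transitivity (b *m (A *m invmx T *m C)); first by rewrite !mulmxA.
  by rewrite e1 !mulmxA.
- by rewrite !mulmxA e1.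
transitivity (b *m (A *m invmx T *m (invmx T *m C)) *m d); first by rewrite !mulmxA.
have -> : A *m invmx T *m (invmx T *m C) = C *m invmx T *m (invmx T *m A).
  by rewrite !cinv // !mulmxA e1.
by rewrite !mulmxA.
Qed.

End Triples.

Section Coordinates.
Variables F : finFieldType.
Local Notation q := (#|F|).
Local Notation tri := (tri F).
Local Notation rel8 := (@rel8 F).

Definition rv2 (x y : F) : 'rV[F]_2 := \row_j [:: x; y]`_j.
Definition cv2 (x y : F) : 'cV[F]_2 := \col_i [:: x; y]`_i.
Definition mk (a b c d x y z t : F) : tri :=
  (mxs 2 [:: [:: a; b]; [:: c; d]], (rv2 x y, cv2 z t)).

Lemma rv2_entries (v : 'rV[F]_2) : exists x y, v = rv2 x y.
Proof.
exists (v 0 0), (v 0 1); apply/rowP => -[[|[|//]] li]; rewrite mxE /=;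
  by congr (v _ _); apply: val_inj.
Qed.

Lemma cv2_entries (v : 'cV[F]_2) : exists x y, v = cv2 x y.
Proof.
exists (v 0 0), (v 1 0); apply/colP => -[[|[|//]] li]; rewrite mxE /=;
  by congr (v _ _); apply: val_inj.
Qed.

Lemma mk_entries (v : tri) : exists a b c d x y z t, v = mk a b c d x y z t.
Proof.
case: v => T [r k]; have [a [b [c [d ->]]]] := mx2_entries T.
have [x [y ->]] := rv2_entries r; have [z [t ->]] := cv2_entries k.
by exists a, b, c, d, x, y, z, t.
Qed.

Lemma rv2_mul x y a b c d :
  rv2 x y *m mxs 2 [:: [:: a; b]; [:: c; d]] = rv2 (x * a + y * c) (x * b + y * d).
Proof. by apply/rowP => -[[|[|//]] li]; rewrite !mxE !big_ord_recl big_ord0 !mxE /= addr0. Qed.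

Lemma mul_cv2 x y a b c d :
  mxs 2 [:: [:: a; b]; [:: c; d]] *m cv2 x y = cv2 (a * x + b * y) (c * x + d * y).
Proof. by apply/colP => -[[|[|//]] li]; rewrite !mxE !big_ord_recl big_ord0 !mxE /= addr0. Qed.

Lemma rv2_cv2 x y z t : rv2 x y *m cv2 z t = (x * z + y * t)%:M.
Proof.
apply/rowP => i; rewrite ord1 !mxE !big_ord_recl big_ord0 !mxE /= addr0.
by rewrite ?eqxx mulr1n.
Qed.

Lemma rv2_inj x y x' y' : rv2 x y = rv2 x' y' -> x = x' /\ y = y'.
Proof. by move=> /rowP e; have := e 0; have := e 1; rewrite !mxE. Qed.

Lemma cv2_inj x y x' y' : cv2 x y = cv2 x' y' -> x = x' /\ y = y'.
Proof. by move=> /colP e; have := e 0; have := e 1; rewrite !mxE. Qed.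

Lemma mk_inj a b c d x y z t a' b' c' d' x' y' z' t' :
  mk a b c d x y z t = mk a' b' c' d' x' y' z' t' ->
  [/\ a = a', b = b', c = c' & d = d'] /\ [/\ x = x', y = y', z = z' & t = t'].
Proof.
case=> /mxs_eq E /rv2_inj[-> ->] /cv2_inj[-> ->]; split=> //.
have /= -> := E 0%N 0%N isT isT; have /= -> := E 0%N 1%N isT isT.
by have /= -> := E 1%N 0%N isT isT; have /= -> := E 1%N 1%N isT isT.
Qed.

Lemma rel8_mkP a b c d x y z t a' b' c' d' x' y' z' t' : reflect
  ([/\ b * c' = b' * c, a * b' + b * d' = a' * b + b' * d
     & c * a' + d * c' = c' * a + d' * c]
  /\ [/\ x * a' + y * c' = x' * a + y' * c, x * b' + y * d' = x' * b + y' * d,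
      a * z' + b * t' = a' * z + b' * t, c * z' + d * t' = c' * z + d' * t
    & x * z' + y * t' = x' * z + y' * t])
  (rel8 (mk a b c d x y z t) (mk a' b' c' d' x' y' z' t')).
Proof.
apply: (iffP (rel8P _ _)) => /=.
  rewrite !rv2_mul !mul_cv2 !rv2_cv2 => -[+ /rv2_inj[-> ->] /cv2_inj[-> ->]].
  rewrite !mxs_mul /lmx /= => /mxs_eq E /matrixP/(_ 0 0); rewrite !mxE !mulr1n => ->.
  have /= e1 := E 0%N 0%N isT isT; have /= e2 := E 0%N 1%N isT isT.
  have /= e3 := E 1%N 0%N isT isT.
  by split; split=> //; [lin e1 | lin e2 | lin e3].
move=> [[e1 e2 e3] [e4 e5 e6 e7 e8]].
rewrite !rv2_mul !mul_cv2 !rv2_cv2 e4 e5 e6 e7 e8; split=> //.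
by mx_entries; first [lin e1 | lin e2 | lin e3].
Qed.

Definition comp2 (c b : F) : 'M[F]_2 := mxs 2 [:: [:: 0; 1]; [:: c; b]].

(** The hypothesis says that the row is outside the row space of T = [comp2 0 b] or the column
    outside its column space. The centralizer is then commutative with two parameters; r is the
    multiple of the element itself. *)
Lemma n8_comp_generic m b x y z t : (x != 0) || (t - b * z != 0) ->
  n8 m (comp2 0 b, (rv2 x y, cv2 z t)) = ((q ^ 2) ^ m)%N.
Proof.
move=> xt; pose f (p : F * F) : tri := let: (r, k) := p in
  mk 0 r 0 (r * b) (r * x - b * (k * x)) (r * y + k * x)
     (r * z + k * (t - b * z)) (r * t).
have f_inj : injective f.
  move=> [r k] [r' k'] /mk_inj[[_ -> _ _] [_ /addrI e1 /addrI e2 _]].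
  by congr pair; case/orP: xt => n0; [apply: (mulIf n0) e1 | apply: (mulIf n0) e2].
rewrite /n8; have -> : cent rel8 setT (comp2 0 b, (rv2 x y, cv2 z t)) = f @: setT.
  apply/setP => u; rewrite inE in_setT /=; apply/idP/imsetP; last first.
    by case=> -[r k] _ ->; apply/rel8_mkP; do 2!split; ring.
  have [a' [b' [c' [d' [x' [y' [z' [t' ->]]]]]]]] := mk_entries u.
  case/rel8_mkP => -[e1 e2 e3] [e4 e5 e6 e7 e8].
  have c0 : c' = 0 by lin e1.
  have dE : d' = a' + b' * b by lin e2.
  have tE : t' = a' * z + b' * t by lin e6.
  have a0 : a' = 0.
    case/orP: xt => n0; apply: (mulIf n0); rewrite mul0r.
      by rewrite c0 in e4; lin e4.
    by rewrite c0 dE tE in e7; lin e7.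
  rewrite {e2 e3 e4 e6 e7}a0 c0 in dE tE e5 e8 *.
  have xE : x' = b' * x - b * (y' - b' * y) by rewrite dE in e5; lin e5.
  have kE : x * (z' - b' * z) = (y' - b' * y) * (t - b * z).
    by rewrite tE xE in e8; lin e8.
  (* By [kE] the two differences are proportional to x and t - b z; the ratio k is read off from
     whichever of these is nonzero. *)
  have [k k1 k2] : exists2 k, y' - b' * y = k * x & z' - b' * z = k * (t - b * z).
    case/orP: xt => n0; [exists ((y' - b' * y) / x) | exists ((z' - b' * z) / (t - b * z))].
    - by rewrite divfK.
    - by apply: (mulfI n0); rewrite kE; field.
    - by apply: (mulIf n0); rewrite -kE; field.
    by rewrite divfK.
  exists (b', k) => //; rewrite /f -k1 -k2 -xE dE tE.
  by congr mk; ring.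
rewrite ncomm_abelian ?card_imset ?cardsT ?card_prod ?mulnn //.
by move=> _ _ /imsetP[[r k] _ ->] /imsetP[[r' k'] _ ->]; apply/rel8_mkP; do 2!split; ring.
Qed.

Definition center_map (T1 T2 : finType) (r2 : rel T2) (f : T1 * T2 -> tri) (v : tri) :=
  [/\ injective f, forall p, rel8 v (f p), forall u, rel8 v u -> exists p, u = f p
    & forall p s, rel8 (f p) (f s) = r2 p.2 s.2].

Lemma n8_center (T1 T2 : finType) (r2 : rel T2) (f : T1 * T2 -> tri) v m :
  center_map r2 f v -> n8 m v = (#|T1| ^ m * ncomm r2 m setT)%N.
Proof.
case=> f_inj vf fv rf; rewrite /n8.
have -> : cent rel8 setT v = f @: setX setT setT.
  apply/setP => u; rewrite inE in_setT /=; apply/idP/imsetP => [/fv[p ->]|[p _ ->]] //.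
  by exists p; rewrite ?inE.
rewrite (ncomm_imset (r := prod_rel (fun _ _ => true) r2)).
- by rewrite ncomm_prod ncomm_full cardsT.
- by move=> p s _ _; apply: f_inj.
by move=> p s _ _; rewrite rf.
Qed.

(** The centralizer in the exceptional case, where the row and the column lie in the row and column
    spaces of T. The parameter r is the multiple of the element itself, hence central. *)
Definition comp_map b y z (p : F * (F * F * F)) : tri :=
  let: (r, (p, k, l)) := p in
  mk p r 0 (p + r * b) (p * y - b * k) (r * y + k) (r * z + l) (p * z + r * (b * z)).

Lemma comp_mapC b y z :
  [/\ injective (comp_map b y z),
    forall p, rel8 (mk 0 1 0 b 0 y z (b * z)) (comp_map b y z p)
  & forall u, rel8 (mk 0 1 0 b 0 y z (b * z)) u -> exists p, u = comp_map b y z p].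
Proof.
split.
- move=> [r [[p k] l]] [r' [[p' k'] l']] /mk_inj[[-> -> _ _] [_ e1 e2 _]].
  by congr (_, (_, _, _)); [apply: addrI e1 | apply: addrI e2].
- by move=> [r [[p k] l]]; apply/rel8_mkP; do 2!split; ring.
move=> u; have [a' [b' [c' [d' [x' [y' [z' [t' ->]]]]]]]] := mk_entries u.
case/rel8_mkP => -[e1 e2 e3] [e4 e5 e6 e7 e8].
have c0 : c' = 0 by lin e1.
have dE : d' = a' + b' * b by lin e2.
have tE : t' = a' * z + b' * (b * z) by lin e6.
exists (b', (a', y' - b' * y, z' - b' * z)).
have xE : x' = a' * y - b * (y' - b' * y) by rewrite dE in e5; lin e5.
by rewrite /comp_map -xE c0 dE tE; congr mk; ring.
Qed.

(** The scalar equation between products of rows and columns contains the minor k l' - k' l with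
    factor b. It therefore adds a third minor when b is nonzero, while for b = 0 it follows from the
    other two ([n8_comp12]). *)
Lemma n8_comp30 m b y z : b != 0 ->
  n8 m (comp2 0 b, (rv2 0 y, cv2 z (b * z))) = (q ^ m * ncomm (@rel30 F) m setT)%N.
Proof.
move=> b0; have [i1 i2 i3] := comp_mapC b y z.
apply: (n8_center (f := comp_map b y z)); split=> //.
move=> [r [[p k] l]] [r' [[p' k'] l']]; apply/rel8_mkP/and3P => /=.
  case=> _ [_ e5 e6 _ e8].
  have h1 : p * k' = p' * k by lin e5.
  have h2 : p * l' = p' * l by lin e6.
  split; apply/eqP => //; apply: (mulfI b0).
  by apply: (@lin3 _ _ _ _ _ _ _ _ _ (-1) (- z) y e8 h1 h2); ring.
move=> [/eqP /= e1 /eqP /= e2 /eqP /= e3]; do 2!split; 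
  first [ring | lin e1 | lin e2 | by apply: (@lin2 _ _ _ _ _ _ _ b 0 e1 e1); ring
       | by apply: (@lin3 _ _ _ _ _ _ _ _ _ (- z) y (- b) e1 e2 e3); ring].
Qed.

Lemma n8_comp12 m y z :
  n8 m (comp2 0 0, (rv2 0 y, cv2 z 0)) = (q ^ m * ncomm (@rel12 F) m setT)%N.
Proof.
have := comp_mapC 0 y z; rewrite mul0r => -[i1 i2 i3].
apply: (n8_center (f := comp_map 0 y z)); split=> //.
move=> [r [[p k] l]] [r' [[p' k'] l']]; apply/rel8_mkP/andP => /=.
  case=> _ [_ e5 e6 _ e8].
  by split; apply/eqP; [lin e5 | lin e6].
move=> [/eqP /= e1 /eqP /= e2]; do 2!split; first [ring | lin e1 | lin e2 | idtac].
by apply: (@lin2 _ _ _ _ _ _ _ (- z) y e1 e2); ring.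
Qed.

(** For T = 0 and row (1, 0) there are three cases: zero column here, a column with nonzero product
    with the row in [n8_zero30], and a nonzero column with zero product in [n8_zero12]. *)
Lemma n8_zero22 m : n8 m (mk 0 0 0 0 1 0 0 0) = (q ^ m * ncomm (@rel22 F) m setT)%N.
Proof.
pose f (p : F * (F * F * (F * F))) : tri :=
  let: (x, (s, y, (t, z))) := p in mk 0 0 t s x y 0 z.
apply: (n8_center (f := f)); split.
- by move=> [x [[s y] [t z]]] [x' [[s' y'] [t' z']]] /mk_inj[[_ _ -> ->] [-> -> _ ->]].
- by move=> [x [[s y] [t z]]]; apply/rel8_mkP; do 2!split; ring.
- move=> u; have [a [b [c [d [x [y [z [t ->]]]]]]]] := mk_entries u.
  case/rel8_mkP => _ [e4 e5 _ _ e8]; exists (x, (d, y, (c, t))); rewrite /f.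
  by congr mk; [lin e4 | lin e5 | lin e8].
move=> [x [[s y] [t z]]] [x' [[s' y'] [t' z']]]; apply/rel8_mkP/and5P => /=.
  case=> -[_ _ e3] [e4 e5 _ e7 e8].
  by split; apply/eqP; [lin e5 | lin e3 | lin e7 | lin e4 | lin e8].
move=> [/eqP /= e1 /eqP /= e2 /eqP /= e3 /eqP /= e4 /eqP /= e5]; do 2!split;
  first [ring | lin e1 | lin e2 | lin e3 | lin e4 | lin e5].
Qed.

Lemma n8_zero30 m g : g != 0 ->
  n8 m (mk 0 0 0 0 1 0 g 0) = (q ^ m * ncomm (@rel30 F) m setT)%N.
Proof.
move=> g0; pose f (p : F * (F * F * F)) : tri :=
  let: (x, (s, y, z)) := p in mk 0 0 0 s x y (x * g) z.
apply: (n8_center (f := f)); split.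
- by move=> [x [[s y] z]] [x' [[s' y'] z']] /mk_inj[[_ _ _ ->] [-> -> _ ->]].
- by move=> [x [[s y] z]]; apply/rel8_mkP; do 2!split; ring.
- move=> u; have [a [b [c [d [x [y [z [t ->]]]]]]]] := mk_entries u.
  case/rel8_mkP => _ [e4 e5 _ e7 e8]; exists (x, (d, y, t)); rewrite /f.
  congr mk; [lin e4 | lin e5 | apply: (mulIf g0); lin e7 | lin e8].
move=> [x [[s y] z]] [x' [[s' y'] z']]; apply/rel8_mkP/and3P => /=.
  case=> _ [_ e5 _ e7 e8].
  by split; apply/eqP; [lin e5 | lin e7 | lin e8].
move=> [/eqP /= e1 /eqP /= e2 /eqP /= e3]; do 2!split; first [ring | lin e1 | lin e2 | lin e3].
Qed.

Lemma n8_zero12 m g : g != 0 ->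
  n8 m (mk 0 0 0 0 1 0 0 g) = (q ^ m * ncomm (@rel12 F) m setT)%N.
Proof.
move=> g0; pose f (p : F * (F * F * F)) : tri :=
  let: (x, (y, t, z)) := p in mk 0 0 t 0 x y (y * g) (z + x * g).
apply: (n8_center (f := f)); split.
- move=> [x [[y t] z]] [x' [[y' t'] z']] /mk_inj[[_ _ -> _] [-> -> _ e]].
  by congr (_, (_, _)); apply: addIr e.
- by move=> [x [[y t] z]]; apply/rel8_mkP; do 2!split; ring.
- move=> u; have [a [b [c [d [x [y [z [t ->]]]]]]]] := mk_entries u.
  case/rel8_mkP => _ [e4 e5 _ e7 e8]; exists (x, (y, c, t - x * g)); rewrite /f.
  congr mk; [lin e4 | lin e5 | apply: (mulIf g0); lin e7 | lin e8 | ring].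
move=> [x [[y t] z]] [x' [[y' t'] z']]; apply/rel8_mkP/andP => /=.
  case=> _ [e4 _ _ _ e8].
  by split; apply/eqP; [lin e4 | lin e8].
move=> [/eqP /= e1 /eqP /= e2]; do 2!split;
  first [ring | lin e1 | lin e2 | by apply: (@lin2 _ _ _ _ _ _ _ (- g) 0 e1 e1); ring].
Qed.

End Coordinates.

Section SumTriples.
Variables F : finFieldType.
Local Notation q := (#|F|).
Local Notation tri := (tri F).
Local Notation rel8 := (@rel8 F).

Definition S8 m (T : 'M[F]_2) : nat := \sum_(p : 'rV[F]_2 * 'cV[F]_2) n8 m (T, p).

Lemma S8_sim m T T' : sim T T' -> S8 m T = S8 m T'.
Proof.
case/simP=> g ug gT; have ui : invmx g \in unitmx by rewrite unitmx_inv.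
have T'E : T' = g *m T *m invmx g by rewrite gT mulmxK.
rewrite /S8 [RHS](reindex (fun p : 'rV[F]_2 * 'cV[F]_2 => (p.1 *m invmx g, g *m p.2))) /=.
  by apply: eq_bigr => p _; rewrite T'E -(n8_conj _ _ ug); case: p.
exists (fun p => (p.1 *m g, invmx g *m p.2)) => -[x y] _ /=.
  by rewrite mulmxKV // mulKmx.
by rewrite mulmxK // mulKVmx.
Qed.

Lemma card_pairs : #|{: 'rV[F]_2 * 'cV[F]_2}| = (q ^ 4)%N.
Proof. by rewrite card_prod !card_mx -expnD. Qed.

Lemma S8_unit m (T : 'M[F]_2) : T \in unitmx -> S8 m T = (q ^ 4 * ncomm comm_mxb m (cmx T))%N.
Proof.
move=> uT; rewrite /S8 (eq_bigr (fun=> ncomm comm_mxb m (cmx T))).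
  by rewrite sum_nat_const card_pairs.
by move=> [x y] _; apply: n8_unit.
Qed.

Lemma S8_nonscalar m (T : 'M[F]_2) : T \in unitmx -> ~~ is_scalar_mx T ->
  S8 m T = (q ^ 4 * (q ^ 2) ^ m)%N.
Proof.
move=> uT nsT; rewrite S8_unit //; congr (_ * _)%N.
have [aC cardC _] := cmx_cyclic (cyclic2 nsT).
by rewrite ncomm_abelian ?cardC // => a b Ca Cb; rewrite /comm_mxb aC.
Qed.

Lemma S8_scalar m (x : F) : x != 0 ->
  S8 m x%:M = (q ^ 4 * ncomm comm_mxb m [set: 'M[F]_2])%N.
Proof. by move=> x0; rewrite S8_unit ?scalar_unit // cmx_scalar. Qed.

(** The q^2 exceptional pairs have their row in the row space and their column in the column space
    of [comp2 0 b], both lines. *)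
Lemma S8_comp m b : S8 m (comp2 0 b) = ((q ^ 4 - q ^ 2) * (q ^ 2) ^ m +
  q ^ 2 * (q ^ m * (if b == 0%R then ncomm (@rel12 F) m setT else ncomm (@rel30 F) m setT)))%N.
Proof.
pose A := [set (rv2 0 s.1, cv2 s.2 (b * s.2)) | s : F * F].
have cardA : #|A| = (q ^ 2)%N.
  rewrite card_imset ?card_prod ?mulnn // => -[x y] [z t] [] /rv2_inj[_ /= ->].
  by case/cv2_inj=> ->.
rewrite /S8 (bigID (mem A)) /= addnC; congr (_ + _)%N.
  rewrite (eq_bigr (fun=> (q ^ 2) ^ m)%N) => [|[r k]]; last first.
    have [x [y ->]] := rv2_entries r; have [z [t ->]] := cv2_entries k => nA.
    apply: n8_comp_generic; apply: contraR nA.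
    rewrite negb_or !negbK subr_eq0 => /andP[/eqP-> /eqP->].
    by apply/imsetP; exists (y, z).
  rewrite sum_nat_cond_const; congr (_ * _)%N.
  rewrite -card_pairs -cardA -(cardsC A) addKn.
  by apply: eq_card => p; rewrite !inE.
rewrite (eq_bigr (fun=> (q ^ m * (if b == 0%R then ncomm (@rel12 F) m setT
   else ncomm (@rel30 F) m setT)))%N) => [|p].
  by rewrite sum_nat_const cardA.
case/imsetP => -[y z] _ ->; case: (eqVneq b 0) => [->|b0] /=.
  by rewrite mul0r n8_comp12.
by rewrite n8_comp30.
Qed.

Lemma row_normal (r : 'rV[F]_2) : r != 0 ->
  exists2 g : 'M[F]_2, g \in unitmx & r = rv2 1 0 *m g.
Proof.
have [x [y ->]] := rv2_entries r => xy0.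
suff [g [h gh rg]] : exists g, exists2 h : 'M[F]_2, g *m h = 1%:M & rv2 x y = rv2 1 0 *m g.
  by exists g => //; have [] := mulmx1_unit gh.
case: (eqVneq x 0) => [x0|x0].
  have y0 : y != 0.
    apply: contraNneq xy0 => y0; rewrite x0 y0; apply/eqP/rowP => i; rewrite !mxE.
    by case: i => [[|[|//]] li].
  exists (mxs 2 [:: [:: x; y]; [:: 1; 0]]), (mxs 2 [:: [:: 0; 1]; [:: y^-1; - x / y]]).
    by mx_entries; field.
  by rewrite rv2_mul; congr rv2; ring.
exists (mxs 2 [:: [:: x; y]; [:: 0; 1]]), (mxs 2 [:: [:: x^-1; - y / x]; [:: 0; 1]]).
  by mx_entries; field.
by rewrite rv2_mul; congr rv2; ring.
Qed.

Lemma mxs2_0 : (0 : 'M[F]_2) = mxs 2 [:: [:: 0; 0]; [:: 0; 0]].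
Proof. by rewrite mxs_0; mx_entries. Qed.

Lemma cv2_0 : cv2 0 0 = 0 :> 'cV[F]_2.
Proof. by apply/colP => -[[|[|//]] li]; rewrite !mxE. Qed.

Lemma sum_row m (r : 'rV[F]_2) : r != 0 ->
  (\sum_(k : 'cV[F]_2) n8 m (0%R, (r, k)) =
   q ^ m * ncomm (@rel22 F) m setT + q.-1 * (q ^ m * ncomm (@rel12 F) m setT) +
   q.-1 * q * (q ^ m * ncomm (@rel30 F) m setT))%N.
Proof.
case/row_normal => g ug ->.
rewrite (reindex (fun k => invmx g *m k)) /=; last first.
  by exists (fun k => g *m k) => k _; rewrite /= ?mulKVmx ?mulKmx.
rewrite (eq_bigr (fun k => n8 m (0, (rv2 1 0, k)))) => [|k _]; last first.
  by rewrite -(n8_conj _ _ ug) /= mulmx0 mul0mx mulmxK // mulKVmx.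
rewrite (reindex (fun p : F * F => cv2 p.1 p.2)) /=; last first.
  exists (fun k : 'cV[F]_2 => (k 0 0, k 1 0)) => [[x y] _|k _] /=; first by rewrite !mxE.
  by apply/colP => -[[|[|//]] li]; rewrite !mxE; congr (k _ _); apply: val_inj.
rewrite -(pair_big xpredT xpredT (fun z t => n8 m (0, (rv2 1 0, cv2 z t)))) /=.
rewrite (bigD1 0) //=; congr (_ + _)%N.
  rewrite (bigD1 0) //= mxs2_0 n8_zero22; congr (_ + _)%N.
  rewrite (eq_bigr (fun=> q ^ m * ncomm (@rel12 F) m setT)%N) => [|t t0].
    by rewrite sum_nat_const -(cardC1 (0 : F)).
  by rewrite n8_zero12.
rewrite (eq_bigr (fun=> q * (q ^ m * ncomm (@rel30 F) m setT))%N) => [|z z0].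
  by rewrite sum_nat_const mulnA -(cardC1 (0 : F)).
rewrite (eq_bigr (fun=> q ^ m * ncomm (@rel30 F) m setT)%N) => [|t _].
  by rewrite sum_nat_const.
(* This unipotent matrix fixes the row (1, 0) and clears the second entry of the column. *)
have gh : mxs 2 [:: [:: 1; 0]; [:: - t / z; 1]] *m mxs 2 [:: [:: 1; 0]; [:: t / z; 1]] =
  1%:M :> 'M[F]_2 by mx_entries; ring.
have [uh _] := mulmx1_unit gh.
set g' := mxs 2 _ in gh uh.
have rE : rv2 1 0 *m invmx g' = rv2 1 0.
  by apply: (can_inj (mulmxK uh)); rewrite mulmxKV // rv2_mul; congr rv2; ring.
have kE : g' *m cv2 z t = cv2 z 0 by rewrite mul_cv2; congr cv2; field.
by rewrite -(n8_conj _ _ uh) /= mulmx0 mul0mx rE kE mxs2_0 n8_zero30.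
Qed.

Lemma S8_zero m : S8 m 0 = (ncomm rel8 m setT + (q ^ 2 - 1) * (q ^ m * ncomm (@rel22 F) m setT) +
  (q ^ 2 - 1) * (q ^ m * ncomm (@rel22 F) m setT + q.-1 * (q ^ m * ncomm (@rel12 F) m setT) +
   q.-1 * q * (q ^ m * ncomm (@rel30 F) m setT)))%N.
Proof.
rewrite /S8 -(pair_big xpredT xpredT (fun r k => n8 m (0, (r, k)))) /=.
have cardr : #|predC1 (0 : 'rV[F]_2)| = (q ^ 2 - 1)%N.
  by rewrite cardC1 card_mx subn1.
have cardk : #|predC1 (0 : 'cV[F]_2)| = (q ^ 2 - 1)%N.
  by rewrite cardC1 card_mx subn1.
rewrite (bigD1 0) //=; congr (_ + _)%N; last first.
  rewrite (eq_bigr _ (fun r r0 => sum_row m r0)) sum_nat_const.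
  by rewrite -cardr.
rewrite (bigD1 0) //=; congr (_ + _)%N.
  congr ncomm; apply/setP => -[T [r k]]; rewrite !inE /rel8 /=.
  by rewrite !(mul0mx, mulmx0) !eqxx.
rewrite (eq_bigr (fun=> q ^ m * ncomm (@rel22 F) m setT)%N) => [|k k0].
  by rewrite sum_nat_const -cardk.
(* Transposition exchanges rows and columns, which reduces a zero row with a nonzero column to
   [n8_zero22]. *)
have /row_normal[g ug kE] : k^T != 0 by rewrite trmx_eq0.
rewrite -n8_tr trmx0 kE -(n8_conj _ _ ug) /= mulmx0 mul0mx mulmxK // trmx0 mulmx0.
by rewrite -cv2_0 mxs2_0 n8_zero22.
Qed.

End SumTriples.

Section TotalTriples.
Variables F : finFieldType.
Local Notation q := (#|F|).
Local Notation rel8 := (@rel8 F).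

Lemma comp2_nonscalar (c b : F) : ~~ is_scalar_mx (comp2 c b).
Proof.
apply/is_scalar_mxP => -[x /matrixP/(_ 0 1)/eqP].
by rewrite !mxE /= mulr0n oner_eq0.
Qed.

Lemma scalar_comp2_unit (p r b : F) :
  (p%:M + r *: comp2 0 b \in unitmx) = (p != 0) && (p + r * b != 0).
Proof.
rewrite unitmxE -det_tr det_trig.
  by rewrite !big_ord_recl big_ord0 !mxE /= !mulr0 !mulr1n addr0 !unitrM unitr1 !unitfE andbT.
apply/is_trig_mxP => -[[|[|//]] li] -[[|[|//]] lj] //= _.
by rewrite !mxE /= mulr0 mulr0n addr0.
Qed.

Lemma comp2_unit (c b : F) : (comp2 c b \in unitmx) = (c != 0).
Proof.
apply/idP/idP => [|c0].
  apply: contraL => /eqP->; have := scalar_comp2_unit 0 1 b.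
  by rewrite eqxx /= raddf0 add0r scale1r => ->.
have : comp2 c b *m mxs 2 [:: [:: - b / c; c^-1]; [:: 1; 0]] = 1%:M.
  by rewrite /comp2; mx_entries; field.
by case/mulmx1_unit.
Qed.

Lemma sim_unit n (a b : 'M[F]_n) : sim a b -> (a \in unitmx) = (b \in unitmx).
Proof.
case/simP=> g ug ga; have := congr1 (fun A => A \in unitmx) ga.
by rewrite !unitmx_mul ug andbT.
Qed.

Lemma singular_nonscalarE (T : 'M[F]_2) :
  [exists b, sim T (comp2 0 b)] = ~~ is_scalar_mx T && (T \notin unitmx).
Proof.
apply/existsP/andP => [[b s]|[nsT nuT]].
  by rewrite (sim_scalar s) (sim_unit s) comp2_unit eqxx comp2_nonscalar.
have [c [b s]] := sim_comp2 nsT; exists b.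
by move: nuT; rewrite (sim_unit s) comp2_unit negbK => /eqP c0; rewrite -c0.
Qed.

Lemma comp2_0_inj (b b' : F) : sim (comp2 0 b) (comp2 0 b') -> b = b'.
Proof.
move=> /sim_trace; rewrite /mxtrace !big_ord_recl !big_ord0 !mxE /=.
by rewrite !addr0 !add0r.
Qed.

(** The number of units in the centralizer of [comp2 0 b], which is F[t]/t^2 for b = 0 and F x F
    otherwise. *)
Definition scount (b : F) : nat := if b == 0 then (q.-1 * q)%N else (q.-1 ^ 2)%N.

Lemma wmx0_comp2 b : wmx 0 (comp2 0 b) = scount b.
Proof.
rewrite wmx0E cmx2_nonscalar ?comp2_nonscalar //.
pose h (p : F * F) := p.1%:M + p.2 *: comp2 0 b.
have -> : [set g in [set h p | p : F * F] | g \in unitmx] =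
    h @: [set p : F * F | (p.1 != 0) && (p.1 + p.2 * b != 0)].
  apply/setP => g; rewrite inE; apply/andP/imsetP => [[/imsetP[p _ ->] up]|[p]].
    by exists p; rewrite // inE -scalar_comp2_unit.
  by rewrite inE -scalar_comp2_unit => up ->; split=> //; apply: imset_f.
rewrite (card_imset _ (scalar_line_inj (comp2_nonscalar 0 b))) /scount.
case: eqVneq => [->|b0].
  rewrite -(cardsC1 (0 : F)) -cardsT -cardsX; apply: eq_card => -[p r].
  by rewrite !inE /= mulr0 addr0 andbb andbT.
rewrite -mulnn -(cardsC1 (0 : F)) -cardsX.
rewrite -[RHS](card_imset (f := fun p : F * F => (p.1, (p.2 - p.1) / b))).
  apply: eq_card => -[p r]; rewrite inE; apply/andP/imsetP => [[/= p0 s0]|[[x y]]].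
    by exists (p, p + r * b); rewrite ?inE ?p0 //= addrC addKr mulfK.
  by rewrite !inE => /andP[/= x0 y0] [-> ->]; rewrite divfK // addrC subrK.
by move=> [x y] [z t] [-> /(mulIf (invr_neq0 b0)) /addIr ->].
Qed.

(** K is the common value of [S8] on invertible nonscalar matrices. Corrections arise only at zero,
    at nonzero scalars and on the singular nonscalar classes, the latter weighted by their sizes. *)
Lemma sum_S8 (phi : 'M[F]_2 -> rat) m :
    (forall T T', sim T T' -> phi T = phi T') ->
  let K := (q ^ 4 * (q ^ 2) ^ m)%N%:R in
  \sum_(T : 'M[F]_2) phi T * (S8 m T)%:R = K * \sum_(T : 'M[F]_2) phi T + phi 0 * ((S8 m (0 : 'M[F]_2))%:R - K)
    + \sum_(x : F | x != 0) phi x%:M * ((S8 m x%:M)%:R - K)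
    + \sum_(b : F) (ugl F 2)%:R / (scount b)%:R *
        (phi (comp2 0 b) * ((S8 m (comp2 0 b))%:R - K)).
Proof.
move=> phi_sim K; pose f T := phi T * ((S8 m T)%:R - K).
transitivity (K * \sum_(T : 'M[F]_2) phi T + \sum_(T : 'M[F]_2) f T).
  rewrite mulr_sumr -big_split; apply: eq_bigr => T _; rewrite /f /=; ring.
rewrite -!addrA; congr (_ + _).
have f_sim T T' : sim T T' -> f T = f T'.
  by move=> s; rewrite /f (phi_sim _ _ s) (S8_sim _ s).
have -> : \sum_(b : F) (ugl F 2)%:R / (scount b)%:R *
        (phi (comp2 0 b) * ((S8 m (comp2 0 b))%:R - K)) =
    \sum_(b : F) (ugl F 2)%:R / (wmx 0 (comp2 0 b))%:R * f (comp2 0 b).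
  by apply: eq_bigr => b _; rewrite wmx0_comp2.
rewrite -(sum_sim f_sim comp2_0_inj).
rewrite (bigID (fun T => is_scalar_mx T)) /= addrA; congr (_ + _); last first.
  rewrite (bigID (fun T : 'M[F]_2 => T \in unitmx)) /= big1 ?add0r.
    by apply: eq_bigl => T; rewrite singular_nonscalarE.
  by move=> T /andP[nsT uT]; rewrite /f S8_nonscalar // subrr mulr0.
transitivity (\sum_(x : F) f x%:M); last by rewrite (bigD1 0) //= raddf0.
rewrite [LHS](reindex_onto (fun x : F => x%:M) (fun T => T 0 0)) /=.
  apply: eq_bigl => x; rewrite !mxE eqxx mulr1n eqxx andbT.
  by apply/is_scalar_mxP; exists x.
by move=> T /is_scalar_mxP[x ->]; rewrite !mxE eqxx mulr1n.
Qed.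

(** The number of scalars x for which an element of [z211] with middle block x + T is invertible. *)
Definition ucount (T : 'M[F]_2) : nat := #|[set x : F | (x != 0) && (x%:M + T \in unitmx)]|.

Lemma ucount_sim T T' : sim T T' -> ucount T = ucount T'.
Proof.
move=> s; apply: eq_card => x; rewrite !inE; congr (_ && _).
by apply: sim_unit; apply: sim_shift.
Qed.

Lemma sum_ucount : (\sum_(T : 'M[F]_2) ucount T = q.-1 * ugl F 2)%N.
Proof.
rewrite (eq_bigr (fun T : 'M[F]_2 => \sum_(x : F | (x != 0%R) && (x%:M + T \in unitmx)%R) 1)%N)
  => [|T _]; last first.
  by rewrite sum1dep_card.
rewrite (exchange_big_dep (fun x : F => x != 0)) /= => [|T x _ /andP[] //].
rewrite (eq_bigr (fun=> ugl F 2)) => [|x x0].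
  by rewrite sum_nat_const -(cardC1 (0 : F)).
rewrite sum1dep_card /ugl -(card_imset _ (@addrI _ x%:M)); apply: eq_card => T.
rewrite !inE; apply/imsetP/idP => [[A]|uT]; first by rewrite inE x0 => ? ->.
by exists (- x%:M + T); rewrite ?inE ?addKr ?addrA ?addrN ?add0r ?x0.
Qed.

Lemma card_neq2 (x : F) : x != 0 -> #|[set y : F | (y != 0) && (y + x != 0)]| = q.-2.
Proof.
move=> x0; have := cardsC [set 0; - x]; rewrite cards2 eq_sym oppr_eq0 x0 /= => <-.
rewrite add2n /=; apply: eq_card => y; rewrite !inE negb_or; congr (_ && _).
by rewrite addr_eq0.
Qed.

Lemma ucount0 : ucount (0 : 'M[F]_2) = q.-1.
Proof.
rewrite /ucount -(cardsC1 (0 : F)); apply: eq_card => x; rewrite !inE addr0.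
by case: eqVneq => //= x0; rewrite scalar_unit.
Qed.

Lemma ucount_scalar x : x != 0 -> ucount x%:M = q.-2.
Proof.
move=> x0; rewrite /ucount -(card_neq2 x0); apply: eq_card => y; rewrite !inE.
congr (_ && _); rewrite -raddfD /=; case: eqVneq => [->|]; last exact: scalar_unit.
by rewrite raddf0 unitmxE det0 unitr0.
Qed.

Lemma ucount_comp b : ucount (comp2 0 b) = if b == 0 then q.-1 else q.-2.
Proof.
have E : ucount (comp2 0 b) = #|[set y : F | (y != 0) && (y + b != 0)]|.
  apply: eq_card => y; rewrite !inE -[comp2 0 b]scale1r scalar_comp2_unit mul1r.
  by rewrite andbA andbb.
rewrite E; case: eqVneq => [->|/card_neq2 //].
rewrite -(cardsC1 (0 : F)); apply: eq_card => x; rewrite !inE addr0; exact: andbb.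
Qed.

Lemma wmx_z211E m : wmx m (rank1 4 0 : 'M[F]_4) =
  ((q ^ 2) ^ m * (q * \sum_(T : 'M[F]_2) ucount T * S8 m T))%N.
Proof.
rewrite wmx_z211; congr (_ * _)%N.
rewrite -(pair_big xpredT xpredT (fun T p => #|[set z | unit211 (z, (T, p))]| *
  ncomm rel8 m (cent rel8 setT (T, p)))%N) /= big_distrr /=; apply: eq_bigr => T _.
rewrite mulnA /S8 big_distrr; apply: eq_bigr => p _; congr (_ * _)%N.
rewrite /ucount mulnC -[X in (_ * X)%N]cardsT -cardsX; apply: eq_card => -[x c].
by rewrite !inE /unit211 /= andbT.
Qed.

Lemma ncomm8S m : ncomm rel8 m.+1 setT = (\sum_(T : 'M[F]_2) S8 m T)%N.
Proof.
rewrite /S8 pair_big /=; apply: eq_big => [u|[T p] _] //; by rewrite inE.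
Qed.

End TotalTriples.

Lemma ord2_ind (P : 'I_2 -> Prop) : P 0 -> P 1 -> forall i, P i.
Proof.
move=> P0 P1 [[|[|//]] li].
  by suff -> : Ordinal li = 0 by []; apply: val_inj.
by suff -> : Ordinal li = 1 by []; apply: val_inj.
Qed.

(** * Irreducible quadratics and the field with q^2 elements *)

Section IrreducibleQuadratic.
Variables (F : finFieldType) (c b : F).
Local Notation q := (#|F|).
Hypothesis noroot : forall x, x * x != b * x + c.

Let h : {poly F} := 'X^2 - b *: 'X - c%:P.
Local Notation B := (comp2 c b).

Lemma quad_size : size h = 3.
Proof.
rewrite /h -addrA size_polyDl ?size_polyXn // -opprD size_polyN.
apply: leq_ltn_trans (size_polyD _ _) _; rewrite gtn_max size_polyC.
by rewrite (leq_ltn_trans (size_scale_leq _ _)) ?size_polyX //; case: (c != 0).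
Qed.

Lemma quad_monic : h \is monic.
Proof.
rewrite monicE lead_coefE quad_size /h !coefB coefXn coefZ coefX coefC /=.
by rewrite mulr0 !subr0.
Qed.

Lemma quad_irr : irreducible_poly h.
Proof.
apply: cubic_irreducible; rewrite ?quad_size // => x.
rewrite /root /h !hornerE; apply: contra (noroot x) => /eqP E.
by rewrite -subr_eq0 opprD addrA -[_ * _]expr2 E.
Qed.

Let hI : monic_irreducible_poly h := (quad_irr, quad_monic).
Let L := {poly %/ h with hI}.

Lemma quad_horner : horner_mx B h = 0.
Proof.
rewrite /h !rmorphB /= rmorphXn /= linearZ /= horner_mx_X horner_mx_C expr2 -mulmxE.
rewrite /comp2; apply/eqP; rewrite -addrA -opprD subr_eq0; apply/eqP.
by mx_entries; ring.
Qed.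

Definition quad_embed (x : L) : 'M[F]_2 := horner_mx B (val (x : {poly %/ h})).

Lemma quad_embedD x y : quad_embed (x + y) = quad_embed x + quad_embed y.
Proof. by rewrite /quad_embed -rmorphD. Qed.

Lemma quad_embedM x y : quad_embed (x * y) = quad_embed x *m quad_embed y.
Proof.
rewrite /quad_embed mulmxE -rmorphM /=.
rewrite [in RHS](Pdiv.RingMonic.rdivp_eq quad_monic (val (x : {poly %/ h}) * val (y : {poly %/ h}))).
rewrite rmorphD rmorphM /= quad_horner mulr0 add0r.
congr horner_mx; congr (Pdiv.Ring.rmodp _ _).
exact: (mk_monicE hI).
Qed.

Lemma quad_embed1 : quad_embed 1 = 1%:M.
Proof.
have -> : quad_embed 1 = horner_mx B 1%:P by congr horner_mx; apply: qpolyCE.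
by rewrite rmorph1.
Qed.

Lemma quad_embed0 : quad_embed 0 = 0.
Proof. by apply: (addrI (quad_embed 0)); rewrite -quad_embedD !addr0. Qed.

Lemma quad_embed_inj : injective quad_embed.
Proof.
move=> x y xy; apply/eqP; rewrite -subr_eq0; apply/negPn/negP => d0.
have : quad_embed ((x - y) / (x - y)) = 0.
  rewrite quad_embedM; have -> : quad_embed (x - y) = 0.
    by apply: (addIr (quad_embed y)); rewrite -quad_embedD subrK add0r.
  by rewrite mul0mx.
rewrite divff // quad_embed1 => /matrixP/(_ 0 0)/eqP.
by rewrite !mxE eqxx mulr1n oner_eq0.
Qed.

Lemma quad_card : #|{: L}| = (q ^ 2)%N.
Proof. by rewrite card_qfpoly quad_size. Qed.

Lemma quad_embed_img : quad_embed @: setT = cmx B.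
Proof.
apply/eqP; rewrite eqEcard (card_imset _ quad_embed_inj) cardsT quad_card.
have [_ -> _] := cmx_cyclic (cyclic2 (comp2_nonscalar c b)); rewrite leqnn andbT.
apply/subsetP => _ /imsetP[x _ ->]; rewrite mem_cmx /quad_embed.
have {1 4}-> : B = horner_mx B 'X by rewrite horner_mx_X.
by rewrite !mulmxE -!rmorphM mulrC.
Qed.

(** A matrix commutes with two copies of B exactly when each of its four blocks lies in [cmx B], a
    copy of the field L. The centralizer is therefore M_2(L). *)
Lemma wmx_irr m : wmx m (double_comp c b : 'M[F]_4) = wmx m (0 : 'M[L]_2).
Proof.
have -> : wmx m (double_comp c b : 'M[F]_4) = wmx m (block_mx B 0 0 B : 'M[F]_(2 + 2)).
  apply: (@wmx_sim F 4); rewrite /comp2 mxs_block_diag.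
  apply: (@sim_inv _ 4 1%:M 1%:M); first by rewrite mulmx1.
  by mx_entries; ring.
pose f (X : 'M[L]_2) : 'M[F]_(2 + 2) :=
  block_mx (quad_embed (X 0 0)) (quad_embed (X 0 1)) (quad_embed (X 1 0)) (quad_embed (X 1 1)).
have fM X Y : f X *m f Y = f (X *m Y).
  have mulE i k : (X *m Y) i k = X i 0 * Y 0 k + X i 1 * Y 1 k.
    rewrite mxE !big_ord_recl big_ord0 addr0 (_ : lift ord0 ord0 = 1 :> 'I_2) //.
    exact: val_inj.
  by rewrite /f mulmx_block !mulE !quad_embedD !quad_embedM.
have f_inj : injective f.
  move=> X Y /eq_block_mx[/quad_embed_inj e1 /quad_embed_inj e2 /quad_embed_inj e3].
  by move=> /quad_embed_inj e4; apply/matrixP; apply: ord2_ind; apply: ord2_ind.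
have f1 : f 1%:M = 1%:M.
  by rewrite /f !mxE /= !mulr0n !mulr1n quad_embed0 quad_embed1 -scalar_mx_block.
have img : cmx (block_mx B 0 0 B : 'M[F]_(2 + 2)) = f @: setT.
  have Bimg (A : 'M[F]_2) : B *m A = A *m B -> exists x, A = quad_embed x.
    move=> BA; have : A \in cmx B by rewrite mem_cmx; apply/eqP.
    by rewrite -quad_embed_img => /imsetP[x _ ->]; exists x.
  have imgB x : B *m quad_embed x = quad_embed x *m B.
    by apply/eqP; rewrite -mem_cmx -quad_embed_img imset_f.
  apply/setP => g; rewrite mem_cmx -[g]submxK !mulmx_block.
  rewrite !(mulmx0, mul0mx, addr0, add0r); apply/eqP/imsetP.
    case/eq_block_mx => /Bimg[x1 ->] /Bimg[x2 ->] /Bimg[x3 ->] /Bimg[x4 ->].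
    exists (\matrix_(i, j) nth 0 (nth [::] [:: [:: x1; x2]; [:: x3; x4]] i) j) => //.
    by rewrite /f !mxE.
  by case=> X _ /eq_block_mx[-> -> -> ->]; rewrite !imgB.
rewrite /wmx img cmx0; apply: wcomm_imset.
- by move=> X Y _ _; apply: f_inj.
- by move=> X Y _ _; rewrite /comm_mxb !fM (inj_eq f_inj).
move=> X _; apply/idP/idP => [ufX|uX]; last first.
  have : f X *m f (invmx X) = 1%:M by rewrite fM mulmxV.
  by case/mulmx1_unit.
(* The inverse of [f X] commutes with the same matrices, so it lies in the image of f and yields an
   inverse of X over L. *)
have : invmx (f X) \in cmx (block_mx B 0 0 B : 'M[F]_(2 + 2)).
  have : f X \in cmx (block_mx B 0 0 B : 'M[F]_(2 + 2)) by rewrite img imset_f.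
  rewrite !mem_cmx => /eqP E; apply/eqP; apply: (can_inj (mulKmx ufX)).
  by rewrite mulKVmx // mulmxA -E mulmxK.
rewrite img => /imsetP[Y _ E]; have : X *m Y = 1%:M.
  by apply: f_inj; rewrite -fM -E mulmxV.
by case/mulmx1_unit.
Qed.

End IrreducibleQuadratic.

Lemma kap_irr (F : finFieldType) (c b : F) m : (forall x, x * x != b * x + c) ->
  exists2 L : finFieldType, #|L| = (#|F| ^ 2)%N &
    kap m (double_comp c b : 'M[F]_4) = kap m (0 : 'M[L]_2).
Proof.
move=> nr; pose hI : monic_irreducible_poly _ := (quad_irr nr, quad_monic c b).
exists {poly %/ _ with hI}; first exact: quad_card.
by rewrite /kap !(wmx_irr nr).
Qed.

(** * Closed forms *)

Section ClosedForms.
Variables F : finFieldType.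
Local Notation q := (#|F|%:R : rat).

Lemma q_gt1 : 1 < q.
Proof. by rewrite ltr1n card_finNzRing_gt1. Qed.

Lemma q_gt0 : 0 < q.
Proof. exact: lt_trans ltr01 q_gt1. Qed.

Lemma q_neq0 : q != 0.
Proof. by rewrite gt_eqF ?q_gt0. Qed.

Lemma q1_neq0 : q - 1 != 0.
Proof. by rewrite subr_eq0 gt_eqF ?q_gt1. Qed.

Lemma q2_neq0 : q + 1 != 0.
Proof. by rewrite gt_eqF // addr_gt0 ?q_gt0. Qed.

Lemma natr_predq : (#|F|.-1)%:R = q - 1.
Proof. by rewrite -subn1 natrB // ltnW ?card_finNzRing_gt1. Qed.

Lemma natr_pred2q : (#|F|.-2)%:R = q - 2%:R.
Proof. by rewrite -subn2 natrB // card_finNzRing_gt1. Qed.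

Lemma natr_subqX i j : (j <= i)%N -> (#|F| ^ i - #|F| ^ j)%N%:R = q ^+ i - q ^+ j.
Proof.
move=> ij; rewrite natrB ?natrX // leq_pexp2l // ltnW ?card_finNzRing_gt1 //.
Qed.

Lemma natr_subq1 i : (#|F| ^ i - 1)%N%:R = q ^+ i - 1.
Proof. by rewrite -(natr_subqX (leq0n i)) expn0. Qed.

Lemma natr_subq i : (0 < i)%N -> (#|F| ^ i - #|F|)%N%:R = q ^+ i - q.
Proof. by move=> i0; rewrite -(natr_subqX i0) expn1. Qed.

Lemma ugl_GL n : ugl F n.-1.+1 = #|'GL_n[F]%g|.
Proof.
rewrite -(card_imset _ val_inj); apply: eq_card => g.
rewrite inE; apply/idP/imsetP => [ug|[h _ ->]]; last exact: GL_unitmx.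
by exists (Sub g ug); rewrite ?inE ?SubK.
Qed.

Lemma ugl2 : (ugl F 2)%:R = (q ^+ 2 - 1) * (q ^+ 2 - q).
Proof.
rewrite (ugl_GL 2) card_GL_2 !natrM natr_predq -natr1; ring.
Qed.

Lemma ncomm30E m : (ncomm (@rel30 F) m setT)%:R =
  1 + (q ^+ 2 + q + 1) * (q ^+ m - 1).
Proof.
elim: m => [|m IHm]; first by rewrite expr0 subrr mulr0 addr0.
rewrite ncomm30S natrD natrM IHm natr_subq1 natrX; rewrite (exprS _ m); ring.
Qed.

Lemma ncomm12E m : (ncomm (@rel12 F) m setT)%:R =
  1 + q ^+ 2 * (q ^+ m - 1) + ((q ^+ m) ^+ 2 - 1).
Proof.
elim: m => [|m IHm]; first by rewrite expr0 expr1n subrr mulr0 !addr0.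
rewrite ncomm12S !natrD !natrM IHm natr_subqX // natr_subq1 !natrX [(_ ^+ 2) ^+ m]exprAC !(exprS _ m).
by move: (q ^+ m) => x; ring.
Qed.

Lemma ncomm22E m : (ncomm (@rel22 F) m setT)%:R =
  1 + q ^+ 2 * (q + 1) * (q ^+ m - 1) + ((q ^+ m) ^+ 2 - 1).
Proof.
elim: m => [|m IHm]; first by rewrite expr0 expr1n subrr mulr0 !addr0.
rewrite ncomm22S !natrD !natrM IHm natr_subqX // natr_subq1 !natrX [(_ ^+ 2) ^+ m]exprAC !(exprS _ m).
by move: (q ^+ m) => x; ring.
Qed.

Lemma ncommM2E m : (ncomm comm_mxb m [set: 'M[F]_2])%:R =
  q ^+ m + (q ^+ 2 + q + 1) * ((q ^+ m) ^+ 2 - q ^+ m).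
Proof.
elim: m => [|m IHm]; first by rewrite expr0 expr1n subrr mulr0 !addr0.
rewrite /= (eq_bigl xpredT) => [|a]; last by rewrite inE.
rewrite (@sum_scalar_cases _ _ xpredT _ (ncomm comm_mxb m [set: 'M[F]_2])
   ((#|F| ^ 2) ^ m)%N).
- have -> : [set a : 'M[F]_2 | xpredT a & is_scalar_mx a] = [set a | is_scalar_mx a] by [].
  have -> : [set a : 'M[F]_2 | xpredT a & ~~ is_scalar_mx a] = [set a | ~~ is_scalar_mx a] by [].
  rewrite card_scalar_mx card_nonscalar_mx natrD !natrM IHm natr_subq // !natrX.
  by rewrite [(_ ^+ 2) ^+ m]exprAC !(exprS _ m); ring.
- by move=> _ /is_scalar_mxP[x ->]; rewrite -/(cmx _) cmx_scalar.
move=> a nsa; have [aC cardC _] := cmx_cyclic (cyclic2 nsa).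
by rewrite -/(cmx _) ncomm_abelian ?cardC // => u v Cu Cv; rewrite /comm_mxb aC.
Qed.

(** The solution of the recursion [ncomm_epsS] in terms of x = q^m. *)
Definition neps (x : rat) : rat := x ^+ 2 * (1 - q ^+ 2 * (q ^+ 2 + q + 1) * (x - 1) +
  (q ^+ 2 + q + 1) * q ^+ 2 * (x ^+ 2 - 1) + (x ^+ 3 - 1)).

Lemma ncomm_epsE m : (ncomm (@rel_eps F) m setT)%:R = neps (q ^+ m).
Proof.
rewrite /neps; elim: m => [|m IHm]; first by rewrite expr0 /=; ring.
rewrite ncomm_epsS !natrD !natrM !natrD !natrM IHm natr_subq // ncomm12E !natrX.
rewrite [(_ ^+ 3) ^+ m]exprAC [(_ ^+ 4) ^+ m]exprAC !(exprS _ m).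
by move: (q ^+ m) => x; ring.
Qed.

End ClosedForms.

Section ClosedForms2.
Variables F : finFieldType.
Local Notation q := (#|F|%:R : rat).

Lemma kap2E m : kap m (0 : 'M[F]_2) =
  (q ^+ m) ^+ 2 + q ^+ m * ((q ^+ m - 1) / (q - 1)).
Proof.
elim: m => [|m IHm]; first by rewrite kap0 expr0 subrr mul0r mulr0 addr0 expr1n.
rewrite kapS2 IHm mulnC exprM !(exprS _ m); have q1 := q1_neq0 F.
by move: (q ^+ m) q1 => x q1; field.
Qed.

Lemma natr_unit_pair i j : (0 < j <= i)%N ->
  (#|F|.-1 ^ 2 * #|F| ^ i - #|F|.-1 * #|F| ^ j)%N%:R = (q - 1) ^+ 2 * q ^+ i - (q - 1) * q ^+ j.
Proof.
case/andP=> j0 ji; rewrite natrB ?natrM ?natrX ?natr_predq //.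
have q0 : (1 < #|F|)%N := card_finNzRing_gt1 F.
apply: leq_mul; last by rewrite leq_pexp2l // ltnW.
by rewrite expnS expn1 leq_pmulr // -subn1 subn_gt0.
Qed.

Lemma kap_z21 m : kap m (rank1 3 0 : 'M[F]_3) =
  (q ^+ m) ^+ 2 * (q ^+ m + (q ^+ m - 1) * (q + 1) / (q * (q - 1))).
Proof.
have E k : (wmx k (rank1 3 0 : 'M[F]_3))%:R = (q ^+ k) ^+ 2 * (((q - 1) * q) *
    (1 + (q ^+ 2 + q + 1) * (q ^+ k - 1)) + ((q - 1) ^+ 2 * q ^+ 3 - (q - 1) * q) * q ^+ k) :> rat.
  rewrite wmx_z21 natrM !natrD !natrM ncomm30E (@natr_unit_pair 3 1) // !natrX natr_predq.
  by rewrite exprAC expr1.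
have E0 : (wmx 0 (rank1 3 0 : 'M[F]_3))%:R = (q - 1) ^+ 2 * q ^+ 3 :> rat by rewrite E expr0; ring.
rewrite /kap E0 E; have q1 := q1_neq0 F; have q0 := q_neq0 F.
by move: (q ^+ m) => x; field; rewrite q0 q1.
Qed.

Lemma kap_z31 m : kap m (singular_comp 0 0 : 'M[F]_4) =
  (q ^+ m) ^+ 3 * (q ^+ m + (q ^+ m - 1) * (q + 1) / (q * (q - 1))).
Proof.
have E k : (wmx k (singular_comp 0 0 : 'M[F]_4))%:R = (q ^+ k) ^+ 3 * (((q - 1) * q ^+ 2) *
    (1 + (q ^+ 2 + q + 1) * (q ^+ k - 1)) + ((q - 1) ^+ 2 * q ^+ 4 - (q - 1) * q ^+ 2) * q ^+ k) :> rat.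
  rewrite wmx_z31 natrM !natrD !natrM ncomm30E (@natr_unit_pair 4 2) // !natrX natr_predq.
  by rewrite exprAC.
have E0 : (wmx 0 (singular_comp 0 0 : 'M[F]_4))%:R = (q - 1) ^+ 2 * q ^+ 4 :> rat by rewrite E expr0; ring.
rewrite /kap E0 E; have q1 := q1_neq0 F; have q0 := q_neq0 F.
by move: (q ^+ m) => x; field; rewrite q0 q1.
Qed.

Lemma ugl2_gt : (#|F|.-1 <= ugl F 2)%N.
Proof.
rewrite -(ler_nat rat) ugl2 natr_predq.
have q0 : (1 < #|F|)%N := card_finNzRing_gt1 F.
have -> : (q ^+ 2 - 1) * (q ^+ 2 - q) = (q - 1) * (#|F|.-1 * #|F| * #|F|.+1)%N%:R.
  by rewrite !natrM natr_predq -natr1; ring.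
apply: ler_peMr; first by rewrite subr_ge0 ltW ?q_gt1.
rewrite ler1n !muln_gt0.
by rewrite -subn1 subn_gt0 q0 ltnW.
Qed.

Lemma kap_eps m : kap m (block_mx 0 1%:M 0 0 : 'M[F]_(2 + 2)) =
  ((q - 1) * (q * neps F (q ^+ m) + (q ^+ 4 - q) * ((q ^+ m) ^+ 3 *
     (1 + q ^+ 2 * (q ^+ m - 1) + ((q ^+ m) ^+ 2 - 1)))) +
     ((q ^+ 2 - 1) * (q ^+ 2 - q) - (q - 1)) * (q ^+ 4 * (q ^+ m) ^+ 4)) /
  ((q ^+ 2 - 1) * (q ^+ 2 - q) * q ^+ 4).
Proof.
have E k : (wmx k (block_mx 0 1%:M 0 0 : 'M[F]_(2 + 2)))%:R =
   (q - 1) * (q * neps F (q ^+ k) + (q ^+ 4 - q) * ((q ^+ k) ^+ 3 *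
     (1 + q ^+ 2 * (q ^+ k - 1) + ((q ^+ k) ^+ 2 - 1)))) +
     ((q ^+ 2 - 1) * (q ^+ 2 - q) - (q - 1)) * (q ^+ 4 * (q ^+ k) ^+ 4) :> rat.
  rewrite wmx_epsE natrD natrM natrD !natrM ncomm12E ncomm_epsE (natrB _ ugl2_gt).
  by rewrite natr_subq // ugl2 !natrX natr_predq ![(_ ^+ _) ^+ k]exprAC.
rewrite /kap !E; congr (_ / _); rewrite expr0 /neps; ring.
Qed.

End ClosedForms2.

Section Nilpotent211.
Variables F : finFieldType.
Local Notation q := (#|F|%:R : rat).

(** These are the closed forms, at x = q^m, of the counts for [rel12], [rel30], [rel22], for M_2(F)
    and for [rel8]. In [cntS8], which is [S8] at zero, z stands for the count of [rel8]. *)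
Definition cnt12 (x : rat) : rat := 1 + q ^+ 2 * (x - 1) + (x ^+ 2 - 1).
Definition cnt30 (x : rat) : rat := 1 + (q ^+ 2 + q + 1) * (x - 1).
Definition cnt22 (x : rat) : rat := 1 + q ^+ 2 * (q + 1) * (x - 1) + (x ^+ 2 - 1).
Definition cntM2 (x : rat) : rat := x + (q ^+ 2 + q + 1) * (x ^+ 2 - x).
Definition cnt8 (x : rat) : rat := 1 + (q + 1) * (x ^+ 3 - 1) +
  (q ^+ 6 + 2 * q ^+ 5 + 4 * q ^+ 4 + 3 * q ^+ 3 - q) * (x ^+ 2 - 1) -
  (q + 1) * q ^+ 3 * (2 * q ^+ 2 + 3 * q + 3) * (x - 1).
Definition cntS8 (z x : rat) := z + (q ^+ 2 - 1) * (x * cnt22 x) +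
  (q ^+ 2 - 1) * (x * cnt22 x + (q - 1) * (x * cnt12 x) + (q - 1) * q * (x * cnt30 x)).

Lemma sum_neq_const (y : F) (c : rat) : \sum_(x : F | x != y) c = (q - 1) * c.
Proof.
have card_neq : #|[pred x : F | x != y]| = #|F|.-1.
  by rewrite -(cardC1 y); apply: eq_card.
by rewrite sumr_const card_neq -[LHS]mulr_natl natr_predq.
Qed.

(** Stated for general phi to serve twice: phi = 1 gives the recursion for [rel8], and phi =
    [ucount] gives the count of units and tuples for the type (2,1,1). *)
Lemma sum_S8E (phi : 'M[F]_2 -> rat) m (p0 px pb0 pb z : rat) :
    (forall T T', sim T T' -> phi T = phi T') ->
    phi 0 = p0 -> (forall x, x != 0 -> phi x%:M = px) ->
    (forall b, phi (comp2 0 b) = if b == 0 then pb0 else pb) ->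
    z = (ncomm (@rel8 F) m setT)%:R ->
  let x := q ^+ m in
  \sum_(T : 'M[F]_2) phi T * (S8 m T)%:R =
    q ^+ 4 * x ^+ 2 * \sum_(T : 'M[F]_2) phi T + p0 * (cntS8 z x - q ^+ 4 * x ^+ 2)
  + (q - 1) * (px * (q ^+ 4 * (cntM2 x - x ^+ 2)))
  + ((q ^+ 2 - 1) * (pb0 * (q ^+ 2 * x * (cnt12 x - x)))
  + (q - 1) * (q * (q + 1) * (pb * (q ^+ 2 * x * (cnt30 x - x))))).
Proof.
move=> phi_sim phi0 phix phib -> x; rewrite sum_S8 //.
have -> : (#|F| ^ 4 * (#|F| ^ 2) ^ m)%N%:R = q ^+ 4 * x ^+ 2.
  by rewrite natrM !natrX exprAC.
rewrite phi0 S8_zero; congr (_ + _ + _ + _).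
- congr (_ * (_ - _)); rewrite !(natrD, natrM) ncomm22E ncomm12E ncomm30E natr_subq1 natrX.
  by rewrite natr_predq.
- rewrite (eq_bigr (fun=> px * (q ^+ 4 * (cntM2 x - x ^+ 2)))) => [|y y0].
    by rewrite sum_neq_const.
  rewrite phix // S8_scalar // natrM ncommM2E natrX; rewrite /cntM2 -/x; ring.
rewrite (bigD1 0) //=; congr (_ + _).
  rewrite phib eqxx S8_comp eqxx natrD !natrM ncomm12E /scount eqxx ugl2 natr_subqX //.
  rewrite !natrM natr_predq !natrX exprAC -/x -/(cnt12 x); have q1 := q1_neq0 F; have q0 := q_neq0 F.
  by move: (cnt12 x) => n; field; rewrite q0 q1.
rewrite (eq_bigr (fun=> q * (q + 1) * (pb * (q ^+ 2 * x * (cnt30 x - x))))) => [|b /negPf b0].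
  by rewrite sum_neq_const.
rewrite phib b0 S8_comp b0 natrD !natrM ncomm30E /scount b0 ugl2 natr_subqX //.
rewrite !natrX natr_predq exprAC -/x -/(cnt30 x); have q1 := q1_neq0 F.
by move: (cnt30 x) => n; field.
Qed.

Lemma ncomm8E m : (ncomm (@rel8 F) m setT)%:R = cnt8 (q ^+ m).
Proof.
elim: m => [|m IHm]; first by rewrite expr0 /cnt8 /=; ring.
rewrite ncomm8S natr_sum (eq_bigr (fun T : 'M[F]_2 => 1 * (S8 m T)%:R)) => [|T _]; last by rewrite mul1r.
rewrite (@sum_S8E (fun=> 1) m 1 1 1 1 _ _ _ _ _ (esym IHm)) // => [|b]; last by rewrite if_same.
rewrite sumr_const card_mx natrX.
rewrite (exprS _ m); move: (q ^+ m) => x; rewrite /cnt8 /cntS8 /cnt12 /cnt22 /cnt30 /cntM2; ring.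
Qed.

Lemma kap_z211 m : kap m (rank1 4 0 : 'M[F]_4) = let x := q ^+ m in
  x ^+ 2 * q * (q ^+ 4 * x ^+ 2 * ((q - 1) * ((q ^+ 2 - 1) * (q ^+ 2 - q)))
     + (q - 1) * (cntS8 (cnt8 x) x - q ^+ 4 * x ^+ 2)
     + (q - 1) * ((q - 2) * (q ^+ 4 * (cntM2 x - x ^+ 2)))
     + ((q ^+ 2 - 1) * ((q - 1) * (q ^+ 2 * x * (cnt12 x - x)))
     + (q - 1) * (q * (q + 1) * ((q - 2) * (q ^+ 2 * x * (cnt30 x - x)))))) /
  (q * q ^+ 4 * ((q - 1) * ((q ^+ 2 - 1) * (q ^+ 2 - q)))).
Proof.
pose W x := x ^+ 2 * q * (q ^+ 4 * x ^+ 2 * ((q - 1) * ((q ^+ 2 - 1) * (q ^+ 2 - q)))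
     + (q - 1) * (cntS8 (cnt8 x) x - q ^+ 4 * x ^+ 2)
     + (q - 1) * ((q - 2) * (q ^+ 4 * (cntM2 x - x ^+ 2)))
     + ((q ^+ 2 - 1) * ((q - 1) * (q ^+ 2 * x * (cnt12 x - x)))
     + (q - 1) * (q * (q + 1) * ((q - 2) * (q ^+ 2 * x * (cnt30 x - x)))))).
have E k : (wmx k (rank1 4 0 : 'M[F]_4))%:R = W (q ^+ k).
  rewrite wmx_z211E !natrM natr_sum !natrX exprAC mulrA; congr (_ * _).
  rewrite (eq_bigr (fun T : 'M[F]_2 => (ucount T)%:R * (S8 k T)%:R)) => [|T _]; last by rewrite natrM.
  rewrite (@sum_S8E (fun T => (ucount T)%:R) k (q - 1) (q - 2) (q - 1) (q - 2) (cnt8 (q ^+ k))).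
  - by rewrite -natr_sum sum_ucount natrM ugl2 natr_predq.
  - by move=> T T' TT'; rewrite (ucount_sim TT').
  - by rewrite ucount0 natr_predq.
  - by move=> y y0; rewrite ucount_scalar // natr_pred2q.
  - by move=> b; rewrite ucount_comp; case: eqP => _; rewrite ?natr_predq ?natr_pred2q.
  by rewrite ncomm8E.
rewrite /kap !E; congr (_ / _); rewrite expr0 /W /cnt8 /cntS8 /cnt12 /cnt22 /cnt30 /cntM2; ring.
Qed.

End Nilpotent211.

Section QuadraticSum.
Variables F : finFieldType.
Local Notation q := (#|F|%:R : rat).

Lemma quad_roots (x y t : F) : (t * t == (x + y) * t - x * y) = (t \in pred2 x y).
Proof.
rewrite -subr_eq0 (_ : _ - _ = (t - x) * (t - y)); last by ring.
by rewrite mulf_eq0 !subr_eq0 !inE.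
Qed.

(** The excess phi - C is shared equally among the roots of t^2 - b t - c, and vanishes if there are
    none. The sum over quadratics with a chosen root then becomes a free sum over ordered pairs of
    roots. *)
Lemma sum_quadratics (phi : F -> F -> rat) (A B C : rat) :
    (forall x y, x != y -> phi (- (x * y)) (x + y) = A) ->
    (forall x, phi (- (x * x)) (x + x) = B) ->
    (forall c b, (forall x, x * x != b * x + c) -> phi c b = C) ->
  \sum_c \sum_b phi c b =
    q * (q - 1) / 2 * A + q * B + q * (q - 1) / 2 * C.
Proof.
move=> phiA phiB phiC.
pose r c b := #|[pred x : F | x * x == b * x + c]|.
pose psi c b := (phi c b - C) / (r c b)%:R.
have phiE c b : phi c b = C + \sum_(x | x * x == b * x + c) psi c b.
  rewrite sumr_const -[#|_|]/(r c b) -mulr_natr /psi.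
  have [r0|r0] := eqVneq (r c b) 0%N; last by rewrite divfK ?pnatr_eq0 // addrC subrK.
  rewrite r0 mulr0 addr0 phiC // => x; apply/negP => xE.
  by move/eqP: r0; rewrite -leqn0 leqNgt => /negP[]; apply/card_gt0P; exists x.
rewrite (eq_bigr (fun c => C * q + \sum_b \sum_(x | x * x == b * x + c) psi c b)); last first.
  move=> c _; rewrite (eq_bigr _ (fun b _ => phiE c b)) big_split /= sumr_const.
  by rewrite mulr_natr.
rewrite big_split /= sumr_const -[_ *+ _]mulr_natr.
have -> : \sum_c \sum_b \sum_(x | x * x == b * x + c) psi c b =
    \sum_x \sum_y psi (- (x * y)) (x + y).
  under eq_bigr => c _ do rewrite (exchange_big_dep xpredT) //=.
  rewrite exchange_big /=; apply: eq_bigr => x _.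
  under eq_bigr => c _ do rewrite big_mkcond /=.
  (* The other root y = b - x replaces b, after which c = - x y is forced. *)
  rewrite exchange_big /= (reindex_inj (addrI x)) /=; apply: eq_bigr => y _.
  rewrite -big_mkcond (big_pred1 (- (x * y))) // => c.
  rewrite /= -subr_eq0 -[RHS]subr_eq0 -[RHS]oppr_eq0; congr (_ == 0); ring.
have -> : \sum_x \sum_y psi (- (x * y)) (x + y) = \sum_(x : F) ((B - C) + (q - 1) * ((A - C) / 2)).
  apply: eq_bigr => x _; rewrite (bigD1 x) //=.
  have rE y : r (- (x * y)) (x + y) = (x != y).+1.
    rewrite -[RHS](card2 x y); apply: eq_card => t; rewrite -quad_roots inE.
    by [].
  rewrite {1}/psi rE eqxx phiB divr1; congr (_ + _).
  rewrite (eq_bigr (fun=> (A - C) / 2)) => [|y yx].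
    by rewrite sum_neq_const.
  by rewrite /psi rE eq_sym yx phiA // eq_sym.
by rewrite sumr_const -[_ *+ #|F|]mulr_natl; field.
Qed.

End QuadraticSum.

Section ClosedForms3.
Variables F : finFieldType.
Local Notation q := (#|F|%:R : rat).

Lemma sum_double_comp m : let x := q ^+ m in
  \sum_c \sum_b kap m (double_comp c b : 'M[F]_4) =
    q * (q - 1) / 2 * (x ^+ 2 + x * ((x - 1) / (q - 1))) ^+ 2 +
    q * kap m (block_mx 0 1%:M 0 0 : 'M[F]_(2 + 2)) +
    q * (q - 1) / 2 * (x ^+ 4 + x ^+ 2 * ((x ^+ 2 - 1) / (q ^+ 2 - 1))).
Proof.
move=> x; apply: sum_quadratics => [y z yz|y|c b irr].
- by rewrite kap_double_split // kap2E.
- exact: kap_double_double.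
have [L cardL ->] := kap_irr m irr.
by rewrite kap2E cardL natrX [(_ ^+ 2) ^+ m]exprAC -/x -exprM.
Qed.

End ClosedForms3.

(** * Orbit numbers in Gaussian binomials *)

Definition br (q x : rat) := (x - 1) / (q - 1).
(** At x = q^k, [br] is the Gaussian integer [k], and [br2], [br3] are the Gaussian binomials of k
    over 2 and 3, since x / q^i = q^(k - i). *)
Definition br2 (q x : rat) := br q x * br q (x / q) / (q + 1).
Definition br3 (q x : rat) := br2 q x * br q (x / q ^+ 2) / (q ^+ 2 + q + 1).

Definition orb2 (q x : rat) := x ^+ 2 + x * br q x.
Definition orb3 (q x : rat) :=
  x ^+ 3 + x ^+ 2 * br q x + x * (br q x * x / q + 2 * br2 q x).
Definition orb4 (q x : rat) :=
  x ^+ 4 + x ^+ 3 * br q x + (br q x ^+ 2 + br (q ^+ 2) (x ^+ 2)) / 2 * x ^+ 2 +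
  x ^+ 2 * (br q x * x / q + 2 * br2 q x) +
  x * (br q x * x ^+ 2 / q ^+ 2 + 2 * br3 q x +
    br2 q x * (q ^+ 2 + 2 * q + 2) * (x / q ^+ 2) +
    br2 q x * (br q (x / q) + q * br (q ^+ 2) ((x / q) ^+ 2))).

Section ClosedForms3.
Variables F : finFieldType.
Local Notation q := (#|F|%:R : rat).

Lemma q3_neq0 : q ^+ 2 + q + 1 != 0.
Proof. by rewrite gt_eqF // !addr_gt0 ?exprn_gt0 ?q_gt0. Qed.

Lemma qq1_neq0 : q ^+ 2 - 1 != 0.
Proof.
rewrite (_ : _ - _ = (q - 1) * (q + 1)); last by ring.
by rewrite mulf_neq0 ?q1_neq0 ?q2_neq0.
Qed.

Lemma kap3E m : kap m (0 : 'M[F]_3) = orb3 q (q ^+ m).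
Proof.
have q0 := q_neq0 F; have q1 := q1_neq0 F; have q2 := q2_neq0 F.
rewrite /orb3 /br2 /br; elim: m => [|m IHm].
  by rewrite kap0 expr0; field; rewrite q0 q2 q1.
rewrite kapS3 IHm (bigD1 0) //= kap_z21.
rewrite (eq_bigr (fun=> kap m (0 : 'M[F]_2) * q ^+ m)) => [|b]; last exact: kap_rank1_3.
rewrite sum_neq_const kap2E [(3 * m)%N]mulnC exprM !(exprS _ m).
by move: (q ^+ m) => x; field; rewrite q0 q1 q2.
Qed.

Lemma sum_rank1_4 m : \sum_b kap m (rank1 4 b : 'M[F]_4) =
  kap m (rank1 4 0 : 'M[F]_4) + (q - 1) * (orb3 q (q ^+ m) * q ^+ m).
Proof.
rewrite (bigD1 0) //=; congr (_ + _); rewrite -(sum_neq_const (0 : F)).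
by apply: eq_bigr => b b0; rewrite kap_rank1_4 // kap3E.
Qed.

Lemma sum_singular_comp m : let x := q ^+ m in
  \sum_c \sum_b kap m (singular_comp c b : 'M[F]_4) =
  x ^+ 3 * (x + (x - 1) * (q + 1) / (q * (q - 1))) +
  (q - 1) * (x ^+ 2 * (x + (x - 1) * (q + 1) / (q * (q - 1))) * x) +
  (q - 1) * (q * ((x ^+ 2 + x * ((x - 1) / (q - 1))) * x ^+ 2)).
Proof.
move=> x; rewrite (bigD1 0) //=; congr (_ + _); last first.
  rewrite -(sum_neq_const (0 : F)); apply: eq_bigr => c c0.
  rewrite (eq_bigr _ (fun b _ => kap_singular_comp m b c0)).
  by rewrite sumr_const kap2E mulnC exprM -/x -[LHS]mulr_natl.
rewrite (bigD1 0) //= kap_z31; congr (_ + _); rewrite -(sum_neq_const (0 : F)).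
by apply: eq_bigr => b b0; rewrite kap_singular_comp0 // kap_z21.
Qed.

(** With the contributions of all families inserted into [kapS4], the induction step is an identity
    of rational functions in q and x = q^m. *)
Lemma kap4E m : kap m (0 : 'M[F]_4) = orb4 q (q ^+ m).
Proof.
have q0 := q_neq0 F; have q1 := q1_neq0 F; have q2 := q2_neq0 F; have q3 := q3_neq0.
have qq := qq1_neq0.
rewrite /orb4 /br3 /br2 /br; elim: m => [|m IHm].
  by rewrite kap0 expr0; field; rewrite q0 q2 q1 q3 qq.
rewrite kapS4 IHm sum_rank1_4 sum_double_comp sum_singular_comp kap_z211 kap_eps.
rewrite /orb3 /br2 /br /neps /cntS8 /cnt8 /cnt12 /cnt22 /cnt30 /cntM2.
rewrite [(4 * m)%N]mulnC exprM !(exprS _ m).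
(* With factored denominators, the side conditions of [field] are the nonvanishing of q, q - 1, q +
   1 and q^2 + q + 1. *)
have -> : q ^+ 2 - q = q * (q - 1) by ring.
have -> : q ^+ 2 - 1 = (q - 1) * (q + 1) by ring.
by move: (q ^+ m) => x; field; rewrite q0 q1 q2 q3.
Qed.

End ClosedForms3.

(** * Polynomials *)

Definition brp k : {poly int} := \sum_(i < k) 'X^i.
Definition brsqp k : {poly int} := \sum_(i < k) 'X^(2 * i).
(** The Gaussian binomial of k + 1 over 2, that is, the complete symmetric polynomial of degree 2 in
    1, q, ..., q^(k-1). It absorbs the division by 2 in [orb4]. *)
Fixpoint h2p k : {poly int} := if k is k'.+1 then h2p k' + 'X^k' * brp k else 0.
(** The q-Pascal rule, here and in [br3p]. Wherever the exponent is truncated, the factor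
    multiplying it is zero. *)
Fixpoint br2p k : {poly int} := if k is k'.+1 then br2p k' + 'X^(k' - 1) * brp k' else 0.
Fixpoint br3p k : {poly int} := if k is k'.+1 then br3p k' + 'X^(k' - 2) * br2p k' else 0.

Definition orb2p k : {poly int} := 'X^(2 * k) + 'X^k * brp k.
Definition orb3p k : {poly int} :=
  'X^(3 * k) + 'X^(2 * k) * brp k + 'X^k * ('X^(k.-1) * brp k + br2p k *+ 2).
Definition orb4p k : {poly int} :=
  'X^(4 * k) + 'X^(3 * k) * brp k + 'X^(2 * k) * h2p k +
  'X^(2 * k) * ('X^(k.-1) * brp k + br2p k *+ 2) +
  'X^k * ('X^(2 * k.-1) * brp k + br3p k *+ 2 +
    'X^(k - 2) * br2p k * ('X^2 + 'X *+ 2 + 1 *+ 2) +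
    br2p k * (brp k.-1 + 'X * brsqp k.-1)).

Definition nonneg_coef (p : {poly int}) := forall i, 0 <= p`_i.

Lemma nonneg_coefD p r : nonneg_coef p -> nonneg_coef r -> nonneg_coef (p + r).
Proof. by move=> p0 r0 i; rewrite coefD addr_ge0. Qed.

Lemma nonneg_coefM p r : nonneg_coef p -> nonneg_coef r -> nonneg_coef (p * r).
Proof. by move=> p0 r0 i; rewrite coefM sumr_ge0 // => j _; rewrite mulr_ge0. Qed.

Lemma nonneg_coefMn p n : nonneg_coef p -> nonneg_coef (p *+ n).
Proof. by move=> p0 i; rewrite coefMn mulrn_wge0. Qed.

Lemma nonneg_coefXn n : nonneg_coef 'X^n.
Proof. by move=> i; rewrite coefXn ler0n. Qed.

Lemma nonneg_coef0 : nonneg_coef 0.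
Proof. by move=> i; rewrite coef0. Qed.

Ltac nonneg := repeat first
  [ assumption | apply: nonneg_coef0 | apply: nonneg_coefXn | apply: nonneg_coefMn
  | apply: nonneg_coefD | apply: nonneg_coefM ].

Lemma brp_nonneg k : nonneg_coef (brp k).
Proof. by apply: big_ind => [|p r|j _]; nonneg. Qed.

Lemma brsqp_nonneg k : nonneg_coef (brsqp k).
Proof. by apply: big_ind => [|p r|j _]; nonneg. Qed.

Lemma h2p_nonneg k : nonneg_coef (h2p k).
Proof. elim: k => [|k IHk] /=; nonneg; exact: brp_nonneg. Qed.

Lemma br2p_nonneg k : nonneg_coef (br2p k).
Proof. elim: k => [|k IHk] /=; nonneg; exact: brp_nonneg. Qed.

Lemma br3p_nonneg k : nonneg_coef (br3p k).
Proof. elim: k => [|k IHk] /=; nonneg; exact: br2p_nonneg. Qed.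

Lemma orb2p_nonneg k : nonneg_coef (orb2p k).
Proof. by rewrite /orb2p; nonneg; apply: brp_nonneg. Qed.

Lemma orb3p_nonneg k : nonneg_coef (orb3p k).
Proof. have := (brp_nonneg k, br2p_nonneg k) => -[? ?]; rewrite /orb3p; nonneg. Qed.

Lemma orb4p_nonneg k : nonneg_coef (orb4p k).
Proof.
have pX : nonneg_coef 'X by apply: (nonneg_coefXn 1).
have p1 : nonneg_coef 1 by apply: (nonneg_coefXn 0).
have [B [C D]] := (brsqp_nonneg k.-1, (brp_nonneg k.-1, brp_nonneg k)).
have [E [G H]] := (h2p_nonneg k, (br2p_nonneg k, br3p_nonneg k)).
rewrite /orb4p; nonneg.
Qed.

Section Evaluation.
Variable F : finFieldType.
Local Notation q := (#|F|%:R : rat).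

Definition evq (p : {poly int}) : rat := (p.[#|F|%:Z])%:~R.

Lemma evqX : evq 'X = q. Proof. by rewrite /evq hornerX. Qed.
Lemma evqXn n : evq 'X^n = q ^+ n. Proof. by rewrite /evq hornerXn rmorphXn. Qed.
Lemma evqD p r : evq (p + r) = evq p + evq r. Proof. by rewrite /evq hornerD rmorphD. Qed.
Lemma evqM p r : evq (p * r) = evq p * evq r. Proof. by rewrite /evq hornerM rmorphM. Qed.
Lemma evqMn p n : evq (p *+ n) = evq p *+ n. Proof. by rewrite /evq hornerMn rmorphMn. Qed.
Lemma evq1 : evq 1 = 1. Proof. by rewrite /evq hornerC. Qed.
Lemma evq0 : evq 0 = 0. Proof. by rewrite /evq hornerC. Qed.

Definition evqE := (evqX, evqXn, evqD, evqM, evqMn, evq1).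

Lemma evq_brp k : evq (brp k) = br q (q ^+ k).
Proof.
have q1 := q1_neq0 F.
elim: k => [|k IHk]; first by rewrite /brp big_ord0 evq0 /br expr0 subrr mul0r.
by rewrite /brp big_ord_recr /= -/(brp k) evqD IHk evqXn /br exprS; field.
Qed.

Lemma evq_brsqp k : evq (brsqp k) = br (q ^+ 2) ((q ^+ k) ^+ 2).
Proof.
have q1 := qq1_neq0 F.
elim: k => [|k IHk]; first by rewrite /brsqp big_ord0 evq0 /br expr0 expr1n subrr mul0r.
rewrite /brsqp big_ord_recr /= -/(brsqp k) evqD IHk evqXn /br mulnC exprM (exprS _ k).
by field.
Qed.

Lemma evq_h2p k : evq (h2p k) = (br q (q ^+ k) ^+ 2 + br (q ^+ 2) ((q ^+ k) ^+ 2)) / 2.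
Proof.
have q1 := q1_neq0 F; have q2 := q2_neq0 F.
have q12 : q ^+ 2 - 1 = (q - 1) * (q + 1) by ring.
elim: k => [|k IHk]; first by rewrite evq0 /br expr0 q12; field; rewrite q1 q2.
rewrite [h2p _]/= !evqE IHk evq_brp /br q12 (exprS _ k).
by field; rewrite q1 q2.
Qed.

Lemma expr_predM k : q ^+ (k - 1) * br q (q ^+ k) = q ^+ k / q * br q (q ^+ k).
Proof.
case: k => [|k]; first by rewrite /br expr0 subrr mul0r !mulr0.
by rewrite subn1 exprS mulrC [q * _]mulrC mulfK ?q_neq0 // mulrC.
Qed.

(** For k < 2 the truncated exponent is harmless because [br2] vanishes. *)
Lemma expr_pred2M k : q ^+ (k - 2) * br2 q (q ^+ k) = q ^+ k / q ^+ 2 * br2 q (q ^+ k).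
Proof.
case: k => [|[|k]].
- by rewrite /br2 /br expr0 subrr !mul0r !mulr0.
- by rewrite /br2 /br expr1 (divff (q_neq0 F)) subrr !(mul0r, mulr0).
rewrite subn2 [k.+2.-2]/=; congr (_ * _); by rewrite -addn2 exprD mulfK ?expf_neq0 ?q_neq0.
Qed.

Lemma evq_br2p k : evq (br2p k) = br2 q (q ^+ k).
Proof.
have q0 := q_neq0 F; have q1 := q1_neq0 F; have q2 := q2_neq0 F.
elim: k => [|k IHk]; first by rewrite evq0 /br2 /br expr0 subrr !mul0r.
rewrite [br2p _]/= !evqE IHk evq_brp expr_predM /br2 /br (exprS _ k).
by field; rewrite q0 q1 q2.
Qed.

Lemma evq_br3p k : evq (br3p k) = br3 q (q ^+ k).
Proof.
have q0 := q_neq0 F; have q1 := q1_neq0 F; have q2 := q2_neq0 F; have q3 := q3_neq0 F.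
elim: k => [|k IHk]; first by rewrite evq0 /br3 /br2 /br expr0 subrr !mul0r.
rewrite [br3p _]/= !evqE IHk evq_br2p expr_pred2M /br3 /br2 /br (exprS _ k).
by field; rewrite q0 q1 q2 q3.
Qed.

Lemma evq_orb2p k : evq (orb2p k) = orb2 q (q ^+ k).
Proof. by rewrite /orb2p !evqE evq_brp mulnC exprM. Qed.

Lemma expr_predn k : (0 < k)%N -> q ^+ k.-1 = q ^+ k / q.
Proof. by case: k => // k _; rewrite exprS mulrC mulKf ?q_neq0. Qed.

Lemma evq_orb3p k : (0 < k)%N -> evq (orb3p k) = orb3 q (q ^+ k).
Proof.
move=> k0; rewrite /orb3p !evqE evq_brp evq_br2p expr_predn // /orb3.
by rewrite mulnC exprM [(2 * k)%N]mulnC exprM; ring.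
Qed.

Lemma evq_orb4p k : (0 < k)%N -> evq (orb4p k) = orb4 q (q ^+ k).
Proof.
move=> k0; rewrite /orb4p !evqE !evq_brp evq_brsqp evq_br2p evq_br3p evq_h2p.
rewrite expr_pred2M /orb4 ![(_ * k)%N]mulnC [(2 * _)%N]mulnC !exprM expr_predn //.
have q0 := q_neq0 F.
by field.
Qed.

End Evaluation.

Lemma kap_num_orbits (F : finFieldType) n k :
  kap k (0 : 'M[F]_n.-1.+1) = (num_commuting_orbits F n k)%:R.
Proof.
rewrite /kap -ugl_wmx /wmx cmx0 -num_commuting_orbits_wcomm -ugl_GL natrM mulfK //.
exact: ugl_neq0.
Qed.

Theorem theorem1p5 (n k : nat) (hn : n \in [:: 2; 3; 4]%N) (hk : (1 <= k)%N) :
  exists Q : {poly int},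
    (forall i : nat, 0 <= Q`_i) /\
    (forall F : finFieldType,
       (num_commuting_orbits F n k)%:Z = Q.[#|F|%:Z]).
Proof.
(* The equality is proved in the rationals, where the closed forms live, and pulled back to the
   integers. *)
suff [Q Qnn QE] : exists2 Q : {poly int}, nonneg_coef Q &
    forall F : finFieldType, (num_commuting_orbits F n k)%:R = evq F Q.
  exists Q; split=> // F.
  by apply: (@intr_inj rat); rewrite -[RHS]/(evq F Q) -QE.
move: hn; rewrite !inE => /or3P[] /eqP->.
- exists (orb2p k) => [|F]; first exact: orb2p_nonneg.
  by rewrite -kap_num_orbits kap2E evq_orb2p.
- exists (orb3p k) => [|F]; first exact: orb3p_nonneg.
  by rewrite -kap_num_orbits kap3E evq_orb3p.
exists (orb4p k) => [|F]; first exact: orb4p_nonneg.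
by rewrite -kap_num_orbits kap4E evq_orb4p.
Qed.
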